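(* Under the standing assumptions below: (a) $\Gamma\text{-}\lim_{k\to\infty}S_k=S$ in $C_b(\mathbb{R}^{2d})'$ (weak-* topology) and in $\mathcal{P}(\mathbb{R}^{2d})$ (narrow topology); (b) $\Gamma\text{-}\lim_{k\to\infty}T_k=T$ in $C_b(\mathbb{R}^d)'$ and in $\mathcal{P}(\mathbb{R}^d)$; (c) consequently, for every $\nu\in\mathcal{P}(\mathbb{R}^d)$ there is a sequence $(\nu_k)$ in $\mathcal{P}(\mathbb{R}^d)$ with $\nu_k\to\nu$ narrowly and $\lim_{k\to\infty}T_k(\nu_k)=T(\nu)$ in $[0,\infty]$.
   Context: $\Gamma$-limit: for functions $f_k$ on a topological space, $\Gamma\text{-}\lim f_k(x)=\sup_{V\in\mathcal{N}(x)}\lim_k\inf_{y\in V}f_k(y)$ when this limit exists ($\mathcal{N}(x)$ the neighbourhoods of $x$). Standing assumptions: $\mu\in\mathcal{P}(\mathbb{R}^d)$; for each $z\in\mathbb{R}^d$, $\mathbb{R}^d$-valued random variables $\{U^k_z\}_{k\ge1}$; for each $k$, $(\mathrm{Law}(U^k_z))_{z}$ is a Feller system ($z\mapsto\mathbb{E}f(U^k_z)$ continuous for all bounded continuous $f$); for each $z$, $\{U^k_z\}_k$ obeys the $k$-LDP in $\mathbb{R}^d$ with good (compact level sets) rate function $c_z$; also there is a triangular array $z_{n,i}$ with $\frac1n\sum_{i\le n}\delta_{z_{n,i}}\to\mu$. $c(x_0,x_1)=c_{x_0}(x_1)$; $\pi^k(dx_0dx_1)=\mu(dx_0)\mathrm{Law}(U^k_{x_0})(dx_1)$;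 $H$ is relative entropy. Functions (defined on $C_b'$, with value $+\infty$ off probability measures): $S_k(\rho)=\frac1kH(\rho|\pi^k)$ if $\rho_0=\mu$, $+\infty$ otherwise; $S(\rho)=\int c\,d\rho$ if $\rho_0=\mu$, $+\infty$ otherwise; $T_k(\nu)=\inf_{\rho\in\Pi(\mu,\nu)}\frac1kH(\rho|\pi^k)$; $T(\nu)=\inf_{\rho\in\Pi(\mu,\nu)}\int c\,d\rho$, where $\Pi(\mu,\nu)$ is the set of probability measures on $\mathbb{R}^{2d}$ with marginals $\mu,\nu$. *)

(* Defs.v *)
From HB Require Import structures.
From mathcomp Require Import all_boot all_order all_algebra.
From mathcomp Require Import all_classical all_reals all_analysis.
Set Implicit Arguments. Unset Strict Implicit. Unset Printing Implicit Defensive.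
Import Order.TTheory GRing.Theory Num.Theory.
Import numFieldNormedType.Exports.
Local Open Scope classical_set_scope.
Local Open Scope ring_scope.

(* MathComp + MathComp-Analysis, over an abstract R : realType.
   R^d is 'rV[R]_d (norm topology), R^{2d} is 'rV[R]_d * 'rV[R]_d (product
   topology).  Sequences indexed by k >= 1 in the paper are indexed here by
   n : nat with k = n.+1. *)

(* products of pointed topological spaces are pointed topological spaces
   (both structures already exist on T * U; this only declares their join) *)
HB.instance Definition _ (T U : ptopologicalType) := Pointed.on (T * U)%type.

Section Defs.
Context {R : realType}.

Definition Borel (T : ptopologicalType) := g_sigma_algebraType (@open T).

Definition Cb (T : topologicalType) : set (T -> R) :=
  [set f | continuous f /\ exists M : R, forall x, `|f x| <= M].

Definition weak_nbhs (X I : Type) (D : set I) (F : I -> X -> R) (x : X)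
  : set (set X) :=
  [set V | exists (A : set I) (e : R),
     [/\ finite_set A, A `<=` D, 0 < e &
         [set y | forall i, A i -> `|F i y - F i x| < e] `<=` V]].

Definition Gliminf (X : Type) (N : X -> set (set X)) (f : nat -> X -> \bar R)
  (x : X) : \bar R :=
  ereal_sup [set limn_einf (fun k => ereal_inf (f k @` V)) | V in N x].

Definition Glimsup (X : Type) (N : X -> set (set X)) (f : nat -> X -> \bar R)
  (x : X) : \bar R :=
  ereal_sup [set limn_esup (fun k => ereal_inf (f k @` V)) | V in N x].

Definition Gamma_lim (X : Type) (N : X -> set (set X)) (f : nat -> X -> \bar R)
  (g : X -> \bar R) : Prop :=
  forall x, Gliminf N f x = g x /\ Glimsup N f x = g x.

Definition integ (T : ptopologicalType) (P : probability (Borel T) R)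
  (f : T -> R) : R := fine (\int[P]_x (f x)%:E).

Definition narrow_nbhs (T : ptopologicalType) :
  probability (Borel T) R -> set (set (probability (Borel T) R)) :=
  weak_nbhs (@Cb T) (fun f P => integ P f).

(* C_b(T)': bounded linear functionals on C_b(T) (sup norm); normalised to
   vanish outside C_b(T) so that each functional has a unique representative *)
Definition isCbDual (T : topologicalType) (L : (T -> R) -> R) : Prop :=
  [/\ forall (f g : T -> R) (a b : R), Cb f -> Cb g ->
        L (fun x => a * f x + b * g x) = a * L f + b * L g,
      exists C : R, forall (f : T -> R) (M : R), Cb f ->
        (forall x, `|f x| <= M) -> `|L f| <= C * M
    & forall f, ~ Cb f -> L f = 0].

Definition CbDual (T : topologicalType) := {L : (T -> R) -> R | isCbDual L}.

Definition weakstar_nbhs (T : topologicalType) :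
  CbDual T -> set (set (CbDual T)) :=
  weak_nbhs (@Cb T) (fun f (L : CbDual T) => proj1_sig L f).

Definition represents (T : ptopologicalType) (L : CbDual T)
  (P : probability (Borel T) R) : Prop :=
  forall f, Cb f -> proj1_sig L f = integ P f.

(* extension of a function on P(T) to C_b(T)', +oo off probability measures *)
Definition to_dual (T : ptopologicalType) (F : probability (Borel T) R -> \bar R)
  (L : CbDual T) : \bar R :=
  ereal_inf [set F P | P in [set P | represents L P]].

(* relative entropy H(P|Q) = int f ln f dQ if P = f Q, +oo otherwise *)
Definition relent (dT : measure_display) (T : measurableType dT)
  (P Q : probability T R) : \bar R :=
  ereal_inf [set (\int[Q]_x (f x * ln (f x))%:E)%E |
     f in [set f : T -> R | [/\ measurable_fun setT f, forall x, 0 <= f x &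
        forall A, measurable A -> P A = (\int[Q]_(x in A) (f x)%:E)%E]]].

Definition good_rate (T : topologicalType) (I : T -> \bar R) : Prop :=
  [/\ forall x, (0 <= I x)%E,
      forall a : R, closed [set x | (I x <= a%:E)%E]
    & forall a : R, compact [set x | (I x <= a%:E)%E]].

Definition kLDP (T : ptopologicalType) (P : nat -> probability (Borel T) R)
  (I : T -> \bar R) : Prop :=
  (forall F : set T, closed F ->
     (limn_esup (fun n => (n.+1%:R^-1)%:E * lne (P n F)) <=
       - ereal_inf (I @` F))%E) /\
  (forall G : set T, open G ->
     (- ereal_inf (I @` G) <=
       limn_einf (fun n => (n.+1%:R^-1)%:E * lne (P n G)))%E).

Definition feller (T : ptopologicalType) (K : T -> probability (Borel T) R)
  : Prop :=
  forall f, Cb f -> continuous (fun z => integ (K z) f).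

Section Transport.
Variable d : nat.
Local Notation Rd := 'rV[R]_d.

Definition marg1 (rho : probability (Borel (Rd * Rd)%type) R)
  (mu : probability (Borel Rd) R) : Prop :=
  forall A : set (Borel Rd), measurable A -> rho (A `*` setT) = mu A.

Definition marg2 (rho : probability (Borel (Rd * Rd)%type) R)
  (nu : probability (Borel Rd) R) : Prop :=
  forall B : set (Borel Rd), measurable B -> rho (setT `*` B) = nu B.

Variables (mu : probability (Borel Rd) R)
  (pik : nat -> probability (Borel (Rd * Rd)%type) R) (c : Rd -> Rd -> \bar R).

Definition Sk (n : nat) (rho : probability (Borel (Rd * Rd)%type) R) : \bar R :=
  if `[< marg1 rho mu >] then ((n.+1%:R^-1)%:E * relent rho (pik n))%E
  else +oo%E.

Definition Sc (rho : probability (Borel (Rd * Rd)%type) R) : \bar R :=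
  if `[< marg1 rho mu >] then (\int[rho]_p c p.1 p.2)%E else +oo%E.

Definition Tk (n : nat) (nu : probability (Borel Rd) R) : \bar R :=
  ereal_inf [set ((n.+1%:R^-1)%:E * relent rho (pik n))%E |
             rho in [set rho | marg1 rho mu /\ marg2 rho nu]].

Definition Tc (nu : probability (Borel Rd) R) : \bar R :=
  ereal_inf [set (\int[rho]_p c p.1 p.2)%E |
             rho in [set rho | marg1 rho mu /\ marg2 rho nu]].

End Transport.
End Defs.

(* Main.v *)
(* For a bounded continuous F on R^d x R^d put
     lam_k F x = (1/k) ln E exp (k F (x, U^k_x)),   phi_k F = int lam_k F dmu.
   By Varadhan's lemma and dominated convergence phi_k F tends to
   phi F = int Lam F dmu, where Lam F x = sup_y (F (x, y) - c (x, y)).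

   Lower bound and equicoercivity.  If S_k P <= a, the variational formula for
   the entropy tested against k (F - lam_k F) gives P F <= a + phi_k F.  Hence a
   limit L in C_b' of such P satisfies L F <= a + phi F for all F.  Dini's
   theorem on the compact sublevel sets of c_x turns this into sigma-smoothness
   of L, so that L is a probability rho (Daniell); its first marginal is mu.
   Moreover c = sup_j (h_j - Lam h_j) over a countable family of tent functions
   h_j of the second variable; as Lam h_j is an L^1 (mu) limit of the functions
   lam_m h_j, which are continuous by the Feller property, finite maxima of
   these differences are approximated by admissible test functions F with
   phi F small, and int c drho <= a follows.

   Upper bound.  Given rho and finitely many test functions f_i, let l minimise
   the finite-dimensional objective
     phi_k (sum_i l_i f_i) - sum_i l_i rho f_i + (th / 2) |l|^2.
   The measure P with density exp (k (F - lam_k F)), F = sum_i l_i f_i, satisfies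
   P f_i - rho f_i = - th l_i, and S_k P <= - objective.  Since
   rho F - phi F <= int c drho, the latter is asymptotically at most int c drho,
   which also makes th |l| small.  No disintegration of rho is needed.

   The statements for T_k follow by testing only with functions of the second
   variable, a limit of the couplings being extracted along an ultrafilter. *)
Require Import Defs.
From HB Require Import structures.
From mathcomp Require Import all_boot all_order all_algebra.
From mathcomp Require Import all_classical all_reals all_analysis.
From mathcomp Require Import measurable_realfun ring lra.
Import Order.TTheory GRing.Theory Num.Theory.
Import numFieldNormedType.Exports.
Local Open Scope classical_set_scope.
Local Open Scope ring_scope.
Set Implicit Arguments. Unset Strict Implicit. Unset Printing Implicit Defensive.


(** * Bounded continuous and bounded measurable functions *)

(** Two obstacles shape the proof. Balls of [C_b'] are weak-* compact, but a limit of probabilities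
    there may be only finitely additive, and neighbourhood bases are in general uncountable. So
    limits are taken along ultrafilters, and countable additivity has to come out of the entropy
    bound; this is where goodness of the rate functions enters. Secondly, a recovery measure must
    fit finitely many integrals at bounded entropy, while the unregularised dual problem need not
    attain its minimum. The quadratic term makes the objective coercive at a rate independent of
    [k]: minimisers stay in a fixed box, on which [phi_k] converges uniformly thanks to a common
    Lipschitz constant. The price is the defect [th l_i], controlled because [th |l|^2 / 2] is
    eventually at most the cost plus [eta]. All four Gamma-limits are instances of one statement
    about infima of [S_k] over the couplings lifting a given point. The sequence in (c) is a
    diagonal choice: a countable family of maxima of tents decides narrow convergence, since every
    nonnegative function in [C_b] is an increasing limit of members of it. *)

Section Cb_closure.
Context {R : realType} {T : topologicalType}.
Implicit Types f g : T -> R.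

Lemma Cb_cst (a : R) : Cb (fun _ : T => a).
Proof. by split; [move=> x; exact: cvg_cst | exists `|a|]. Qed.

Lemma CbD f g : Cb f -> Cb g -> Cb (fun x => f x + g x).
Proof.
move=> [cf [M fM]] [cg [N gN]]; split; first by move=> x; apply: cvgD; [exact: cf|exact: cg].
by exists (M + N) => x; rewrite (le_trans (ler_normD _ _))// lerD.
Qed.

Lemma CbZ (a : R) f : Cb f -> Cb (fun x => a * f x).
Proof.
move=> [cf [M fM]]; split; first by move=> x; apply: cvgM; [exact: cvg_cst|exact: cf].
by exists (`|a| * M) => x; rewrite normrM ler_wpM2l.
Qed.

Lemma CbN f : Cb f -> Cb (fun x => - f x).
Proof. by move/(CbZ (-1)); under eq_fun do rewrite mulN1r. Qed.

Lemma CbB f g : Cb f -> Cb g -> Cb (fun x => f x - g x).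
Proof. by move=> cf cg; apply: (CbD cf); exact: CbN. Qed.

Lemma Cb_max f g : Cb f -> Cb g -> Cb (fun x => Num.max (f x) (g x)).
Proof.
move=> [cf [M fM]] [cg [N gN]]; split; first by move=> x; apply: continuous_max; [exact: cf|exact: cg].
exists (Num.max M N) => x; have := fM x; have := gN x; rewrite !ler_norml.
move=> /andP[g1 g2] /andP[f1 f2].
rewrite le_max ge_max; apply/andP; split; last by rewrite !le_max f2 g2 orbT.
by rewrite (le_trans _ f1)// lerN2 le_max lexx.
Qed.

Lemma Cb_min f g : Cb f -> Cb g -> Cb (fun x => Num.min (f x) (g x)).
Proof.
move=> /CbN cf /CbN cg; have /CbN := Cb_max cf cg.
by under eq_fun do rewrite oppr_max !opprK.
Qed.

Lemma Cb_sum (I : Type) (r : seq I) (P : pred I) (F : I -> T -> R) :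
  (forall i, Cb (F i)) -> Cb (fun x => \sum_(i <- r | P i) F i x).
Proof.
move=> cF; elim: r => [|i r ih].
  by under eq_fun do rewrite big_nil; exact: Cb_cst.
under eq_fun do rewrite big_cons; case: (P i) => //; exact: CbD.
Qed.

Lemma Cb_bigmax (I : Type) (r : seq I) (P : pred I) (F : I -> T -> R) :
  (forall i, Cb (F i)) -> Cb (fun x => \big[Num.max/0]_(i <- r | P i) F i x).
Proof.
move=> cF; elim: r => [|i r ih].
  by under eq_fun do rewrite big_nil; exact: Cb_cst.
under eq_fun do rewrite big_cons; case: (P i) => //; exact: Cb_max.
Qed.

Lemma Cb_comp {S : topologicalType} (p : S -> T) f :
  continuous p -> Cb f -> Cb (f \o p).
Proof.
move=> cp [cf [M fM]]; split; last by exists M => x; exact: fM.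
by move=> x; apply: continuous_comp; [exact: cp|exact: cf].
Qed.

End Cb_closure.

Section Borel_measurability.
Context {R : realType}.

Lemma open_Borel {T : ptopologicalType} (U : set T) :
  open U -> measurable (U : set (Borel T)).
Proof. by move=> oU; exact: sub_sigma_algebra. Qed.

Lemma continuous_Borel {T : ptopologicalType} (f : T -> R) :
  continuous f -> measurable_fun setT (f : Borel T -> R).
Proof.
move=> /continuousP cf; apply: (measurability _ (measurable_realfun.RGenOpens.measurableE R)).
move=> _ [_ [a [b ->] <-]]; rewrite setTI; apply: open_Borel.
exact/cf/interval_open.
Qed.

Lemma continuous_Borel_fun {S T : ptopologicalType} (p : S -> T) :
  continuous p -> measurable_fun setT (p : Borel S -> Borel T).
Proof.
move=> /continuousP cp; apply: (@measurability _ _ (Borel S) (Borel T) setT p (@open T)) => //.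
by move=> _ [U oU <-]; rewrite setTI; apply: open_Borel; exact: cp.
Qed.

End Borel_measurability.

Section bounded_integrals.
Context d {T : measurableType d} {R : realType} (P : probability T R).
Implicit Types f g : T -> R.

Definition Bm f := measurable_fun setT f /\ exists M : R, forall x, `|f x| <= M.

Lemma Bm_integrable f : Bm f -> P.-integrable setT (EFin \o f).
Proof.
move=> [mf [M fM]]; apply: measurable_bounded_integrable => //.
  by rewrite (le_lt_trans (probability_le1 _ _))// ltry.
by exists M; split; [rewrite num_real | move=> N /ltW MN x _; exact: le_trans (fM x) MN].
Qed.

Lemma Bm_EFin f : Bm f -> (\int[P]_x (f x)%:E)%E = (\int[P]_x f x)%:E.
Proof.
by move=> bf; rewrite /Rintegral fineK//; exact: integrable_fin_num (Bm_integrable bf).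
Qed.

Lemma Rint_cst (a : R) : \int[P]_x a = a.
Proof. by rewrite Rintegral_cst//= probability_setT mulr1. Qed.

Lemma Rint_le f g : Bm f -> Bm g -> (forall x, f x <= g x) ->
  \int[P]_x f x <= \int[P]_x g x.
Proof. by move=> bf bg fg; apply: le_Rintegral => //; exact: Bm_integrable. Qed.

Lemma RintD f g : Bm f -> Bm g ->
  \int[P]_x (f x + g x) = \int[P]_x f x + \int[P]_x g x.
Proof. by move=> bf bg; apply: RintegralD => //; exact: Bm_integrable. Qed.

Lemma RintB f g : Bm f -> Bm g ->
  \int[P]_x (f x - g x) = \int[P]_x f x - \int[P]_x g x.
Proof. by move=> bf bg; apply: RintegralB => //; exact: Bm_integrable. Qed.

Lemma RintZ (a : R) f : Bm f -> \int[P]_x (a * f x) = a * \int[P]_x f x.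
Proof. by move=> bf; apply: RintegralZl => //; exact: Bm_integrable. Qed.

Lemma BmD f g : Bm f -> Bm g -> Bm (fun x => f x + g x).
Proof.
move=> [mf [M fM]] [mg [N gN]]; split; first exact: measurable_funD.
by exists (M + N) => x; rewrite (le_trans (ler_normD _ _))// lerD.
Qed.

Lemma BmM f g : Bm f -> Bm g -> Bm (fun x => f x * g x).
Proof.
move=> [mf [M fM]] [mg [N gN]]; split; first exact: measurable_funM.
by exists (M * N) => x; rewrite normrM ler_pM.
Qed.

Lemma Bm_cst (a : R) : Bm (fun=> a).
Proof. by split => //; exists `|a|. Qed.

Lemma BmB f g : Bm f -> Bm g -> Bm (fun x => f x - g x).
Proof.
move=> bf bg; have := BmD bf (BmM (Bm_cst (-1)) bg).
by under eq_fun do rewrite mulN1r.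
Qed.

Lemma Bm_sum (I : Type) (r : seq I) (F : I -> T -> R) :
  (forall i, Bm (F i)) -> Bm (fun x => \sum_(i <- r) F i x).
Proof.
move=> cF; elim: r => [|i r ih].
  by under eq_fun do rewrite big_nil; exact: Bm_cst.
under eq_fun do rewrite big_cons; exact: BmD.
Qed.

Lemma Rint_sum (I : Type) (r : seq I) (F : I -> T -> R) :
  (forall i, Bm (F i)) ->
  \int[P]_x (\sum_(i <- r) F i x) = \sum_(i <- r) \int[P]_x F i x.
Proof.
move=> cF; elim: r => [|i r ih].
  under eq_Rintegral do rewrite big_nil; by rewrite Rint_cst big_nil.
under eq_Rintegral do rewrite big_cons; rewrite big_cons RintD ?ih//.
exact: Bm_sum.
Qed.

Lemma Rint_norm_le f (M : R) : measurable_fun setT f -> (forall x, `|f x| <= M) ->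
  `|\int[P]_x f x| <= M.
Proof.
move=> mf fM; have bf : Bm f by split=> //; exists M.
rewrite ler_norml; apply/andP; split.
  rewrite -(Rint_cst (- M)); apply: Rint_le => //; first exact: Bm_cst.
  by move=> x; have := fM x; rewrite ler_norml => /andP[].
rewrite -(Rint_cst M); apply: Rint_le => //; first exact: Bm_cst.
by move=> x; have := fM x; rewrite ler_norml => /andP[].
Qed.

(** Bounded convergence. Measurability and the bound of the limit are returned too, since limits
    such as [Lam F] are known only pointwise when the lemma is applied. *)
Lemma Rint_dct (f_ : nat -> T -> R) f (M : R) :
  (forall n, measurable_fun setT (f_ n)) -> (forall n x, `|f_ n x| <= M) ->
  (forall x, f_ n x @[n --> \oo] --> f x) ->
  [/\ measurable_fun setT f, forall x, `|f x| <= M &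
  \int[P]_x f_ n x @[n --> \oo] --> \int[P]_x f x].
Proof.
move=> mf fM cf.
have mlim : measurable_fun setT f.
  by apply: (@measurable_fun_cvg _ _ _ _ f_) => // x _; exact: cf.
have flim x : `|f x| <= M.
  have cn : `|f_ n x| @[n --> \oo] --> `|f x| by apply: cvg_norm; exact: cf.
  have := cvg_lim (@Rhausdorff R) cn => <-; apply: limr_le.
    by apply/cvg_ex; eexists; exact: cn.
  by apply: nearW => n; exact: fM.
split => //; apply: fine_cvg.
rewrite -Bm_EFin; last by split => //; exists M.
apply: (@dominated_cvg _ _ _ P setT _ _ _ (cst M%:E)) => //=.
- by move=> n; apply/measurable_EFinP.
- by move=> x _; apply/cvg_EFin; [exact: nearW | exact: cf].
- by apply: Bm_integrable; exact: Bm_cst.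
- by move=> n x _; rewrite lee_fin.
Qed.

End bounded_integrals.

Lemma Cb_Bm {R : realType} {T : ptopologicalType} (f : T -> R) :
  Cb f -> Bm (f : Borel T -> R).
Proof. by move=> [cf [M fM]]; split; [exact: continuous_Borel | exists M]. Qed.

(** * Tent functions and semicontinuous envelopes *)

Section tents.
Context {R : realType} {T : normedModType R} (q : nat -> T).
Implicit Types (c : T -> \bar R) (U : set T).

(** Cones with centre [q j], slope [n] and rational height [a], cut off at 0. Coding the triple by
    [unpickle] enumerates the family by [nat], so that finite maxima form monotone sequences;
    indices coding nothing give the zero function. *)
Definition tent (i : nat) (x : T) : R :=
  if (unpickle i : option (nat * nat * rat)) is Some (j, n, a)
  then Num.max 0 (ratr a - n%:R * `|x - q j|) else 0.

Lemma tent_ge0 i x : 0 <= tent i x.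
Proof. by rewrite /tent; case: unpickle => [[[j n] a]|//]; rewrite le_max lexx. Qed.

Lemma tent_Cb i : Cb (tent i).
Proof.
rewrite /tent; case: unpickle => [[[j n] a]|]; last exact: Cb_cst.
split.
  move=> x; apply: (@continuous_max _ _ (cst 0) (fun x => ratr a - n%:R * `|x - q j|)); first exact: cvg_cst.
  apply: cvgB; first exact: cvg_cst.
  apply: cvgM; first exact: cvg_cst.
  by apply: cvg_norm; apply: cvgB; [exact: cvg_id|exact: cvg_cst].
exists `|ratr a| => x /=; rewrite ger0_norm; last by rewrite le_max lexx.
rewrite ge_max normr_ge0 /= (le_trans _ (ler_norm _))// gerBl.
by rewrite mulr_ge0.
Qed.

Hypothesis q_dense : forall x (e : R), 0 < e -> exists n, `|x - q n| < e.

Lemma tent_below c y (t e : R) : (forall x, 0 <= c x)%E ->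
  (forall a : R, closed [set x | (c x <= a%:E)%E]) ->
  (t%:E < c y)%E -> 0 < e ->
  exists i, (forall x, ((tent i x)%:E <= c x)%E) /\ t - e < tent i y.
Proof.
move=> c0 cc tc e0.
have : nbhs y (~` [set x | (c x <= t%:E)%E]).
  apply: open_nbhs_nbhs; split; first by rewrite openC; exact: cc.
  by apply/negP; rewrite -ltNge.
move=> /nbhs_normP[r /= r0 rc].
have e20 : 0 < e / 2 by rewrite divr_gt0.
have r20 : 0 < r / 2 by rewrite divr_gt0.
have [a at_] : exists a : rat, t - e / 2 < ratr a < t.
  have /rat_in_itvoo[a ha] : t - e / 2 < t by rewrite gtrBl.
  by exists a; move: ha; rewrite in_itv.
(* The slope is so steep that the cone vanishes at distance [r / 2] from its centre. The centre is
   then put within [r / 2] of [y], which keeps the support inside the ball where [c > t], and so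
   close that at most [e / 2] of height is lost at [y]. *)
have [n hn] : exists n : nat, `|ratr a| / (r / 2) < n%:R :> R.
  by exists (Num.truncn (`|ratr a| / (r / 2) : R)).+1; exact: truncnS_gt.
have [j hj] : exists j, `|y - q j| < Num.min (r / 2) (e / 2 / n.+1%:R).
  by apply: q_dense; rewrite lt_min r20 divr_gt0.
move: hj; rewrite lt_min => /andP[hj1 hj2].
exists (pickle (j, n, a)); rewrite /tent pickleK; split.
  move=> x; rewrite EFin_max ge_max c0/=.
  have [xq|xq] := ltP `|x - q j| (r / 2).
    have : (t%:E < c x)%E.
      rewrite ltNge; apply/negP; apply: rc => /=.
      rewrite (splitr r) (le_lt_trans _ (ltrD hj1 xq))//.
      rewrite -(subrKA (q j)) (le_trans (ler_normD _ _))// lerD2l.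
      by rewrite distrC.
    move=> /ltW; apply: le_trans; rewrite lee_fin.
    move/andP: at_ => [_ /ltW]; apply: le_trans.
    by rewrite gerBl mulr_ge0.
  apply: le_trans (c0 x); rewrite lee_fin subr_le0 (le_trans (ler_norm _))//.
  rewrite ltr_pdivrMr// in hn; rewrite (le_trans (ltW hn))//.
  by rewrite ler_wpM2l.
rewrite lt_max; apply/orP; right.
have : n%:R * `|y - q j| <= e / 2.
  move: hj2; rewrite ltr_pdivlMr// mulrC => /ltW; apply: le_trans.
  by rewrite ler_wpM2r// ler_nat.
move/andP: at_ => []; lra.
Qed.

Definition tent_max (P : pred nat) (n : nat) (x : T) : R :=
  \big[Num.max/0]_(i < n | P i) tent i x.

Lemma tent_max_Cb P n : Cb (tent_max P n).
Proof. by apply: Cb_bigmax => i; exact: tent_Cb. Qed.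

Lemma tent_max_ge0 P n x : 0 <= tent_max P n x.
Proof.
rewrite /tent_max; elim/big_ind : _ => // [a b a0 b0|i _]; last exact: tent_ge0.
by rewrite le_max a0.
Qed.

Lemma tent_le_max (P : pred nat) n (i : 'I_n) x : P i -> tent i x <= tent_max P n x.
Proof.
move=> Pi; rewrite /tent_max.
exact: (@le_bigmax_cond _ _ _ _ i (fun i : 'I_n => P i) (fun i : 'I_n => tent i x)).
Qed.

Lemma tent_max_nd P x : nondecreasing_seq (tent_max P ^~ x).
Proof.
move=> m n mn; rewrite /tent_max.
elim/big_ind : _ => [|a b a0 b0|i Pi]; first exact: tent_max_ge0.
  by rewrite ge_max a0.
exact: (tent_le_max (i := widen_ord mn i)).
Qed.

(** Baire's approximation of a nonnegative lower semicontinuous function from below: [P] selects the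
    tents lying under [c], and by [tent_below] their supremum is [c]. *)
Lemma lsc_tent_max c : (forall x, 0 <= c x)%E ->
  (forall a : R, closed [set x | (c x <= a%:E)%E]) ->
  exists P : pred nat, (forall n x, ((tent_max P n x)%:E <= c x)%E) /\
    forall x, (tent_max P n x)%:E @[n --> \oo] --> c x.
Proof.
move=> c0 cc; exists (fun i => `[< forall x, ((tent i x)%:E <= c x)%E >]).
set P := (X in tent_max X).
have ub n x : ((tent_max P n x)%:E <= c x)%E.
  rewrite /tent_max; elim/big_ind : _ => [|a b a0 b0|i Pi].
  - exact: c0.
  - by rewrite EFin_max ge_max a0.
  - by move/asboolP : Pi; exact.
split => // x.
have nd : nondecreasing_seq (fun n => (tent_max P n x)%:E).
  by move=> m n mn; rewrite lee_fin tent_max_nd.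
rewrite (_ : c x = ereal_sup (range (fun n => (tent_max P n x)%:E))).
  exact: ereal_nondecreasing_cvgn.
apply/eqP; rewrite eq_le; apply/andP; split; last first.
  by apply: ge_ereal_sup => _ [n _ <-]; exact: ub.
set s := ereal_sup _.
have s0 : (0 <= s)%E.
  by apply: ereal_sup_ge; exists (tent_max P 0 x)%:E; [exists 0%N|rewrite lee_fin tent_max_ge0].
rewrite leNgt; apply/negP => sc.
have sfin : s \is a fin_num by rewrite ge0_fin_numE// (lt_le_trans sc)// leey.
have [t [st tc]] : exists t : R, fine s < t /\ (t%:E < c x)%E.
  move: sc; rewrite -(fineK sfin); case: (c x) (c0 x) => [r _|_|//].
    rewrite lte_fin => sr; exists ((fine s + r) / 2); rewrite lte_fin; lra.
  by move=> _; exists (fine s + 1); rewrite ltey ltrDl.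
have [i [ic]] := tent_below c0 cc tc (ltac:(by rewrite subr_gt0) : 0 < t - fine s).
rewrite opprB addrC subrK => si.
have Pi : P i by apply/asboolP.
have : ((tent_max P i.+1 x)%:E <= s)%E by apply: ereal_sup_ubound; exists i.+1.
rewrite -(fineK sfin) lee_fin leNgt => /negP; apply.
by rewrite (lt_le_trans si)//; exact: (tent_le_max (i := ord_max)).
Qed.

Lemma open_indic_approx U : open U -> exists g : nat -> T -> R,
  [/\ forall n, Cb (g n), forall n x, 0 <= g n x <= \1_U x,
      forall x, nondecreasing_seq (g ^~ x) &
      forall x, g n x @[n --> \oo] --> (\1_U x : R)].
Proof.
move=> oU.
have [|a|P [Pc Pcvg]] := @lsc_tent_max (fun x => (\1_U x)%:E).
- by move=> x; rewrite lee_fin.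
- have [a0|a0] := ltP a 0.
    rewrite (_ : [set x | _] = set0); first exact: closed0.
    by apply/seteqP; split => // x /=; rewrite lee_fin leNgt (lt_le_trans a0).
  have [a1|a1] := ltP a 1.
    rewrite (_ : [set x | _] = ~` U); first exact: open_closedC.
    apply/seteqP; split => x /=; rewrite lee_fin indicE.
      by move=> h Ux; move: h; rewrite mem_set// leNgt a1.
    by move=> Ux; rewrite memNset.
  rewrite (_ : [set x | _] = setT); first exact: closedT.
  apply/seteqP; split => x //= _; rewrite lee_fin indicE (le_trans _ a1)//.
  by case: (x \in U) => /=; rewrite ?ler01.
exists (tent_max P); split.
- exact: tent_max_Cb.
- by move=> n x; rewrite tent_max_ge0/= -lee_fin.
- by move=> x; exact: tent_max_nd.
- by move=> x; apply: (fine_cvg (Pcvg x)).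
Qed.

End tents.

(** Bounded convergence along [open_indic_approx] gives equality on open sets, which are stable
    under intersection and generate the Borel sets. *)
Lemma Borel_unique {R : realType} {T : normedModType R} (q : nat -> T)
  (P Q : probability (Borel T) R) :
  (forall x (e : R), 0 < e -> exists n, `|x - q n| < e) ->
  (forall f, Cb f -> integ P f = integ Q f) ->
  forall A : set (Borel T), measurable A -> P A = Q A.
Proof.
move=> qd PQ.
apply: (@measure_unique _ R (Borel T) (@open T) (fun=> setT) erefl _ _ _ P Q) => //.
- by move=> A B; exact: openI.
- by move=> _; exact: openT.
- by rewrite bigcup_const//; exists 0%N.
- move=> U oU.
  have [g [gC g01 _ gcvg]] := open_indic_approx qd oU.
  have mU : measurable (U : set (Borel T)) by exact: open_Borel.
  have g1 n x : `|g n x| <= 1.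
    have /andP[g0 gU] := g01 n x; rewrite ger0_norm// (le_trans gU)// indicE; case: (x \in U) => /=; rewrite ?ler01.
  have H (M : probability (Borel T) R) : integ M (g n) @[n --> \oo] --> fine (M U).
    have [|_ _] := @Rint_dct _ (Borel T) R M g (\1_U) 1 _ g1 gcvg.
      by move=> n; apply: continuous_Borel; case: (gC n).
    by rewrite /Rintegral integral_indic// setIT.
  have HQ := H Q.
  rewrite (_ : (fun n => integ Q (g n)) = (fun n => integ P (g n))) in HQ; last first.
    by apply/funext => n; rewrite PQ.
  have e : fine (P U) = fine (Q U) := cvg_unique (@Rhausdorff R) (H P) HQ.
  by rewrite -[LHS]fineK ?fin_num_measure// -[RHS]fineK ?fin_num_measure// e.
- by move=> k; rewrite (le_lt_trans (probability_le1 _ _)) ?ltry.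
Qed.

(** * Daniell representation on C_b *)

Section build_probability.
Context d (T : measurableType d) (R : realType) (m : set T -> \bar R).
Hypotheses (m0 : m set0 = 0%E) (m_ge0 : forall A, (0 <= m A)%E)
  (m_sigma : semi_sigma_additive m) (m1 : m setT = 1%E).

(** The dummy [let] makes the four hypotheses parameters of the constant, so that the instances
    below can be attached to it. *)
Definition build_probability : set T -> \bar R :=
  let _ := (m0, m_ge0, m_sigma, m1) in m.

HB.instance Definition _ :=
  isMeasure.Build d T R build_probability m0 m_ge0 m_sigma.
HB.instance Definition _ :=
  Measure_isProbability.Build d T R build_probability m1.

End build_probability.

Lemma indic_le1 {R : realType} {T : Type} (A : set T) x : \1_A x <= 1 :> R.
Proof. by rewrite indicE; case: (x \in A); rewrite ?ler01. Qed.

Section Daniell.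
Context {R : realType} {T : normedModType R} (q : nat -> T) (L : (T -> R) -> R).
Hypothesis q_dense : forall x (e : R), 0 < e -> exists n, `|x - q n| < e.
Hypothesis L_linear : forall f g (a b : R), Cb f -> Cb g ->
  L (fun x => a * f x + b * g x) = a * L f + b * L g.
Hypothesis L_ge0 : forall f, Cb f -> (forall x, 0 <= f x) -> 0 <= L f.
Hypothesis L1 : L (fun=> 1) = 1.
Hypothesis L_smooth : forall f_ : nat -> T -> R, (forall n, Cb (f_ n)) ->
  (forall n x, 0 <= f_ n x) -> (forall x, nonincreasing_seq (f_ ^~ x)) ->
  (forall x, f_ n x @[n --> \oo] --> (0 : R)) ->
  forall e : R, 0 < e -> exists n, L (f_ n) <= e.
Implicit Types (U A X : set T) (f g : T -> R).

Let LD f g : Cb f -> Cb g -> L (fun x => f x + g x) = L f + L g.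
Proof.
move=> cf cg; have := L_linear 1 1 cf cg; rewrite !mul1r => <-.
by congr L; apply/funext => x; rewrite !mul1r.
Qed.

Let LB f g : Cb f -> Cb g -> L (fun x => f x - g x) = L f - L g.
Proof.
move=> cf cg; have := L_linear 1 (-1) cf cg; rewrite mul1r mulN1r => <-.
by congr L; apply/funext => x; rewrite mul1r mulN1r.
Qed.

Let LZ a f : Cb f -> L (fun x => a * f x) = a * L f.
Proof.
move=> cf; have := L_linear a 0 cf cf; rewrite mul0r addr0 => <-.
by congr L; apply/funext => x; rewrite mul0r addr0.
Qed.

Let Lcst a : L (fun=> a) = a.
Proof.
have := LZ a (Cb_cst (T := T) (1 : R)); rewrite L1 mulr1 => {2}<-.
by congr L; apply/funext => x; rewrite mulr1.
Qed.

Let L_le f g : Cb f -> Cb g -> (forall x, f x <= g x) -> L f <= L g.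
Proof.
move=> cf cg fg; rewrite -subr_ge0 -LB//; apply: L_ge0; first exact: CbB.
by move=> x; rewrite subr_ge0.
Qed.

Let L_sum (I : Type) (r : seq I) (F : I -> T -> R) : (forall i, Cb (F i)) ->
  L (fun x => \sum_(i <- r) F i x) = \sum_(i <- r) L (F i).
Proof.
move=> cF; elim: r => [|i r ih].
  under eq_fun do rewrite big_nil; by rewrite Lcst big_nil.
under eq_fun do rewrite big_cons; rewrite big_cons LD ?ih//.
exact: Cb_sum.
Qed.

(** As in the Riesz construction, but with competitors in [C_b] that need not have compact support;
    [L_smooth] does the work of compactness. *)
Definition open_content U : \bar R :=
  ereal_sup [set (L f)%:E | f in [set f | Cb f /\ forall x, 0 <= f x <= \1_U x]].

Definition daniell_outer A : \bar R :=
  ereal_inf [set open_content U | U in [set U | open U /\ A `<=` U]].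

Local Notation l := open_content.
Local Notation m := daniell_outer.

Let l_ubound U f : Cb f -> (forall x, 0 <= f x <= \1_U x) -> ((L f)%:E <= l U)%E.
Proof. by move=> cf fU; apply: ereal_sup_ubound; exists f. Qed.

Let l_ge0 U : (0 <= l U)%E.
Proof.
rewrite -(_ : (L (fun=> 0))%:E = 0%E); last by rewrite Lcst.
by apply: l_ubound => [|x]; [exact: Cb_cst|rewrite lexx/=].
Qed.

Let l_le1 U : (l U <= 1)%E.
Proof.
apply: ge_ereal_sup => _ [f [cf fU] <-]; rewrite lee_fin -L1; apply: L_le => //.
  exact: Cb_cst.
by move=> x; have /andP[_ fx] := fU x; exact: le_trans fx (indic_le1 _ _).
Qed.

Let l_le U V : U `<=` V -> (l U <= l V)%E.
Proof.
move=> UV; apply: ge_ereal_sup => _ [f [cf fU] <-]; apply: l_ubound => // x.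
have /andP[-> /= /le_trans] := fU x; apply; rewrite !indicE ler_nat.
have [xU|//] := boolP (x \in U); rewrite mem_set//; apply: UV; exact: set_mem.
Qed.

Let l0 : l set0 = 0%E.
Proof.
apply/eqP; rewrite eq_le l_ge0 andbT; apply: ge_ereal_sup => _ [f [cf fU] <-].
rewrite (_ : f = fun=> 0) ?Lcst//; apply/funext => x.
by apply: le_anti; rewrite andbC; have := fU x; rewrite indicE in_set0.
Qed.

(** With [g i n] increasing to the indicator of [U i] and [S n] the sum of the first [n] of them,
    the defect [f - min (f, S n)] decreases to 0 pointwise, so [L_smooth] makes its value under [L]
    negligible. *)
Let l_sigma_subadditive (U : nat -> set T) : (forall n, open (U n)) ->
  (l (\bigcup_n U n) <= \sum_(n <oo) l (U n))%E.
Proof.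
move=> oU; apply: ge_ereal_sup => _ [f [cf fU] <-].
have /choice[g hg] : forall i, exists g : nat -> T -> R,
  [/\ forall n, Cb (g n), forall n x, 0 <= g n x <= \1_(U i) x,
      forall x, nondecreasing_seq (g ^~ x) &
      forall x, g n x @[n --> \oo] --> (\1_(U i) x : R)].
  by move=> i; exact: (open_indic_approx q_dense (oU i)).
have gC i n : Cb (g i n) by have [] := hg i.
have g0 i n x : 0 <= g i n x by have [_ /(_ n x) /andP[]] := hg i.
pose S n x := \sum_(0 <= i < n) g i n x.
have SC n : Cb (S n) by apply: Cb_sum => i.
have S0 n x : 0 <= S n x by apply: sumr_ge0.
have Snd x : nondecreasing_seq (S ^~ x).
  move=> a b ab; rewrite /S [leRHS](big_cat_nat (n := a))//=.
  rewrite -[leLHS]addr0; apply: lerD; last exact: sumr_ge0.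
  by apply: ler_sum => i _; have [_ _ + _] := hg i; apply.
pose h n x := f x - Num.min (f x) (S n x).
have hC n : Cb (h n) by apply: CbB => //; exact: Cb_min.
have h0 n x : 0 <= h n x by rewrite /h subr_ge0 ge_min lexx.
have hni x : nonincreasing_seq (h ^~ x).
  move=> a b ab; rewrite /h lerD2l lerN2 le_min ge_min lexx/= ge_min.
  by rewrite (Snd x)// orbT.
have hcvg x : h n x @[n --> \oo] --> (0 : R).
  have [[i _ Uix]|nU] := pselect ((\bigcup_n U n) x); last first.
    apply: cvg_near_cst; apply: nearW => n; rewrite /h.
    have : 0 <= f x <= 0 by have := fU x; rewrite indicE memNset.
    move=> /le_anti <-; rewrite sub0r; apply/eqP; rewrite oppr_eq0; apply/eqP.
    by rewrite min_l.
  have [_ _ _ /(_ x)] := hg i; rewrite indicE mem_set// => gi.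
  (* As soon as [n > i], [S n] dominates [g i n]; since [f <= 1], the defect is at most
     [1 - g i n]. *)
  have : (1 - g i n x) @[n --> \oo] --> (0 : R).
    by rewrite -[X in _ --> X](subrr (1 : R)); apply: cvgB => //; exact: cvg_cst.
  apply: squeeze_cvgr; last exact: cvg_cst.
  exists i.+1 => // n /= ni; rewrite h0/= /h.
  have f1 : f x <= 1.
    by have /andP[_ fx] := fU x; exact: le_trans fx (indic_le1 _ _).
  have gS : g i n x <= S n x.
    rewrite /S (bigD1_seq i)/=; [|by rewrite mem_index_iota|exact: iota_uniq].
    by rewrite lerDl sumr_ge0.
  have g1 : g i n x <= 1.
    by have [_ /(_ n x)/andP[_ gx] _ _] := hg i; exact: le_trans gx (indic_le1 _ _).
  rewrite -subr_ge0 opprB addrA addrC addrA addrAC -addrA.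
  by case: (leP (f x) (S n x)) => fS; lra.
apply/lee_addgt0Pr => e e0.
have [n hn] := L_smooth hC h0 hni hcvg e0.
have Lf : L f <= L (h n) + L (S n).
  rewrite -LD//; apply: L_le => //; first exact: CbD.
  by move=> x; rewrite /h -lerBlDl opprB addrC subrK ge_min lexx orbT.
apply: (@le_trans _ _ (e%:E + (\sum_(0 <= i < n) l (U i)))%E).
  apply: (@le_trans _ _ ((L (h n))%:E + (L (S n))%:E)%E); first by rewrite -EFinD lee_fin.
  apply: leeD; first by rewrite lee_fin.
  rewrite /S L_sum// -sumEFin; apply: lee_sum => i _; apply: l_ubound => // x.
  by have [_ /(_ n x)] := hg i.
rewrite addeC; apply: leeD => //.
by apply: nneseries_lim_ge => i _ _; exact: l_ge0.
Qed.

Let m_open U : open U -> m U = l U.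
Proof.
move=> oU; apply/eqP; rewrite eq_le; apply/andP; split.
  by apply: ereal_inf_lbound; exists U => //; split.
by apply: le_ereal_inf_tmp => _ [V [oV UV] <-]; exact: l_le.
Qed.

Let m_ge0 A : (0 <= m A)%E.
Proof. by apply: le_ereal_inf_tmp => _ [V [oV UV] <-]. Qed.

Let m_le A B : A `<=` B -> (m A <= m B)%E.
Proof.
move=> AB; apply: le_ereal_inf_tmp => _ [V [oV BV] <-].
by apply: ereal_inf_lbound; exists V => //; split => //; exact: subset_trans BV.
Qed.

Let m_fin A : m A \is a fin_num.
Proof.
rewrite ge0_fin_numE// (le_lt_trans (m_le (@subsetT _ A)))//.
by rewrite m_open ?(le_lt_trans (l_le1 _)) ?ltry//; exact: openT.
Qed.

Let m_approx A (e : R) : 0 < e ->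
  exists U, [/\ open U, A `<=` U & (l U <= m A + e%:E)%E].
Proof.
move=> e0; have [_ [U [oU AU] <-] h] := lb_ereal_inf_adherent e0 (m_fin A).
by exists U; split => //; exact: ltW.
Qed.

Let m_sigma_subadditive : sigma_subadditive m.
Proof.
move=> A; apply/lee_addgt0Pr => e e0.
rewrite [leRHS]addeC.
have h : (forall i, exists U, [/\ open U, A i `<=` U & (l U <= m (A i) + (e / (2 ^ i.+1)%:R)%:E)%E]).
  by move=> i; apply: m_approx; rewrite divr_gt0// ltr0n expn_gt0.
have /choice[U hU] := h.
have oU i : open (U i) by have [] := hU i.
apply: (@le_trans _ _ (l (\bigcup_n U n))).
  rewrite -m_open; last exact: bigcup_open.
  by apply: m_le; apply: subset_bigcup => i _; have [] := hU i.
apply: le_trans (l_sigma_subadditive oU) _.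
rewrite addeC; apply: (@le_trans _ _ (\sum_(i <oo) (m (A i) + (e / (2 ^ i.+1)%:R)%:E))%E).
  by apply: lee_nneseries => // i _; have [] := hU i.
by apply: epsilon_trick => //; exact: ltW.
Qed.

Let m0 : m set0 = 0%E.
Proof. by rewrite m_open ?l0//; exact: open0. Qed.

Let mo : {outer_measure set T -> \bar R} :=
  HB.pack m (isOuterMeasure.Build R T m m0 m_ge0 m_le m_sigma_subadditive).

(** For an open [W] containing the test set, let [f] compete for the part of [W] in [U], and [g] for
    [W'], the part of [W] where [f < e]; [W'] is open and contains the part of [W] outside [U].
    Where [max (0, f - e)] is positive [g] vanishes, so the sum of the two competes for [W], at a
    loss of [e]. *)
Let open_caratheodory U : open U -> caratheodory_measurable m U.
Proof.
move=> oU; apply: (@le_caratheodory_measurable R T mo) => X /=.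
apply: le_ereal_inf_tmp => _ [W [oW XW] <-].
have oWU : open (W `&` U) by exact: openI.
apply: (@le_trans _ _ (l (W `&` U) + m (W `&` ~` U))%E).
  apply: leeD; last by apply: m_le; exact: setSI.
  by rewrite -m_open//; apply: m_le; exact: setSI.
rewrite -leeBrDr//; apply: ge_ereal_sup => _ [f [cf fU] <-].
rewrite leeBrDr//; apply/lee_addgt0Pr => e e0.
pose W' := W `&` [set x | f x < e].
have oW' : open W'.
  apply: openI => //; case: cf => /continuousP cf _.
  rewrite (_ : [set x | _] = f @^-1` [set y | y < e]) //.
  by apply: cf; exact: open_lt.
have mW' : (m (W `&` ~` U) <= l W')%E.
  rewrite -m_open//; apply: m_le => x [Wx Ux]; split => //=.
  have /andP[_] := fU x; rewrite indicE memNset; last by move=> [].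
  by move=> /le_lt_trans; apply.
apply: (@le_trans _ _ ((L f)%:E + l W')%E); first exact: leeD2l.
rewrite -leeBrDl//; apply: ge_ereal_sup => _ [g [cg gW] <-].
rewrite leeBrDl// -leeBlDr// -!EFinD.
pose k x := Num.max 0 (f x - e).
have kC : Cb k by apply: Cb_max; [exact: Cb_cst|apply: CbB => //; exact: Cb_cst].
apply: (@le_trans _ _ (L (fun x => k x + g x))%:E).
  rewrite lee_fin LD// addrAC lerD2r -{1}(Lcst e) -LB//; last exact: Cb_cst.
  apply: L_le => //; first by apply: CbB => //; exact: Cb_cst.
  by move=> x; rewrite /k le_max lexx orbT.
apply: l_ubound; first exact: CbD.
move=> x; have /andP[f0 f1] := fU x; have /andP[gx0 g1] := gW x.
rewrite addr_ge0//=; last by rewrite /k le_max lexx.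
rewrite /k; case: (leP (f x - e) 0) => fe.
  rewrite add0r (le_trans g1)// !indicE ler_nat.
  have [|//] := boolP (x \in W'); move=> /set_mem[Wx _]; by rewrite mem_set.
have -> : g x = 0.
  apply/eqP; rewrite eq_le gx0 andbT (le_trans g1)// indicE memNset// => -[_ /= h].
  by move: fe; rewrite subr_gt0 ltNge (ltW h).
rewrite addr0; apply: (@le_trans _ _ (f x)); first by rewrite gerBl ltW.
rewrite (le_trans f1)// !indicE ler_nat.
by have [|//] := boolP (x \in W `&` U); move=> /set_mem[Wx _]; rewrite mem_set.
Qed.

Let Borel_caratheodory : measurable `<=` (caratheodory_measurable m : set (set (Borel T))).
Proof.
apply: smallest_sub; last by move=> U; exact: open_caratheodory.
split.
- exact: (@caratheodory_measurable_set0 R T mo).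
- by move=> A; rewrite setTD; exact: (@caratheodory_measurable_setC R T mo).
- by move=> A; exact: (@caratheodory_measurable_bigcup R T mo).
Qed.

Let m_semi_sigma_additive : semi_sigma_additive (m : set (Borel T) -> \bar R).
Proof.
move=> A mA tA mbA.
apply: (@caratheodory_measure_sigma_additive R T mo A) => //.
- by move=> i; exact: Borel_caratheodory.
- exact: Borel_caratheodory.
Qed.

Let mT : m setT = 1%E.
Proof.
rewrite m_open; last exact: openT.
apply/eqP; rewrite eq_le l_le1/= -L1; apply: l_ubound; first exact: Cb_cst.
by move=> x; rewrite indicE in_setT ler01 lexx.
Qed.

Let mP : probability (Borel T) R :=
  build_probability (T := Borel T) m0 m_ge0 m_semi_sigma_additive mT.

(* Layer cake: [n f] is the sum of the truncations [min 1 (max 0 (n f - i))],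
   the i-th of which is at most the indicator of [{f > i / n}]. *)
Let L_le_integ f : Cb f -> (forall x, 0 <= f x <= 1) -> L f <= integ mP f.
Proof.
move=> cf f01; apply/ler_addgt0Pr => e e0.
pose n := (Num.truncn (e^-1)).+1.
have n0 : 0 < n%:R :> R by rewrite ltr0n.
have ne : n%:R^-1 <= e.
  by rewrite -[leRHS]invrK lef_pV2 ?posrE ?invr_gt0//; apply/ltW/truncnS_gt.
pose g i x : R := Num.min 1 (Num.max 0 (n%:R * f x - i%:R)).
pose V i := [set x | i%:R < n%:R * f x].
have oV i : open (V i).
  rewrite (_ : V i = (fun x => n%:R * f x) @^-1` [set y | i%:R < y]) //.
  have [/continuousP cnf _] := CbZ n%:R cf.
  by apply: cnf; exact: open_gt.
have gC i : Cb (g i).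
  apply: Cb_min; first exact: Cb_cst.
  apply: Cb_max; first exact: Cb_cst.
  by apply: CbB; [exact: CbZ|exact: Cb_cst].
have gV i x : 0 <= g i x <= \1_(V i) x.
  rewrite /g le_min ler01 le_max lexx/= indicE.
  have [xV|/negP xV] := boolP (x \in V i); first by rewrite ge_min lexx.
  rewrite ge_min ge_max lexx/= subr_le0; apply/orP; right; rewrite leNgt.
  by apply/negP => h; apply: xV; rewrite inE.
have sum_g x m : \sum_(0 <= i < m) g i x = Num.min m%:R (n%:R * f x).
  have w0 : 0 <= n%:R * f x by rewrite mulr_ge0//; case/andP : (f01 x).
  elim: m => [|m ih]; first by rewrite big_nil min_l.
  rewrite big_nat_recr//= ih /g -natr1.
  by case: (leP m%:R (n%:R * f x)) => h1; case: leP => h2; case: leP => h3; case: leP => h4; lra.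
have sum_V x m : \sum_(0 <= i < m) \1_(V i) x <= n%:R * f x + 1.
  have w0 : 0 <= n%:R * f x by rewrite mulr_ge0//; case/andP : (f01 x).
  elim: m => [|m ih]; first by rewrite big_nil addr_ge0.
  rewrite big_nat_recr//= indicE.
  have [/set_mem xV|xV] := boolP (x \in V m); last by rewrite addr0.
  apply: lerD => //; apply: le_trans (ltW xV).
  apply: (@le_trans _ _ (\sum_(0 <= i < m) 1)); first by apply: ler_sum => i _; exact: indic_le1.
  by rewrite sumr_const_nat subn0.
have mV i : measurable (V i : set (Borel T)) by exact: open_Borel.
have bV i : Bm (\1_(V i) : Borel T -> R).
  split; first exact: measurable_indic.
  by exists 1 => x; rewrite ger0_norm ?indic_le1.
have Lg i : L (g i) <= \int[mP]_x (\1_(V i) x).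
  rewrite -lee_fin -Bm_EFin// integral_indic// setIT -[leRHS]/(m (V i)).
  by rewrite m_open//; exact: l_ubound.
have -> : L f = n%:R^-1 * \sum_(0 <= i < n) L (g i).
  rewrite -L_sum// -LZ; last exact: Cb_sum.
  congr L; apply/funext => x; rewrite sum_g min_r ?mulKf ?gt_eqF//.
  by rewrite ler_piMr//; case/andP : (f01 x).
have bf := Cb_Bm cf.
apply: (@le_trans _ _ (n%:R^-1 * (n%:R * integ mP f + 1))); last first.
  by rewrite mulrDr mulKf ?gt_eqF// mulr1 lerD2l.
rewrite ler_wpM2l ?invr_ge0//.
apply: (@le_trans _ _ (\sum_(0 <= i < n) \int[mP]_x (\1_(V i) x))); first exact: ler_sum.
rewrite -Rint_sum// -[X in _ + X](Rint_cst mP) -RintZ// -RintD//; first last.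
- exact: Bm_cst.
- by apply: BmM => //; exact: Bm_cst.
apply: Rint_le => //; first exact: Bm_sum.
by apply: BmD; [apply: BmM => //; exact: Bm_cst|exact: Bm_cst].
Qed.

(** [L_le_integ] is one-sided, but it applies both to [h] and to [1 - h], where [h] rescales [f]
    affinely into [[0, 1]]. The [+ 1] in [N] keeps the scale positive when [M = 0]. *)
Lemma Daniell_representation :
  exists P : probability (Borel T) R, forall f, Cb f -> L f = integ P f.
Proof.
exists mP => f cf; have [_ [M fM]] := cf.
have M0 : 0 <= M by rewrite (le_trans _ (fM point)).
pose N := M + M + 1; have N0 : 0 < N by rewrite /N; lra.
pose h x := N^-1 * (f x + M).
have cfM : Cb (fun x => f x + M) by apply: CbD => //; exact: Cb_cst.
have ch : Cb h by exact: CbZ.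
have h01 x : 0 <= h x <= 1.
  have := fM x; rewrite ler_norml => /andP[f1 f2].
  rewrite /h mulr_ge0 ?invr_ge0 ?(ltW N0)//=; last by lra.
  by rewrite mulrC ler_pdivrMr// mul1r /N; lra.
have c1 : Cb (fun _ : T => 1 : R) by exact: Cb_cst.
have le1 := L_le_integ ch h01.
have le2 : L (fun x => 1 - h x) <= integ mP (fun x => 1 - h x).
  by apply: L_le_integ; [exact: CbB|move=> x; have := h01 x; lra].
have eh : L h = integ mP h.
  apply/eqP; rewrite eq_le le1/=; move: le2; rewrite LB// L1.
  have -> : integ mP (fun x => 1 - h x) = 1 - integ mP h.
    rewrite -[X in X - _](Rint_cst mP); apply: RintB; exact: Cb_Bm.
  by rewrite lerD2l lerN2.
move: eh; rewrite /h LZ// LD//; last exact: Cb_cst.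
rewrite Lcst.
have -> : integ mP (fun x => N^-1 * (f x + M)) = N^-1 * (integ mP f + M).
  transitivity (N^-1 * integ mP (fun x => f x + M)); first by apply: RintZ; exact: Cb_Bm.
  congr (_ * _); rewrite -[X in _ + X](Rint_cst mP); apply: RintD; apply: Cb_Bm => //.
  exact: Cb_cst.
by move/mulfI => /(_ (lt0r_neq0 _)); rewrite invr_gt0 => /(_ N0)/addIr.
Qed.

End Daniell.

(** * Mixtures, densities and Feller kernels *)

Section mixtures.
Local Open Scope ereal_scope.
Context d d' (X : measurableType d) (Z : measurableType d') (R : realType).
Variables (mu : {measure set X -> \bar R}) (m : {measure set Z -> \bar R}).
Variable k : X -> {measure set Z -> \bar R}.
Hypothesis mk : forall A, measurable A -> measurable_fun setT (k ^~ A).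
Hypothesis mE : forall A, measurable A -> m A = \int[mu]_x k x A.

Import HBNNSimple.

Let mixture_nnsfun (f : {nnsfun Z >-> R}) :
  \int[m]_z (f z)%:E = \int[mu]_x \int[k x]_z (f z)%:E.
Proof.
have E (n : {measure set Z -> \bar R}) :
    \int[n]_z (f z)%:E = \sum_(r \in range f) r%:E * n (f @^-1` [set r]).
  by rewrite integralT_nnsfun sintegralE.
rewrite E; under eq_integral do rewrite E.
rewrite ge0_integral_fsum//; first last.
- move=> r x _; have [r0|r0] := leP 0%R r; first by rewrite mule_ge0.
  by rewrite preimage_nnfun0// measure0 mule0.
- by move=> r; apply: emeasurable_funM => //; exact: mk.
apply: eq_fsbigr => r _; rewrite mE//.
have [r0|r0] := leP 0%R r; first by rewrite ge0_integralZl//; exact: mk.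
rewrite integral0_eq; last by move=> x _; rewrite preimage_nnfun0// measure0.
rewrite mule0 integral0_eq// => x _; by rewrite preimage_nnfun0// measure0 mule0.
Qed.

(** Passes from sets to functions by simple approximation. It serves twice: with the kernel
    [g x * dirac x] for measures with a density, and with [graph_kernel] for the disintegration of
    the couplings. *)
Lemma mixture_integral (F : Z -> \bar R) : measurable_fun setT F ->
  (forall z, 0 <= F z) -> \int[m]_z F z = \int[mu]_x \int[k x]_z F z.
Proof.
move=> mF F0.
pose f := nnsfun_approx measurableT mF.
have fF z : lim ((f n z)%:E @[n --> \oo]) = F z.
  by apply/cvg_lim => //; exact: cvg_nnsfun_approx.
have fnd z : nondecreasing_seq (fun n => (f n z)%:E).
  by move=> a b ab; rewrite lee_fin; exact/lefP/nd_nnsfun_approx.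
have mf n : measurable_fun setT (fun z => (f n z)%:E) by apply/measurable_EFinP.
have H (n : {measure set Z -> \bar R}) :
    \int[n]_z F z = limn (fun i => \int[n]_z (f i z)%:E).
  rewrite -monotone_convergence//; first by apply: eq_integral => z _; rewrite fF.
  by move=> i z _; rewrite lee_fin.
rewrite H; under [RHS]eq_integral do rewrite H.
have mg n : measurable_fun setT (fun x => \int[k x]_z (f n z)%:E).
  by apply: measurable_fun_integral_kernel => // z; rewrite lee_fin.
have g0 n x : setT x -> 0 <= \int[k x]_z (f n z)%:E.
  by move=> _; apply: integral_ge0 => z _; rewrite lee_fin.
have gnd x : setT x -> nondecreasing_seq (fun n => \int[k x]_z (f n z)%:E).
  move=> _ a b ab; apply: ge0_le_integral => //.
  - by move=> z _; rewrite lee_fin.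
  - by move=> z _; rewrite lee_fin; exact/lefP/nd_nnsfun_approx.
rewrite (monotone_convergence mu measurableT mg g0 gnd).
rewrite (_ : (fun i => \int[m]_z (f i z)%:E) =
  (fun i => \int[mu]_x \int[k x]_z (f i z)%:E)) //.
by apply/funext => n; rewrite mixture_nnsfun.
Qed.

End mixtures.

Section densities.
Local Open Scope ereal_scope.
Context d (T : measurableType d) (R : realType).
Variables (Q P : {measure set T -> \bar R}) (g : T -> R).
Hypotheses (mg : measurable_fun setT g) (g0 : forall x, (0 <= g x)%R).
Hypothesis PE : forall A, measurable A -> P A = \int[Q]_(x in A) (g x)%:E.

Lemma ge0_integral_density (F : T -> \bar R) : measurable_fun setT F ->
  (forall z, 0 <= F z) -> \int[P]_x F x = \int[Q]_x ((g x)%:E * F x).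
Proof.
move=> mF F0.
pose k x : {measure set T -> \bar R} := mscale (NngNum (g0 x)) (dirac x).
have kE x A : k x A = (g x)%:E * (\1_A x)%:E by [].
rewrite (@mixture_integral _ _ T T R Q P k) //.
- apply: eq_integral => x _; rewrite ge0_integral_mscale//.
  by rewrite integral_dirac//= diracT mul1e.
- move=> A mA; under eq_fun do rewrite kE.
  apply: emeasurable_funM; first exact/measurable_EFinP.
  by apply/measurable_EFinP; exact: measurable_indic.
- move=> A mA; rewrite PE// integral_mkcond; apply: eq_integral => x _.
  rewrite kE patchE indicE; case: (x \in A); by rewrite ?mule1 ?mule0.
Qed.

End densities.

Section product_Borel.
Context {R : realType} {E : normedModType R} (q : nat -> E).
Hypothesis q_dense : forall x (e : R), 0 < e -> exists n, `|x - q n| < e.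

Definition open_rectangles : set (set (E * E)) :=
  [set A `*` B | A in open & B in open].

Lemma setI_closed_open_rectangles : setI_closed open_rectangles.
Proof.
move=> _ _ [A oA [B oB <-]] [C oC [D oD <-]].
exists (A `&` C); first exact: openI.
by exists (B `&` D); [exact: openI|rewrite setXI].
Qed.

(** The reference couplings are prescribed on rectangles only, but live on the Borel sets of the
    product topology. Separability reconciles the two: an open set is the countable union of the
    products of balls with centres among the [q i] and radii [1 / (k + 1)] that it contains. *)
Lemma Borel_rectangles :
  @measurable _ (Borel (E * E)%type) = <<s open_rectangles >>.
Proof.
apply/seteqP; split; apply: smallest_sub.
- exact: smallest_sigma_algebra.
- move=> O oO.
  pose W n := if (unpickle n : option (nat * nat * nat)) is Some (i, j, k)
    then (let A := ball (q i) (k.+1%:R^-1 : R) `*` ball (q j) k.+1%:R^-1 in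
          if `[< A `<=` O >] then A else set0) else set0.
  have -> : O = \bigcup_n W n.
    apply/seteqP; split; last first.
      move=> z [n _]; rewrite /W; case: unpickle => [[[i j] k]|//] /=.
      by case: asboolP => // AO /AO.
    move=> [x y] Oxy; have : nbhs (x, y) O by exact: open_nbhs_nbhs.
    move=> [[A B] /= [/nbhs_ballP[r /= r0 rA] /nbhs_ballP[s /= s0 sB]] AB].
    have rs0 : 0 < Num.min r s / 2 by rewrite divr_gt0// lt_min r0 s0.
    have [k hk] : exists k : nat, k.+1%:R^-1 < Num.min r s / 2.
      exists (Num.truncn ((Num.min r s / 2)^-1)).
      by rewrite invf_plt ?posrE ?ltr0n//; exact: truncnS_gt.
    have [i hi] := q_dense x (ltac:(by rewrite invr_gt0 ltr0n) : 0 < k.+1%:R^-1 :> R).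
    have [j hj] := q_dense y (ltac:(by rewrite invr_gt0 ltr0n) : 0 < k.+1%:R^-1 :> R).
    have near_sub (u v w : E) (t : R) : Num.min r s <= t -> `|u - v| < k.+1%:R^-1 ->
        ball v (k.+1%:R^-1 : R) w -> ball u t w.
      move=> mt uv; rewrite -ball_normE /= => vw.
      rewrite -(subrKA v) (le_lt_trans (ler_normD _ _))// (lt_le_trans (ltrD uv vw))//.
      by rewrite (le_trans _ mt)// [leRHS]splitr lerD// ltW.
    exists (pickle (i, j, k)) => //; rewrite /W pickleK/=.
    rewrite asboolT; last first.
      move=> [u v] [/= qu qv]; apply: AB; split => /=.
        by apply: rA; apply: near_sub hi qu; rewrite ge_min lexx.
      by apply: sB; apply: near_sub hj qv; rewrite ge_min lexx orbT.
    split => /=; by rewrite -ball_normE /= distrC.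
  apply: (@bigcupT_measurable _ (g_sigma_algebraType open_rectangles)) => n.
  rewrite /W; case: unpickle => [[[i j] k]|]; last exact: measurable0.
  rewrite /=; case: asboolP => _; last exact: measurable0.
  apply: sub_sigma_algebra; exists (ball (q i) k.+1%:R^-1); first exact: ball_open.
  by exists (ball (q j) k.+1%:R^-1) => //; exact: ball_open.
- exact: smallest_sigma_algebra.
- move=> _ [A oA [B oB <-]]; apply: (@open_Borel (E * E)%type).
  rewrite openE => -[x y] [/= Ax By].
  by exists (A, B) => //; split; exact: open_nbhs_nbhs.
Qed.

End product_Borel.

Section Feller_kernel.
Context {R : realType} {E : normedModType R} (q : nat -> E).
Hypothesis q_dense : forall x (e : R), 0 < e -> exists n, `|x - q n| < e.
Variables (K : E -> probability (Borel E) R).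
Hypothesis K_feller : feller K.

(** The Feller property speaks of integrals of [C_b] functions; monotone approximation carries
    measurability in [x] to open sets, and Dynkin's theorem to Borel sets. *)
Lemma feller_measurable (B : set (Borel E)) : measurable B ->
  measurable_fun setT (fun x : Borel E => K x B).
Proof.
move=> mB.
apply: (@dynkin_induction _ (Borel E) (@open E)
  (fun B => measurable_fun setT (fun x : Borel E => K x B)) erefl _ _ _ _ _ B mB).
- by move=> U V; exact: openI.
- by under eq_fun do rewrite probability_setT; exact: measurable_cst.
- move=> U oU.
  have [g [gC g01 _ gcvg]] := open_indic_approx q_dense oU.
  have mU : measurable (U : set (Borel E)) by exact: open_Borel.
  apply: (@emeasurable_fun_cvg _ (Borel E) R setT
    (fun n (x : Borel E) => (integ (K x) (g n))%:E)).
    by move=> n; apply/measurable_EFinP; apply: continuous_Borel; exact: K_feller.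
  move=> x _; rewrite -(@fineK _ (K x U)) ?fin_num_measure//.
  apply: cvg_EFin; first exact: nearW.
  have [|n y|_ _] := @Rint_dct _ (Borel E) R (K x) g (\1_U) 1 _ _ gcvg.
  + by move=> n; apply: continuous_Borel; case: (gC n).
  + have /andP[g0 gU] := g01 n y; rewrite ger0_norm// (le_trans gU)//.
  + by rewrite /Rintegral integral_indic// setIT.
- move=> S mS hS; under eq_fun do rewrite probability_setC//.
  by apply: emeasurable_funB => //; exact: measurable_cst.
- move=> F mF tF hF.
  rewrite (_ : (fun x => _) = (fun x : Borel E => \sum_(n <oo) K x (F n))%E).
    by apply: (@ge0_emeasurable_sum _ (Borel E) R setT (fun n x => K x (F n)) xpredT).
  apply/funext => x; apply/esym/cvg_lim => //; apply: measure_semi_sigma_additive => //.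
  exact: bigcupT_measurable.
Qed.

Definition pairB (x : Borel E) (y : Borel E) : Borel (E * E)%type := (x, y).

Lemma pairB_measurable (x : Borel E) : measurable_fun setT (pairB x).
Proof.
apply: (@continuous_Borel_fun E (E * E)%type) => y.
by apply: cvg_pair; [exact: cvg_cst|exact: cvg_id].
Qed.

(** Law of the pair [(x, U_x)]. Against [mu] these laws mix to the coupling [pi], which brings
    disintegration under [mixture_integral]. *)
Definition graph_kernel (x : Borel E) : {measure set (Borel (E * E)%type) -> \bar R} :=
  measure_function_pushforward__canonical__measure_function_Measure (K x) (pairB_measurable x).

Lemma graph_kernelE x A : graph_kernel x A = K x (pairB x @^-1` A).
Proof. by []. Qed.

Lemma graph_kernel_setT x : graph_kernel x setT = 1%E.
Proof. by rewrite graph_kernelE preimage_setT probability_setT. Qed.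

Lemma graph_kernel_rectangle x (A B : set (Borel E)) :
  graph_kernel x (A `*` B) = ((\1_A x)%:E * K x B)%E.
Proof.
rewrite graph_kernelE indicE.
have [/set_mem xA|xA] := boolP (x \in A).
  rewrite mul1e; congr (K x _); apply/seteqP; split => y /=; first by case.
  by move=> By; split.
rewrite mul0e (_ : _ @^-1` _ = set0) ?measure0//.
by apply/seteqP; split => // y [/= xA']; move: xA; rewrite mem_set.
Qed.

Lemma graph_kernel_setC x A : measurable A ->
  graph_kernel x (~` A) = (1 - graph_kernel x A)%E.
Proof.
move=> mA; rewrite !graph_kernelE preimage_setC probability_setC//.
by rewrite -[X in measurable X]setTI; exact: pairB_measurable.
Qed.

Lemma graph_kernel_bigcup x (F : nat -> set (Borel (E * E)%type)) :
  (forall n, measurable (F n)) -> trivIset setT F ->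
  graph_kernel x (\bigcup_n F n) = (\sum_(n <oo) graph_kernel x (F n))%E.
Proof.
move=> mF tF; apply/esym/cvg_lim => //; apply: measure_semi_sigma_additive => //.
exact: bigcupT_measurable.
Qed.

Lemma graph_kernel_measurable A : measurable A ->
  measurable_fun setT (graph_kernel ^~ A).
Proof.
move=> mA.
apply: (@dynkin_induction _ (Borel (E * E)%type) (open_rectangles (E := E))
  (fun A => measurable_fun setT (graph_kernel ^~ A)) _ _ _ _ _ _ A).
- exact: (Borel_rectangles q_dense).
- exact: setI_closed_open_rectangles.
- by under eq_fun do rewrite graph_kernel_setT; exact: measurable_cst.
- move=> _ [U oU [V oV <-]]; under eq_fun do rewrite graph_kernel_rectangle.
  apply: emeasurable_funM; last exact: feller_measurable (open_Borel oV).
  by apply/measurable_EFinP; apply: measurable_indic; exact: open_Borel.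
- move=> S mS hS; under eq_fun do rewrite graph_kernel_setC//.
  by apply: emeasurable_funB => //; exact: measurable_cst.
- move=> F mF tF hF.
  under eq_fun do rewrite graph_kernel_bigcup//.
  by apply: (@ge0_emeasurable_sum _ (Borel E) R setT (fun n x => graph_kernel x (F n)) xpredT).
- by rewrite -(Borel_rectangles q_dense).
Qed.

Variables (mu : probability (Borel E) R) (pi : probability (Borel (E * E)%type) R).
Hypothesis piE : forall A B : set (Borel E), measurable A -> measurable B ->
  pi (A `*` B) = (\int[mu]_(x in A) K x B)%E.

Lemma pi_graph_kernel A : measurable A -> pi A = (\int[mu]_x graph_kernel x A)%E.
Proof.
move=> mA.
apply: (@dynkin_induction _ (Borel (E * E)%type) (open_rectangles (E := E))
  (fun A => pi A = (\int[mu]_x graph_kernel x A)%E) _ _ _ _ _ _ A).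
- exact: (Borel_rectangles q_dense).
- exact: setI_closed_open_rectangles.
- under eq_integral do rewrite graph_kernel_setT.
  by rewrite integral_cst//= (probability_setT pi) mul1e (probability_setT mu).
- move=> _ [U oU [V oV <-]]; under eq_integral do rewrite graph_kernel_rectangle.
  rewrite piE; [|exact: open_Borel|exact: open_Borel].
  rewrite [LHS]integral_mkcond; apply: eq_integral => x _.
  by rewrite patchE indicE; case: (x \in U); rewrite ?mul1e ?mul0e.
- move=> S mS hS; have mkS := graph_kernel_measurable mS.
  have : (\int[mu]_x (1 - graph_kernel x S) + \int[mu]_x graph_kernel x S = 1)%E.
    rewrite -ge0_integralD//; first last.
    + by apply: emeasurable_funB => //; exact: measurable_cst.
    + by move=> x _; rewrite -graph_kernel_setC.
    transitivity (\int[mu]_x (cst 1%E x))%E; last by rewrite integral_cst//= mul1e (probability_setT mu).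
    apply: eq_integral => x _; rewrite subeK//.
    by rewrite graph_kernelE fin_num_measure// -[X in measurable X]setTI; exact: pairB_measurable.
  rewrite -hS => h; rewrite probability_setC// -[in LHS]h addeK ?fin_num_measure//.
  by apply: eq_integral => x _; rewrite graph_kernel_setC.
- move=> F mF tF hF.
  under eq_integral do rewrite graph_kernel_bigcup//.
  rewrite integral_nneseries//; last by move=> n; exact: graph_kernel_measurable.
  under eq_eseriesr do rewrite -hF.
  apply/esym/cvg_lim => //; apply: measure_semi_sigma_additive => //.
  exact: bigcupT_measurable.
- by rewrite -(Borel_rectangles q_dense).
Qed.

Lemma disintegrate (F : E * E -> \bar R) :
  measurable_fun setT (F : Borel (E * E)%type -> \bar R) -> (forall z, (0 <= F z)%E) ->
  measurable_fun setT (fun x : Borel E => \int[K x]_y F (x, y))%E /\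
  (\int[pi]_z F z = \int[mu]_x \int[K x]_y F (x, y))%E.
Proof.
move=> mF F0.
have E1 x : (\int[graph_kernel x]_z F z = \int[K x]_y F (x, y))%E.
  by rewrite ge0_integral_pushforward//; exact: pairB_measurable.
split.
  under eq_fun do rewrite -E1; apply: measurable_fun_integral_kernel => //.
  exact: graph_kernel_measurable.
rewrite (mixture_integral graph_kernel_measurable pi_graph_kernel)//.
by apply: eq_integral => x _; rewrite E1.
Qed.

End Feller_kernel.

(** * Varadhan's lemma *)

Section limsup_liminf.
Context {R : realType}.
Implicit Types (u : nat -> \bar R) (x : \bar R).

Lemma limn_esup_lt_near u x : (limn_esup u < x)%E -> \forall n \near \oo, (u n < x)%E.
Proof.
rewrite /limn_esup limf_esupE => /ereal_inf_lt[_ [V nV <-] ux].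
apply: filterS nV => n Vn; apply: le_lt_trans ux.
by apply: ereal_sup_ubound; exists n.
Qed.

Lemma limn_einf_gt_near u x : (x < limn_einf u)%E -> \forall n \near \oo, (x < u n)%E.
Proof.
rewrite /limn_einf lteNr => /limn_esup_lt_near; apply: filterS => n.
by rewrite lteNr oppeK.
Qed.

Lemma limn_esup_le_near u x : (\forall n \near \oo, (u n <= x)%E) -> (limn_esup u <= x)%E.
Proof.
move=> ux; rewrite /limn_esup limf_esupE.
apply: (@le_trans _ _ (ereal_sup (u @` [set n | (u n <= x)%E]))).
  by apply: ereal_inf_lbound; exists [set n | (u n <= x)%E].
by apply: ge_ereal_sup => _ [n /= un <-].
Qed.

Lemma limn_einf_ge_near u x : (\forall n \near \oo, (x <= u n)%E) -> (x <= limn_einf u)%E.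
Proof.
move=> ux; rewrite /limn_einf leeNr; apply: limn_esup_le_near.
by apply: filterS ux => n; rewrite leeN2.
Qed.

Lemma lne_le_scale (k t : R) (p : \bar R) : 0 < k -> p \is a fin_num ->
  ((k^-1)%:E * lne p <= t%:E)%E -> fine p <= expR (k * t).
Proof.
move=> k0; move: p => [p _|//|//].
have [p0 _|p0] := leP p 0; first by rewrite (le_trans p0)// expR_ge0.
rewrite lne_EFin// -EFinM lee_fin ler_pdivrMl//= => h.
by rewrite -[leLHS]lnK ?posrE// ler_expR.
Qed.

Lemma lne_ge_scale (k t : R) (p : \bar R) : 0 < k -> p \is a fin_num ->
  (t%:E <= (k^-1)%:E * lne p)%E -> expR (k * t) <= fine p.
Proof.
move=> k0; move: p => [p _|//|//].
have [p0|p0] := leP p 0.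
  by rewrite le0_lneNy ?lee_fin// gt0_muleNy ?lte_fin ?invr_gt0// leeNy_eq.
rewrite lne_EFin// -EFinM lee_fin ler_pdivlMl//= => h.
by rewrite -[leRHS]lnK ?posrE// ler_expR.
Qed.

End limsup_liminf.

Section log_moment.
Context d {T : measurableType d} {R : realType} (P : probability T R).
Implicit Types (f g : T -> R) (k : R).

Definition lmgf k f : R := k^-1 * ln (\int[P]_x expR (k * f x)).

Lemma Bm_expR k f : Bm f -> Bm (fun x => expR (k * f x)).
Proof.
move=> [mf [M fM]]; split.
  by apply: measurableT_comp; [exact: measurable_expR|exact: measurable_funM].
exists (expR (`|k| * M)) => x; rewrite ger0_norm ?expR_ge0// ler_expR.
by rewrite (le_trans (ler_norm _))// normrM ler_wpM2l.
Qed.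

Lemma Rint_expR_gt0 k f : Bm f -> 0 < \int[P]_x expR (k * f x).
Proof.
move=> bf; have [mf [M fM]] := bf.
apply: (@lt_le_trans _ _ (expR (- (`|k| * M)))); first exact: expR_gt0.
rewrite -[leLHS](Rint_cst P); apply: Rint_le; [exact: Bm_cst|exact: Bm_expR|].
move=> x; rewrite ler_expR lerNl (le_trans (ler_norm _))// normrN normrM.
by rewrite ler_wpM2l.
Qed.

Lemma lmgf_le k f g : 0 < k -> Bm f -> Bm g -> (forall x, f x <= g x) ->
  lmgf k f <= lmgf k g.
Proof.
move=> k0 bf bg fg; rewrite /lmgf ler_pM2l ?invr_gt0// ler_ln ?posrE ?Rint_expR_gt0//.
apply: Rint_le; [exact: Bm_expR|exact: Bm_expR|].
by move=> x; rewrite ler_expR ler_pM2l.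
Qed.

Lemma lmgfD k f a : 0 < k -> Bm f -> lmgf k (fun x => f x + a) = lmgf k f + a.
Proof.
move=> k0 bf; rewrite /lmgf.
under eq_Rintegral do rewrite mulrDr expRD mulrC.
rewrite RintZ; last exact: Bm_expR.
rewrite lnM ?posrE ?expR_gt0 ?Rint_expR_gt0// expRK mulrDr mulKf ?gt_eqF//.
by rewrite addrC.
Qed.

Lemma lmgf_cst k a : 0 < k -> lmgf k (fun=> a) = a.
Proof. by move=> k0; rewrite /lmgf Rint_cst expRK mulKf ?gt_eqF. Qed.

Lemma lmgf_norm_le k f (M : R) : 0 < k -> measurable_fun setT f ->
  (forall x, `|f x| <= M) -> `|lmgf k f| <= M.
Proof.
move=> k0 mf fM; have bf : Bm f by split => //; exists M.
rewrite ler_norml -{1}(@lmgf_cst k (- M))// -{2}(@lmgf_cst k M)//.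
apply/andP; split; apply: lmgf_le => //; try exact: Bm_cst.
  by move=> x; have := fM x; rewrite ler_norml => /andP[].
by move=> x; have := fM x; rewrite ler_norml => /andP[].
Qed.

End log_moment.

Section Varadhan.
Context {R : realType} {T : ptopologicalType} (P : nat -> probability (Borel T) R).
Variable I : T -> \bar R.
Hypotheses (ldp : kLDP P I) (I_ge0 : forall x, (0 <= I x)%E).
Variable f : T -> R.
Hypothesis cf : Cb f.

Let bf : Bm (f : Borel T -> R). Proof. exact: Cb_Bm. Qed.

(** The bounded range of [f] is cut into [N] slices of height [r = e / 3]. On the closed slice [F i]
    one has [I >= a i - b], so its probability is at most [exp (k (b - a i + r))], while [exp (k f)]
    is at most [exp (k (a i + r))]. The third [r] pays for [ln N / k]. *)
Lemma Varadhan_upper (b e : R) : 0 < e -> (forall y, ((f y - b)%:E <= I y)%E) ->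
  \forall n \near \oo, lmgf (P n) n.+1%:R f <= b + e.
Proof.
move=> e0 fb; have [cf' [M fM]] := cf.
pose r := e / 3; have r0 : 0 < r by rewrite divr_gt0.
have M0 : 0 <= M by rewrite (le_trans _ (fM point)).
pose N := (Num.truncn ((M + M) / r)).+1.
pose a i : R := - M + i%:R * r.
pose F i := [set y | a i <= f y <= a i + r].
have cF i : closed (F i).
  rewrite (_ : F i = f @^-1` `[a i, a i + r]%classic).
    by apply: preimage_closed => //; exact: itv_closed.
  by apply/seteqP; split => y /=; rewrite in_itv.
have mF i : measurable (F i : set (Borel T)).
  by rewrite -[F i]setCK; apply: measurableC; apply: open_Borel; rewrite openC.
have cover y : exists i : 'I_N, F i y.
  have [f1 f2] : - M <= f y /\ f y <= M by have := fM y; rewrite ler_norml => /andP[].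
  pose t := (f y + M) / r.
  have t0 : 0 <= t by rewrite divr_ge0//; [lra|exact: ltW].
  have tN : (Num.truncn t < N)%N.
    by rewrite ltnS; apply: le_truncn; rewrite ler_pM2r ?invr_gt0//; lra.
  exists (Ordinal tN); rewrite /F/= /a.
  have /andP[h1 h2] : (Num.truncn t)%:R <= t < (Num.truncn t).+1%:R by exact: truncn_itv.
  move: h1 h2; rewrite {2 3}/t ler_pdivlMr// ltr_pdivrMr// -natr1 mulrDl mul1r => h1 h2.
  by apply/andP; split; lra.
have piece (i : 'I_N) : \forall n \near \oo,
    fine (P n (F i)) <= expR (n.+1%:R * (b - a i + r)).
  have inf : ((a i - b)%:E <= ereal_inf (I @` F i))%E.
    apply: le_ereal_inf_tmp => _ [y /= /andP[ay _] <-]; apply: le_trans (fb y).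
    by rewrite lee_fin lerD2r.
  have : (limn_esup (fun n => (n.+1%:R^-1)%:E * lne (P n (F i))) < (b - a i + r)%:E)%E.
    apply: le_lt_trans (proj1 ldp (F i) (cF i)) _.
    apply: (@le_lt_trans _ _ (b - a i)%:E); last by rewrite lte_fin ltrDl.
    by rewrite leeNl -EFinN opprB.
  move/limn_esup_lt_near; apply: filterS => n /ltW; apply: lne_le_scale; first by [].
  exact: fin_num_measure.
have lnN : \forall n \near \oo, ln N%:R <= r * n.+1%:R.
  exists (Num.truncn (ln N%:R / r)) => // n /= hn.
  rewrite mulrC -ler_pdivrMr//; apply: (le_trans (ltW (truncnS_gt _))).
  by rewrite ler_nat.
have all_pieces : \forall n \near \oo, forall i : 'I_N,
    fine (P n (F i)) <= expR (n.+1%:R * (b - a i + r)).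
  exact: filter_forall.
near=> n.
have pieces_n : forall i : 'I_N, fine (P n (F i)) <= expR (n.+1%:R * (b - a i + r)) by near: n.
have lnN_n : ln N%:R <= r * n.+1%:R by near: n.
have k0 : 0 < n.+1%:R :> R by rewrite ltr0n.
set k : R := n.+1%:R in k0 *.
have bexp : Bm (fun y : Borel T => expR (k * f y)) by exact: Bm_expR.
have bind (i : 'I_N) : Bm (fun y : Borel T => expR (k * (a i + r)) * \1_(F i) y).
  apply: BmM; first exact: Bm_cst.
  split; first exact: measurable_indic.
  by exists 1 => x; rewrite ger0_norm ?indic_le1.
have : \int[P n]_y expR (k * f y) <= N%:R * expR (k * (b + r + r)).
  apply: (@le_trans _ _ (\int[P n]_y (\sum_(i < N) expR (k * (a i + r)) * \1_(F i) y))).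
    apply: Rint_le => //; first exact: Bm_sum.
    move=> y; have [i Fy] := cover y.
    rewrite (bigD1 i)//= indicE mem_set// mulr1 (@le_trans _ _ (expR (k * (a i + r))))//.
      by rewrite ler_expR ler_pM2l//; case/andP : Fy.
    by rewrite lerDl sumr_ge0// => j _; rewrite mulr_ge0 ?expR_ge0.
  rewrite Rint_sum// -[X in X%:R * _](card_ord N) mulr_natl -sumr_const.
  apply: ler_sum => i _; rewrite RintZ; last first.
    split; first exact: measurable_indic.
    by exists 1 => x; rewrite ger0_norm ?indic_le1.
  rewrite /Rintegral integral_indic// setIT.
  have -> : b + r + r = (a i + r) + (b - a i + r) by ring.
  rewrite [k * (a i + r + _)]mulrDr expRD ler_pM2l ?expR_gt0//.
  exact: pieces_n.
move=> hI; have h : ln (\int[P n]_y expR (k * f y)) <= ln (N%:R * expR (k * (b + r + r))).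
  by rewrite ler_ln ?posrE ?mulr_gt0 ?expR_gt0 ?ltr0n ?Rint_expR_gt0.
rewrite /lmgf ler_pdivrMl// (le_trans h)// lnM ?posrE ?expR_gt0 ?ltr0n// expRK.
have -> : k * (b + e) = r * k + k * (b + r + r) by rewrite /r; field.
by rewrite lerD2r.
Unshelve. all: by end_near. Qed.

(** Half of [e] pays for the oscillation of [f] on the open set [G] around [y], the other half for
    the lower bound of the LDP on [G]. *)
Lemma Varadhan_lower y (r e : R) : 0 < e -> (I y <= r%:E)%E ->
  \forall n \near \oo, f y - r - e <= lmgf (P n) n.+1%:R f.
Proof.
move=> e0 Iy; have [/continuousP cf' _] := cf.
pose h := e / 2; have h0 : 0 < h by rewrite divr_gt0.
pose G := [set z | f y - h < f z].
have oG : open G.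
  rewrite (_ : G = f @^-1` [set t | f y - h < t]) //.
  by apply: cf'; exact: open_gt.
have Gy : G y by rewrite /G/= gtrBl.
have inf : (- r%:E <= - ereal_inf (I @` G))%E.
  by rewrite leeN2; apply: le_trans Iy; apply: ereal_inf_lbound; exists y.
have : ((- r - h)%:E < limn_einf (fun n => (n.+1%:R^-1)%:E * lne (P n G)))%E.
  apply: lt_le_trans (proj2 ldp G oG); apply: lt_le_trans inf.
  by rewrite -EFinN lte_fin gtrBl.
move/limn_einf_gt_near; apply: filterS => n.
have k0 : 0 < n.+1%:R :> R by rewrite ltr0n.
have mG : measurable (G : set (Borel T)) by exact: open_Borel.
set k : R := n.+1%:R in k0 *.
move=> /ltW/(lne_ge_scale k0 (fin_num_measure _ _ mG)) hG.
have bG : Bm (\1_G : Borel T -> R).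
  split; first exact: measurable_indic.
  by exists 1 => x; rewrite ger0_norm ?indic_le1.
rewrite /lmgf ler_pdivlMl// -ler_expR lnK ?posrE ?Rint_expR_gt0//.
apply: (@le_trans _ _ (\int[P n]_z (expR (k * (f y - h)) * \1_G z))).
  rewrite RintZ// /Rintegral integral_indic// setIT.
  have -> : k * (f y - r - e) = k * (f y - h) + k * (- r - h) by rewrite /h; field.
  by rewrite expRD ler_pM2l ?expR_gt0.
apply: Rint_le.
- by apply: BmM => //; exact: Bm_cst.
- exact: Bm_expR.
move=> z; rewrite indicE; have [/set_mem zG|] := boolP (z \in G).
  by rewrite mulr1 ler_expR ler_pM2l//; apply: ltW.
by rewrite mulr0 expR_ge0.
Qed.

End Varadhan.

Section Varadhan_limit.
Context {R : realType} {T : ptopologicalType} (P : nat -> probability (Borel T) R).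
Variable I : T -> \bar R.
Hypotheses (ldp : kLDP P I) (I_ge0 : forall x, (0 <= I x)%E).

(** The supremum of [f - I] is expressed as the least [b] with [f - b <= I]; this form is
    real-valued in [b] and is how the limit is used throughout. *)
Lemma Varadhan (f : T -> R) : Cb f -> exists L : R,
  [/\ lmgf (P n) n.+1%:R f @[n --> \oo] --> L,
      forall y, ((f y - L)%:E <= I y)%E &
      forall b : R, (forall y, ((f y - b)%:E <= I y)%E) -> L <= b].
Proof.
move=> cf; have [cf' [M fM]] := cf.
pose S := [set v : R | exists y r, I y = r%:E /\ v = f y - r].
(* If [I] were [+oo] everywhere, the upper bound would hold with [b = - M - 2] and error 1,
   contradicting that the cumulants are at least [- M]. *)
have S0 : S !=set0.
  apply: contrapT => /forallNP S0.
  have Iy y : I y = +oo%E.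
    move: (I_ge0 y) (S0 (f y - fine (I y))); case E : (I y) => [r||]// _ [].
    by exists y, r; rewrite E.
  have := @Varadhan_upper _ _ _ _ ldp _ cf (- M - 2) 1 ltr01.
  move=> /(_ (fun y => eq_ind_r (fun z => (_ <= z)%E) (leey _) (Iy y))).
  move=> [n _ /(_ n (leqnn n))] /=.
  have : `|lmgf (P n) n.+1%:R f| <= M.
    by apply: lmgf_norm_le => //; exact: continuous_Borel.
  rewrite ler_norml => /andP[+ _]; lra.
have Sub : ubound S M.
  move=> _ [y [r [Iy ->]]]; have := I_ge0 y; rewrite Iy lee_fin => r0.
  have := fM y; rewrite ler_norml => /andP[_ h]; lra.
have hS : has_sup S by split => //; exists M.
exists (sup S); split.
- apply/cvgrPdist_le => e e0.
  have e20 : 0 < e / 2 by rewrite divr_gt0.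
  have up : forall y, ((f y - sup S)%:E <= I y)%E.
    move=> y; case E : (I y) (I_ge0 y) => [r||]//= _; last exact: leey.
    rewrite lee_fin lerBlDr -lerBlDl; apply: ub_le_sup; first by exists M.
    by exists y, r.
  have [_ [y [r [Iy ->]]] hv] := sup_adherent e20 hS.
  have := @Varadhan_upper _ _ _ _ ldp _ cf _ _ e20 up.
  have Iyr : (I y <= r%:E)%E by rewrite Iy.
  have := @Varadhan_lower _ _ _ _ ldp _ cf _ _ _ e20 Iyr.
  apply: filterS2 => n h1 h2; rewrite ler_norml; apply/andP; split; lra.
- move=> y; case E : (I y) (I_ge0 y) => [r||]//= _; last exact: leey.
  rewrite lee_fin lerBlDr -lerBlDl; apply: ub_le_sup; first by exists M.
  by exists y, r.
- move=> b hb; apply: ge_sup => // _ [y [r [Iy ->]]].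
  by have := hb y; rewrite Iy lee_fin; lra.
Qed.

End Varadhan_limit.

(** * Relative entropy *)

Section bounded_density.
Context d (T : measurableType d) (R : realType).
Variables (Q P : probability T R) (g : T -> R).
Hypotheses (mg : measurable_fun setT g) (g0 : forall x, (0 <= g x)%R).
Hypothesis PE : forall A, measurable A -> P A = (\int[Q]_(x in A) (g x)%:E)%E.

Lemma integrable_density : Q.-integrable setT (EFin \o g).
Proof.
apply/integrableP; split; first exact/measurable_EFinP.
under eq_integral do rewrite /= ger0_norm//.
by rewrite -PE// probability_setT ltry.
Qed.

Lemma integral_density (W : T -> R) : Bm W ->
  Q.-integrable setT (fun x => (g x * W x)%:E) /\
  (\int[Q]_x (g x * W x)%:E = (\int[P]_x W x)%:E)%E.
Proof.
move=> bW; have [mW [M WM]] := bW.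
have igM : Q.-integrable setT (fun x => (M * g x)%:E).
  by under eq_fun do rewrite EFinM; apply: integrableZl => //; exact: integrable_density.
(* The density formula is available for nonnegative integrands; the signed [W] is shifted by its
   bound, and the shift is removed by linearity. *)
have WM0 x : 0 <= W x + M by have := WM x; rewrite ler_norml => /andP[]; lra.
have bWM : Bm (fun x => W x + M) by apply: BmD => //; exact: Bm_cst.
have E1 : (\int[Q]_x (g x * (W x + M))%:E = (\int[P]_x (W x + M))%:E)%E.
  rewrite -Bm_EFin// (ge0_integral_density mg g0 PE)//.
  by apply/measurable_EFinP; case: bWM.
have igWM : Q.-integrable setT (fun x => (g x * (W x + M))%:E).
  apply/integrableP; split.
    by apply/measurable_EFinP; apply: measurable_funM => //; case: bWM.
  under eq_integral do rewrite /= ger0_norm ?mulr_ge0//.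
  by rewrite E1 ltry.
have E2 x : (g x * W x)%:E = ((g x * (W x + M))%:E - (M * g x)%:E)%E.
  by rewrite -EFinB; congr EFin; ring.
split; first by under eq_fun do rewrite E2; exact: integrableB.
under eq_integral do rewrite E2.
rewrite integralB// E1 RintD//; last exact: Bm_cst.
rewrite Rint_cst.
have -> : (\int[Q]_x (M * g x)%:E = M%:E)%E.
  under eq_integral do rewrite EFinM; rewrite integralZl//; last exact: integrable_density.
  by rewrite -PE// probability_setT mule1.
by rewrite -EFinB addrK.
Qed.

End bounded_density.

(** Fenchel-Young inequality for the conjugate pair [g ln g - g] and [exp w]; it is [1 + u <= exp u]
    at [u = w - ln g], multiplied by [g]. *)
Lemma Young_entropy {R : realType} (g w : R) : 0 <= g ->
  g * w + g <= g * ln g + expR w.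
Proof.
rewrite le_eqVlt => /predU1P[<-|g0]; first by rewrite !mul0r !add0r expR_ge0.
have -> : expR w = g * expR (w - ln g) by rewrite expRD expRN lnK// mulrCA mulfV ?mulr1// gt_eqF.
rewrite -mulrDr -{2}(mulr1 g) -mulrDr ler_pM2l//.
have := expR_ge1Dx (w - ln g); lra.
Qed.

Section entropy.
Context d (T : measurableType d) (R : realType).
Implicit Types P Q : probability T R.

Lemma relent_variational P Q (W : T -> R) (t : R) : Bm W ->
  \int[Q]_x expR (W x) = 1 -> (relent P Q <= t%:E)%E -> \int[P]_x W x <= t.
Proof.
move=> bW eW ht; apply/ler_addgt0Pr => e e0.
have : (relent P Q < (t + e)%:E)%E by apply: le_lt_trans ht _; rewrite lte_fin ltrDl.
move=> /ereal_inf_lt[_ [g [mg g0 PE] <-]] hlt.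
pose A x := g x * ln (g x).
have mA : measurable_fun setT A.
  by apply: measurable_funM => //; apply: measurableT_comp => //; exact: measurable_ln.
have A1 x : - 1 <= A x.
  have := @Young_entropy _ (g x) 0 (g0 x); rewrite mulr0 expR0 add0r /A; have := g0 x; lra.
have neg1 : (\int[Q]_x ((EFin \o A)^\-%E x) <= 1)%E.
  rewrite -(@probability_setT _ _ _ Q) -[leRHS]mul1e -integral_cst//.
  apply: ge0_le_integral => //.
    by apply: measurable_funeneg; exact/measurable_EFinP.
  move=> x _; rewrite funenegE /= -EFin_max lee_fin ge_max.
  by rewrite ler01 andbT lerNl.
have posy : (\int[Q]_x ((EFin \o A)^\+ x) < +oo)%E.
  have := hlt; rewrite integralE -/A.
  have : (\int[Q]_x ((EFin \o A)^\- x))%E \is a fin_num.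
    by rewrite ge0_fin_numE ?integral_ge0// (le_lt_trans neg1) ?ltry.
  move=> negf; rewrite lteBlDr// => /lt_trans; apply.
  by rewrite -(fineK negf) ltry.
have iA : Q.-integrable setT (EFin \o A).
  apply/integrableP; split; first exact/measurable_EFinP.
  have absE x : (`|(EFin \o A) x| = (EFin \o A)^\+%E x + (EFin \o A)^\-%E x)%E.
    by rewrite -[LHS]/((abse \o (EFin \o A)) x) fune_abse.
  under eq_integral do rewrite absE.
  rewrite ge0_integralD//; first last.
  - by apply: measurable_funeneg; exact/measurable_EFinP.
  - by apply: measurable_funepos; exact/measurable_EFinP.
  by rewrite lte_add_pinfty// (le_lt_trans neg1) ?ltry.
have bexp : Bm (fun x => expR (W x)).
  by have := Bm_expR 1 bW; under eq_fun do rewrite mul1r.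
have ie : Q.-integrable setT (fun x => (expR (W x))%:E) by exact: (Bm_integrable Q bexp).
have [igW EgW] := integral_density mg g0 PE bW.
have ig := integrable_density mg g0 PE.
(* In the integrated Young inequality the terms [int g dQ] and [int exp W dQ] both equal 1 and
   cancel. *)
have : (\int[Q]_x ((g x * W x)%:E + (g x)%:E) <=
        \int[Q]_x ((EFin \o A) x + (expR (W x))%:E))%E.
  apply: le_integral => //; [exact: integrableD|exact: integrableD|].
  by move=> x _; rewrite -!EFinD lee_fin; exact: Young_entropy.
rewrite integralD// integralD// EgW -(PE setT)// probability_setT (Bm_EFin Q bexp) eW.
rewrite leeD2rE// => h.
by rewrite -lee_fin (le_trans h)// ltW.
Qed.

End entropy.

Section tilting.
Context d (T : measurableType d) (R : realType) (Q : probability T R) (W : T -> R).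
Hypotheses (bW : Bm W) (W1 : \int[Q]_x expR (W x) = 1).

Let bexp : Bm (fun x => expR (W x)).
Proof. by have := Bm_expR 1 bW; under eq_fun do rewrite mul1r. Qed.

Let mexp : measurable_fun setT (fun x => (expR (W x))%:E).
Proof. by apply/measurable_EFinP; case: bexp. Qed.

(** The entropy is only bounded above: [relent] is an infimum over densities, and [exp W] is one of
    them. *)
Lemma tilt_exists : exists P : probability T R,
  (forall A, measurable A -> P A = (\int[Q]_(x in A) (expR (W x))%:E)%E) /\
  (relent P Q <= (\int[P]_x W x)%:E)%E.
Proof.
pose m A := (\int[Q]_(x in A) (expR (W x))%:E)%E.
have m0 : m set0 = 0%E by exact: integral_set0.
have mge0 A : (0 <= m A)%E by apply: integral_ge0 => x _; rewrite lee_fin expR_ge0.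
have msig : semi_sigma_additive m.
  move=> F mF tF mUF; rewrite /m.
  rewrite ge0_integral_bigcup//.
    by apply: is_cvg_nneseries => n _ _; exact: mge0.
  exact: measurable_funTS.
have m1 : m setT = 1%E by rewrite /m Bm_EFin// W1.
pose P : probability T R := build_probability m0 mge0 msig m1.
have PE A : measurable A -> P A = (\int[Q]_(x in A) (expR (W x))%:E)%E by [].
exists P; split => //.
have e0 x : 0 <= expR (W x) by exact: expR_ge0.
have [_ E] := integral_density (proj1 bexp) e0 PE bW.
rewrite -E; apply: ereal_inf_lbound; exists (fun x => expR (W x)).
  by split => //; case: bexp.
by apply: eq_integral => x _; rewrite expRK.
Qed.

End tilting.

(** * The entropic functionals and their cumulants *)

Lemma rV_separable (R : realType) (d : nat) :
  exists q : nat -> 'rV[R]_d, forall x (e : R), 0 < e -> exists n, `|x - q n| < e.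
Proof.
exists (fun n => if (unpickle n : option 'rV[rat]_d) is Some v
  then \row_j (ratr (v ord0 j)) else 0) => x e e0.
have /choice[v hv] : forall j : 'I_d, exists a : rat, `|x ord0 j - ratr a| < e.
  move=> j; have /rat_in_itvoo[a] : x ord0 j - e < x ord0 j + e by lra.
  rewrite in_itv/= => /andP[a1 a2]; exists a; rewrite ltr_norml; apply/andP; split; lra.
exists (pickle (\row_j v j)); rewrite pickleK.
have : ball x e (\row_j (ratr ((\row_j v j) ord0 j)) : 'rV[R]_d).
  split=> [|i j]; first exact: e0.
  rewrite !mxE (ord1 i) -ball_normE /=; exact: hv.
by rewrite -ball_normE.
Qed.

Lemma pair_separable (R : realType) (E : normedModType R) (q : nat -> E) :
  (forall x (e : R), 0 < e -> exists n, `|x - q n| < e) ->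
  exists q2 : nat -> E * E, forall z (e : R), 0 < e -> exists n, `|z - q2 n| < e.
Proof.
move=> hq.
exists (fun n => if (unpickle n : option (nat * nat)) is Some (i, j)
  then (q i, q j) else (0, 0)) => -[x y] e e0.
have [i hi] := hq x e e0; have [j hj] := hq y e e0.
exists (pickle (i, j)); rewrite pickleK.
have : ball (x, y) e (q i, q j) by split; rewrite /= -ball_normE.
by rewrite -ball_normE.
Qed.

Section marginals.
Context {R : realType} {d : nat}.
Local Notation E := 'rV[R]_d.
Implicit Types (rho : probability (Borel (E * E)%type) R) (mu : probability (Borel E) R).

Definition fstB (z : Borel (E * E)%type) : Borel E := z.1.
Definition sndB (z : Borel (E * E)%type) : Borel E := z.2.

Lemma fstB_measurable : measurable_fun setT fstB.
Proof. by apply: (@continuous_Borel_fun (E * E)%type E) => z; exact: cvg_fst. Qed.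

Lemma sndB_measurable : measurable_fun setT sndB.
Proof. by apply: (@continuous_Borel_fun (E * E)%type E) => z; exact: cvg_snd. Qed.

Let Rint_image (p : Borel (E * E)%type -> Borel E) (mp : measurable_fun setT p) rho mu
    (u : Borel E -> R) :
  (forall A, measurable A -> rho (p @^-1` A) = mu A) -> Bm u ->
  \int[rho]_z u (p z) = \int[mu]_x u x.
Proof.
move=> H bu; congr fine.
rewrite (eq_measure_integral (measure_function_pushforward__canonical__measure_function_Measure rho mp)); last first.
  by move=> A mA _; rewrite /= /pushforward H.
rewrite integral_pushforward//.
  by apply/measurable_EFinP; case: bu.
apply: (@Bm_integrable _ _ _ rho (u \o p)); split.
  by apply: measurableT_comp => //; case: bu.
by case: bu => _ [M uM]; exists M => z; exact: uM.
Qed.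

Lemma marg1_Rint rho mu (u : Borel E -> R) : marg1 rho mu -> Bm u ->
  \int[rho]_z u z.1 = \int[mu]_x u x.
Proof.
move=> H; apply: (Rint_image fstB_measurable) => A mA; rewrite -H//.
by congr (rho _); apply/seteqP; split => [z|z []].
Qed.

Lemma marg2_Rint rho mu (u : Borel E -> R) : marg2 rho mu -> Bm u ->
  \int[rho]_z u z.2 = \int[mu]_x u x.
Proof.
move=> H; apply: (Rint_image sndB_measurable) => A mA; rewrite -H//.
by congr (rho _); apply/seteqP; split => [z|z []].
Qed.

Lemma marg2_exists rho : exists nu, marg2 rho nu.
Proof.
pose m : {measure set (Borel E) -> \bar R} :=
  measure_function_pushforward__canonical__measure_function_Measure rho sndB_measurable.
have m1 : m setT = 1%E by rewrite /m/= /pushforward preimage_setT probability_setT.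
exists (build_probability (measure0 m) (measure_ge0 m) (@measure_semi_sigma_additive _ _ _ m) m1).
move=> B mB; rewrite /build_probability /= /m /= /pushforward.
by congr (rho _); apply/seteqP; split => [z []|z].
Qed.

End marginals.

Section Schroedinger.
Context {R : realType} {d : nat}.
Local Notation E := 'rV[R]_d.
Variables (mu : probability (Borel E) R) (K : nat -> E -> probability (Borel E) R)
  (c : E -> E -> \bar R) (pik : nat -> probability (Borel (E * E)%type) R).
Hypotheses (hFeller : forall n, feller (K n))
  (hLDP : forall x, kLDP (fun n => K n x) (c x))
  (hgood : forall x, good_rate (c x))
  (hpi : forall n (A B : set (Borel E)), measurable A -> measurable B ->
     pik n (A `*` B) = (\int[mu]_(x in A) K n x B)%E).
Implicit Types (F G : Borel (E * E)%type -> R) (n : nat).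

Lemma Bm_slice F (x : Borel E) : Bm F -> Bm (fun y : Borel E => F (x, y)).
Proof.
move=> [mF [M FM]]; split; last by exists M => y; exact: FM.
exact: (measurableT_comp mF (pairB_measurable x)).
Qed.

Lemma disintegrate_Bm n G : Bm G ->
  Bm (fun x : Borel E => \int[K n x]_y G (x, y)) /\
  \int[pik n]_z G z = \int[mu]_x \int[K n x]_y G (x, y).
Proof.
move=> bG; have [mG [M GM]] := bG.
have [q hq] := rV_separable R d.
have GM0 z : 0 <= G z + M by have := GM z; rewrite ler_norml => /andP[]; lra.
have bGM : Bm (fun z => G z + M) by apply: BmD => //; exact: Bm_cst.
have := @disintegrate _ _ q hq (K n) (@hFeller n) mu (pik n) (@hpi n) (fun z => (G z + M)%:E).
case=> [|z|mI].
- by apply/measurable_EFinP; case: bGM.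
- by rewrite lee_fin.
have bs (x : Borel E) := Bm_slice x bG.
have Ex x : (\int[K n x]_y (G (x, y) + M)%:E)%E = (\int[K n x]_y G (x, y) + M)%:E.
  rewrite Bm_EFin; last by apply: BmD => //; exact: Bm_cst.
  by rewrite RintD ?Rint_cst//; exact: Bm_cst.
have bI : Bm (fun x : Borel E => \int[K n x]_y G (x, y)).
  split; last first.
    by exists M => x; apply: Rint_norm_le => //; case: (bs x).
  have : measurable_fun setT (fun x : Borel E => (\int[K n x]_y G (x, y) + M)%:E).
    by under eq_fun do rewrite -Ex.
  move/measurable_EFinP => h.
  rewrite (_ : (fun x => _) = (fun x : Borel E => \int[K n x]_y G (x, y) + M - M)).
    exact: measurable_funB.
  by apply/funext => x; rewrite addrK.
under [in RHS]eq_integral do rewrite Ex.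
rewrite Bm_EFin// RintD ?Rint_cst//; last exact: Bm_cst.
rewrite Bm_EFin; last by apply: BmD => //; exact: Bm_cst.
rewrite RintD ?Rint_cst//; last exact: Bm_cst.
by move=> [] /addIr.
Qed.

Definition lam n F (x : Borel E) : R := lmgf (K n x) n.+1%:R (fun y => F (x, y)).
Definition phi n F : R := \int[mu]_x lam n F x.

Let k0 n : 0 < n.+1%:R :> R. Proof. by rewrite ltr0n. Qed.

Lemma lam_norm_le n F (M : R) x : measurable_fun setT F -> (forall z, `|F z| <= M) ->
  `|lam n F x| <= M.
Proof.
move=> mF FM; apply: lmgf_norm_le => //.
by have [] := @Bm_slice F x (conj mF (ex_intro _ M FM)).
Qed.

Lemma lam_Bm n F : Bm F -> Bm (lam n F).
Proof.
move=> bF; have [mF [M FM]] := bF; split; last first.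
  by exists M => x; exact: lam_norm_le.
apply: measurable_funM => //; apply: measurableT_comp; first exact: measurable_ln.
by have [[]] := disintegrate_Bm n (Bm_expR n.+1%:R bF).
Qed.

Lemma lam_le n F G x : Bm F -> Bm G -> (forall y, F (x, y) <= G (x, y)) ->
  lam n F x <= lam n G x.
Proof. by move=> bF bG FG; apply: lmgf_le => //; exact: Bm_slice. Qed.

Lemma lamD n F (a : R) x : Bm F -> lam n (fun z => F z + a) x = lam n F x + a.
Proof. by move=> bF; apply: lmgfD => //; exact: Bm_slice. Qed.

(** Log-density of the tilted coupling with respect to [pik n]. Subtracting [lam n F] normalises
    every fibre separately, not just the total mass, so the first marginal remains [mu]. *)
Definition tilt_weight n F (z : Borel (E * E)%type) : R :=
  n.+1%:R * (F z - lam n F z.1).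

Lemma Bm_fst (u : Borel E -> R) : Bm u -> Bm (fun z : Borel (E * E)%type => u z.1).
Proof.
move=> [mu' [M uM]]; split; last by exists M => z; exact: uM.
exact: (measurableT_comp mu' fstB_measurable).
Qed.

Lemma tilt_weight_Bm n F : Bm F -> Bm (tilt_weight n F).
Proof.
move=> bF; apply: BmM; first exact: Bm_cst.
by apply: BmB => //; apply: Bm_fst; exact: lam_Bm.
Qed.

Let Bm_exp d' (T : measurableType d') (f : T -> R) : Bm f -> Bm (fun x => expR (f x)).
Proof.
move=> bf; have := Bm_expR 1 bf.
by rewrite (_ : (fun x => expR (1 * f x)) = fun x => expR (f x))//; apply/funext => x; rewrite mul1r.
Qed.

Lemma tilt_slice n F G x : Bm F -> Bm G ->
  \int[K n x]_y expR (tilt_weight n F (x, y) + n.+1%:R * G (x, y)) =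
  expR (n.+1%:R * (lam n (fun z => F z + G z) x - lam n F x)).
Proof.
move=> bF bG.
have bs := Bm_slice x (BmD bF bG).
have -> : expR (n.+1%:R * (lam n (fun z => F z + G z) x - lam n F x)) =
    expR (- (n.+1%:R * lam n F x)) * \int[K n x]_y expR (n.+1%:R * (F (x, y) + G (x, y))).
  rewrite mulrBr addrC expRD; congr (_ * _).
  by rewrite /lam /lmgf mulVKf ?gt_eqF// lnK// posrE; exact: (Rint_expR_gt0 (K n x) _ bs).
rewrite -RintZ; last exact: Bm_expR bs.
by apply: eq_Rintegral => y _; rewrite -expRD; congr expR; rewrite /tilt_weight /=; ring.
Qed.

Lemma tilt_total n F G : Bm F -> Bm G ->
  \int[pik n]_z expR (tilt_weight n F z + n.+1%:R * G z) =
  \int[mu]_x expR (n.+1%:R * (lam n (fun z => F z + G z) x - lam n F x)).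
Proof.
move=> bF bG.
have bW : Bm (fun z => tilt_weight n F z + n.+1%:R * G z).
  by apply: BmD; [exact: tilt_weight_Bm|apply: BmM => //; exact: Bm_cst].
have be := Bm_exp bW.
have [_ ->] := disintegrate_Bm n be.
by apply: eq_Rintegral => x _; rewrite tilt_slice.
Qed.

Lemma tilt_weight_total n F : Bm F -> \int[pik n]_z expR (tilt_weight n F z) = 1.
Proof.
move=> bF; transitivity (\int[pik n]_z expR (tilt_weight n F z + n.+1%:R * 0)).
  by apply: eq_Rintegral => z _; rewrite mulr0 addr0.
rewrite (tilt_total n bF (Bm_cst (0 : R))) -[RHS](Rint_cst mu).
by apply: eq_Rintegral => x _; rewrite lamD// addr0 subrr mulr0 expR0.
Qed.

Lemma Sk_marg1 n P (a : R) : (Sk mu pik n P <= a%:E)%E -> marg1 P mu.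
Proof. by rewrite /Sk; case: asboolP. Qed.

(* The entropic inequality dual to [phi], from the variational formula for the
   entropy tested against [k (F - lam F)]. *)
Lemma Sk_phi_ineq n P (a : R) F : Bm F -> (Sk mu pik n P <= a%:E)%E ->
  \int[P]_z F z <= a + phi n F.
Proof.
move=> bF hS; have m1 := Sk_marg1 hS.
move: hS; rewrite /Sk asboolT// => hS.
have hr : (relent P (pik n) <= (n.+1%:R * a)%:E)%E.
  move: hS; rewrite lee_pdivrMl//.
have := relent_variational (tilt_weight_Bm n bF) (tilt_weight_total n bF) hr.
rewrite /tilt_weight RintZ; last by apply: BmB => //; apply: Bm_fst; exact: lam_Bm.
rewrite ler_pM2l// RintB//; last by apply: Bm_fst; exact: lam_Bm.
by rewrite (marg1_Rint m1 (lam_Bm n bF)) lerBlDr.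
Qed.

(** The last clause replaces differentiation of [phi]: the increment of [phi] is the [mu]-integral
    of [lam (F + G) - lam F], to which [1 + u <= exp u] applies, and the resulting exponential
    integrates to [int exp (k G) dP] by [tilt_total]. *)
Lemma tilt_measure n F : Bm F -> exists P,
  [/\ marg1 P mu,
      (Sk mu pik n P <= (\int[P]_z F z - phi n F)%:E)%E,
      0 <= \int[P]_z F z - phi n F &
      forall G, Bm G -> phi n (fun z => F z + G z) <=
        phi n F + n.+1%:R^-1 * (\int[P]_z expR (n.+1%:R * G z) - 1)].
Proof.
move=> bF.
have bW := tilt_weight_Bm n bF.
have [P [PE hP]] := tilt_exists bW (tilt_weight_total n bF).
have mexp := proj1 (Bm_exp bW).
have e0 z : 0 <= expR (tilt_weight n F z) by exact: expR_ge0.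
have m1 : marg1 P mu.
  move=> A mA.
  have bA : Bm (\1_A : Borel E -> R).
    split; first exact: measurable_indic.
    by exists 1 => x; rewrite ger0_norm ?indic_le1.
  have bAe : Bm (fun z => \1_A (fstB z) * expR (tilt_weight n F z)).
    by apply: BmM; [exact: (Bm_fst bA)|exact: Bm_exp].
  have mA1 : measurable (A `*` setT : set (Borel (E * E)%type)).
    rewrite (_ : _ `*` _ = fstB @^-1` A).
      by rewrite -[X in measurable X]setTI; exact: fstB_measurable.
    by apply/seteqP; split => [z []|z].
  rewrite PE//; transitivity (\int[pik n]_z (\1_A (fstB z) * expR (tilt_weight n F z)))%:E.
    rewrite -Bm_EFin// integral_mkcond; apply: eq_integral => -[x y] _.
    rewrite patchE in_setX in_setT andbT indicE /=.
    by case: (x \in A); rewrite ?mul1r ?mul0r.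
  have [_ ->] := disintegrate_Bm n bAe.
  transitivity (\int[mu]_x \1_A x)%:E.
    congr EFin; apply: eq_Rintegral => x _.
    transitivity (\int[K n x]_y (\1_A x * expR (tilt_weight n F (x, y)))) => //.
    rewrite RintZ; last exact: (Bm_slice x (Bm_exp bW)).
    rewrite (_ : Rintegral _ _ _ = 1) ?mulr1//.
    transitivity (\int[K n x]_y expR (tilt_weight n F (x, y) + n.+1%:R * 0)).
      by apply: eq_Rintegral => y _; rewrite mulr0 addr0.
    rewrite (tilt_slice n x bF (Bm_cst (0 : R))).
    by rewrite lamD// addr0 subrr mulr0 expR0.
  by rewrite -Bm_EFin// integral_indic// setIT.
have ES : (Sk mu pik n P <= (\int[P]_z F z - phi n F)%:E)%E.
  rewrite /Sk asboolT// lee_pdivrMl// (le_trans hP)// lee_fin.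
  rewrite /tilt_weight RintZ; last by apply: BmB => //; apply: Bm_fst; exact: lam_Bm.
  rewrite ler_pM2l// RintB//; last by apply: Bm_fst; exact: lam_Bm.
  by rewrite (marg1_Rint m1 (lam_Bm n bF)).
exists P; split => //.
  (* Nonnegativity of the entropy, obtained by testing with the zero function. *)
  have := Sk_phi_ineq (Bm_cst (0 : R)) ES.
  rewrite Rint_cst /phi; under [X in _ + X]eq_Rintegral do rewrite /lam lmgf_cst//.
  by rewrite Rint_cst addr0.
move=> G bG.
have bFG : Bm (fun z => F z + G z) by exact: BmD.
have beG : Bm (fun z => expR (n.+1%:R * G z)) by exact: Bm_expR.
have -> : \int[P]_z expR (n.+1%:R * G z) =
    \int[mu]_x expR (n.+1%:R * (lam n (fun z => F z + G z) x - lam n F x)).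
  rewrite -tilt_total//; apply: EFin_inj; rewrite -(integral_density mexp e0 PE beG).2.
  rewrite -Bm_EFin; first by apply: eq_integral => z _; rewrite expRD.
  exact: Bm_exp (BmD bW (BmM (Bm_cst (n.+1%:R : R)) bG)).
have bl := lam_Bm n bF; have blG := lam_Bm n bFG.
have bD : Bm (fun x => lam n (fun z => F z + G z) x - lam n F x) by exact: BmB.
rewrite -lerBlDl /phi -RintB// ler_pdivlMl// -RintZ// lerBrDr.
rewrite -[X in _ + X](Rint_cst mu) -RintD//; first last.
- exact: Bm_cst.
- by apply: BmM => //; exact: Bm_cst.
apply: Rint_le.
- by apply: BmD; [apply: BmM => //|]; exact: Bm_cst.
- exact: Bm_expR.
- by move=> x; rewrite addrC; exact: expR_ge1Dx.
Qed.

End Schroedinger.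

Lemma Cb_fst {R : realType} {S T : topologicalType} (u : S -> R) :
  Cb u -> Cb (fun z : S * T => u z.1).
Proof. by move=> cu; apply: (@Cb_comp _ _ _ fst) => // z; exact: cvg_fst. Qed.

Lemma Cb_snd {R : realType} {S T : topologicalType} (u : T -> R) :
  Cb u -> Cb (fun z : S * T => u z.2).
Proof. by move=> cu; apply: (@Cb_comp _ _ _ snd) => // z; exact: cvg_snd. Qed.

Lemma Cb_slice {R : realType} {S T : topologicalType} (F : S * T -> R) (x : S) :
  Cb F -> Cb (fun y => F (x, y)).
Proof.
move=> cF; apply: (@Cb_comp _ _ _ (pair x)) => // y.
by apply: cvg_pair; [exact: cvg_cst|exact: cvg_id].
Qed.

Lemma Cb_expR {R : realType} {T : topologicalType} (f : T -> R) :
  Cb f -> Cb (fun x => expR (f x)).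
Proof.
move=> [cf [M fM]]; split.
  by move=> x; apply: continuous_comp; [exact: cf|exact: continuous_expR].
exists (expR M) => x; rewrite ger0_norm ?expR_ge0// ler_expR.
by rewrite (le_trans (ler_norm _)).
Qed.

Lemma Cb_scale_ln {R : realType} {T : topologicalType} (a M : R) (J : T -> R) :
  continuous J -> (forall x, 0 < J x) -> (forall x, `|a * ln (J x)| <= M) ->
  Cb (fun x => a * ln (J x)).
Proof.
move=> cJ J0 JM; split; last by exists M.
move=> x; apply: cvgM; first exact: cvg_cst.
by apply: continuous_comp; [exact: cJ|exact: continuous_ln].
Qed.

Lemma bigmax_le_sum_dist {R : realType} (J : nat) (a b : nat -> R) :
  \big[Num.max/0]_(j < J) a j <=
  \big[Num.max/0]_(j < J) b j + \sum_(j < J) `|a j - b j|.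
Proof.
elim: J a b => [|J ih] a b; first by rewrite !big_ord0 addr0.
rewrite !big_ord_recl/=.
have := ih (fun j => a j.+1) (fun j => b j.+1).
set A := \big[_/_]_(_ < _) a _; set B := \big[_/_]_(_ < _) b _.
set S := \sum_(_ < _) _ => hA.
rewrite -/A -/B -/S.
have S0 : 0 <= S by exact: sumr_ge0.
have ab := ler_norm (a 0%N - b 0%N); have n0 := normr_ge0 (a 0%N - b 0%N).
by rewrite ge_max; apply/andP; split; case: (leP (b 0%N) B) => h; lra.
Qed.

Section cumulant_limit.
Context {R : realType} {d : nat}.
Local Notation E := 'rV[R]_d.
Variables (mu : probability (Borel E) R) (K : nat -> E -> probability (Borel E) R)
  (c : E -> E -> \bar R) (pik : nat -> probability (Borel (E * E)%type) R).
Hypotheses (hFeller : forall n, feller (K n))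
  (hLDP : forall x, kLDP (fun n => K n x) (c x))
  (hgood : forall x, good_rate (c x))
  (hpi : forall n (A B : set (Borel E)), measurable A -> measurable B ->
     pik n (A `*` B) = (\int[mu]_(x in A) K n x B)%E).
Implicit Types (F G : E * E -> R) (n : nat).

Let c0 x y : (0 <= c x y)%E. Proof. by have [+ _ _] := hgood x; exact. Qed.

Let CbBm2 F : Cb F -> Bm (F : Borel (E * E)%type -> R). Proof. exact: Cb_Bm. Qed.

(** Defined as a limit rather than as the supremum of [F - c], so that measurability in [x] is that
    of a pointwise limit; [LamP] supplies the description through [c]. *)
Definition Lam F (x : Borel E) : R := limn (fun n => lam K n F x).
Definition phi_lim F : R := \int[mu]_x Lam F x.

Lemma LamP F x : Cb F -> [/\ lam K n F x @[n --> \oo] --> Lam F x,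
  forall y, ((F (x, y) - Lam F x)%:E <= c x y)%E &
  forall b : R, (forall y, ((F (x, y) - b)%:E <= c x y)%E) -> Lam F x <= b].
Proof.
move=> cF; have [L [hL h1 h2]] := Varadhan (hLDP x) (c0 x) (Cb_slice x cF).
by have -> : Lam F x = L by exact: (cvg_lim (@Rhausdorff R) hL).
Qed.

Lemma lam_cvg_phi F : Cb F -> [/\ Bm (Lam F), phi mu K n F @[n --> \oo] --> phi_lim F &
  forall M : R, (forall z, `|F z| <= M) -> forall x, `|Lam F x| <= M].
Proof.
move=> cF; have bF := CbBm2 cF.
have H (M : R) : (forall z, `|F z| <= M) -> [/\ measurable_fun setT (Lam F),
    forall x, `|Lam F x| <= M & phi mu K n F @[n --> \oo] --> phi_lim F].
  move=> FM; apply: Rint_dct.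
  - by move=> n; case: (lam_Bm hFeller hpi n bF).
  - by move=> n x; apply: lam_norm_le => //; case: bF.
  - by move=> x; have [] := LamP x cF.
have [_ [M FM]] := cF; have [h1 h2 h3] := H M FM.
split=> //; first by split => //; exists M.
by move=> N FN; have [_ + _] := H N FN.
Qed.

Lemma Lam_ge0 F x : Cb F -> (forall z, 0 <= F z) -> 0 <= Lam F x.
Proof.
move=> cF F0; have [hc _ _] := LamP x cF; apply: limr_ge.
  by apply/cvg_ex; eexists; exact: hc.
apply: nearW => n; rewrite -(@lmgf_cst _ _ _ (K n x) n.+1%:R 0) ?ltr0n//.
apply: (@lam_le _ _ K n (fun=> 0) F x); [exact: Bm_cst|exact: CbBm2|].
by move=> y; exact: F0.
Qed.

(* Dini's theorem on the compact sublevel sets of the rate function. *)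
Lemma Lam_cvg0 (F : nat -> E * E -> R) (x : E) : (forall n, Cb (F n)) ->
  (forall n z, 0 <= F n z) -> (forall z, nonincreasing_seq (F ^~ z)) ->
  (forall z, F n z @[n --> \oo] --> (0 : R)) ->
  Lam (F n) x @[n --> \oo] --> (0 : R).
Proof.
move=> CF F0 Fni Fcvg; apply/cvgrPdist_le => e e0.
have [_ [M FM]] := CF 0%N.
have FnM n z : F n z <= M.
  by rewrite (le_trans (Fni z _ _ (leq0n n)))// (le_trans (ler_norm _)).
(* [M] bounds all the [F n], so where [c x y > M] the inequality [F n - e <= c] is automatic and
   only this one sublevel set has to be covered. *)
have [_ _ /(_ M) /compact_near_coveringP cpt] := hgood x.
have := cpt nat \oo (fun n y => F n (x, y) <= e) ltac:(typeclasses eauto).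
have near_pt y : [set y | (c x y <= M%:E)%E] y ->
    \forall y' \near y & n \near \oo, F n (x, y') <= e.
  move=> _; have := Fcvg (x, y) => /cvgrPdist_lt/(_ _ e0)[m _ /(_ m (leqnn m))].
  rewrite /= sub0r normrN ger0_norm// => Fm.
  have [cs _] := Cb_slice x (CF m).
  exists ([set y' | F m (x, y') < e], [set n | (m <= n)%N]) => /=.
    split; last by exists m.
    have := cs y; move=> /(_ [set t | t < e]); apply.
    by apply: open_nbhs_nbhs; split => //; exact: open_lt.
  by move=> [y' n] [/= h1 h2]; rewrite (le_trans (Fni _ _ _ h2))// ltW.
move=> /(_ near_pt); apply: filterS => n hn.
rewrite sub0r normrN ger0_norm; last exact: Lam_ge0.
have [_ _] := LamP x (CF n); apply => y.
have [cM|cM] := leP (c x y) M%:E.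
  by apply: le_trans (c0 x y); rewrite lee_fin subr_le0; exact: hn.
apply: le_trans (ltW cM); rewrite lee_fin.
by rewrite (le_trans _ (FnM n (x, y)))// gerBl ltW.
Qed.

Lemma phi_lim_cvg0 (F : nat -> E * E -> R) : (forall n, Cb (F n)) ->
  (forall n z, 0 <= F n z) -> (forall z, nonincreasing_seq (F ^~ z)) ->
  (forall z, F n z @[n --> \oo] --> (0 : R)) ->
  phi_lim (F n) @[n --> \oo] --> (0 : R).
Proof.
move=> CF F0 Fni Fcvg; have [_ [M FM]] := CF 0%N.
have FnM n z : `|F n z| <= M.
  rewrite ger0_norm// (le_trans (Fni z _ _ (leq0n n)))// (le_trans (ler_norm _))//.
have [||x|_ _] := @Rint_dct _ (Borel E) R mu (fun n => Lam (F n)) (fun=> 0) M.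
- by move=> n; have [[]] := lam_cvg_phi (CF n).
- by move=> n x; have [_ _ h] := lam_cvg_phi (CF n); exact: h.
- exact: Lam_cvg0.
by rewrite Rint_cst.
Qed.

(** For a function of the second variable the integrand does not move with [x], which is the
    situation of the Feller property. The result makes [lam] itself an admissible test function. *)
Lemma lam_snd_Cb n (h : E -> R) : Cb h -> Cb (fun x : E => lam K n (fun z => h z.2) x).
Proof.
move=> ch; have [_ [M hM]] := ch.
have ck : Cb (fun y => expR (n.+1%:R * h y)) by apply: Cb_expR; exact: CbZ.
apply: (@Cb_scale_ln _ _ _ M (fun x => integ (K n x) (fun y => expR (n.+1%:R * h y)))).
- by move=> x; exact: (@hFeller n _ ck x).
- by move=> x; apply: (Rint_expR_gt0 (K n x) n.+1%:R); exact: Cb_Bm.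
- move=> x; apply: (@lam_norm_le _ _ K n (fun z => h z.2)); last by move=> z; exact: hM.
  exact: (proj1 (CbBm2 (Cb_snd ch))).
Qed.

End cumulant_limit.

(** * Lower bound *)

Section liminf.
Context {R : realType} {d : nat}.
Local Notation E := 'rV[R]_d.
Local Notation PEE := (probability (Borel (E * E)%type) R).
Variables (mu : probability (Borel E) R) (K : nat -> E -> probability (Borel E) R)
  (c : E -> E -> \bar R) (pik : nat -> PEE).
Hypotheses (hFeller : forall n, feller (K n))
  (hLDP : forall x, kLDP (fun n => K n x) (c x))
  (hgood : forall x, good_rate (c x))
  (hpi : forall n (A B : set (Borel E)), measurable A -> measurable B ->
     pik n (A `*` B) = (\int[mu]_(x in A) K n x B)%E).

Let c0 x y : (0 <= c x y)%E. Proof. by have [+ _ _] := hgood x; exact. Qed.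

Lemma marg1_exists (rho : PEE) : exists nu, marg1 rho nu.
Proof.
pose m : {measure set (Borel E) -> \bar R} :=
  measure_function_pushforward__canonical__measure_function_Measure rho fstB_measurable.
have m1 : m setT = 1%E by rewrite /m/= /pushforward preimage_setT probability_setT.
exists (build_probability (measure0 m) (measure_ge0 m) (@measure_semi_sigma_additive _ _ _ m) m1).
move=> B mB; rewrite /build_probability /= /m /= /pushforward.
by congr (rho _); apply/seteqP; split => [z []|z].
Qed.

Lemma marg1_Cb (rho : PEE) :
  (forall u, Cb u -> integ rho (fun z => u z.1) = integ mu u) -> marg1 rho mu.
Proof.
move=> H A mA; have [nu hnu] := marg1_exists rho; rewrite hnu//.
have [q hq] := rV_separable R d.
apply: (Borel_unique hq) => // u cu; rewrite -H//; symmetry.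
exact: (marg1_Rint hnu (Cb_Bm cu)).
Qed.

(** Which tents lie under [c x] depends on [x]. Subtracting [Lam] makes every tent admissible for
    all [x] at once, so that the family is fixed and measurability in [x] is kept. *)
Definition cost_approx (q : nat -> E) J (z : E * E) : R :=
  \big[Num.max/0]_(j < J) (tent q j z.2 - Lam K (fun z => tent q j z.2) z.1).

Let tentC q j : Cb (fun z : E * E => tent q j z.2).
Proof. by apply: Cb_snd; exact: tent_Cb. Qed.

Let LamB q j : Bm (Lam K (fun z => tent q j z.2) : Borel E -> R).
Proof. by have [] := lam_cvg_phi hFeller hLDP hgood hpi (tentC q j). Qed.

Lemma cost_approx_ge0 q J z : 0 <= cost_approx q J z.
Proof. exact: bigmax_ge_id. Qed.

Lemma cost_approx_le q J z : ((cost_approx q J z)%:E <= c z.1 z.2)%E.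
Proof.
rewrite /cost_approx; elim/big_ind : _ => [|x y x0 y0|j _]; first exact: c0.
  by rewrite EFin_max ge_max x0.
by have [_ + _] := LamP hLDP hgood z.1 (tentC q j); exact.
Qed.

Lemma cost_approx_measurable q J :
  measurable_fun setT (cost_approx q J : Borel (E * E)%type -> R).
Proof.
rewrite /cost_approx; elim: (index_enum _) => [|j r ih].
  by under eq_fun do rewrite big_nil; exact: measurable_cst.
under eq_fun do rewrite big_cons; apply: measurable_maxr => //.
apply: measurable_funB; first by case: (Cb_Bm (tentC q j)).
by have [] := Bm_fst (LamB q j).
Qed.

Lemma cost_approx_nd q z : nondecreasing_seq (fun J => (cost_approx q J z)%:E).
Proof.
move=> I J IJ; rewrite lee_fin /cost_approx.
elim/big_ind : _ => [|x y x0 y0|j _]; [exact: cost_approx_ge0|by rewrite ge_max x0|].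
exact: (@le_bigmax _ _ _ _
  (fun j : 'I_J => tent q j z.2 - Lam K (fun z => tent q j z.2) z.1) (widen_ord IJ j)).
Qed.

(* A tent [h] below [c z.1] satisfies [Lam h <= 0], hence [h <= h - Lam h]. *)
Lemma cost_approx_cvg q z :
  (forall x (e : R), 0 < e -> exists n, `|x - q n| < e) ->
  (cost_approx q J z)%:E @[J --> \oo] --> c z.1 z.2.
Proof.
move=> hq; have [_ cc _] := hgood z.1.
have [P [Pc Pcvg]] := lsc_tent_max hq (c0 z.1) cc.
apply: (@squeeze_cvge _ _ _ _ (fun J => (tent_max q P J z.2)%:E) _ (fun=> c z.1 z.2)).
- apply: nearW => J; rewrite cost_approx_le andbT lee_fin /tent_max.
  elim/big_ind : _ => [|x y x0 y0|j Pj]; [exact: cost_approx_ge0|by rewrite ge_max x0|].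
  apply: (@le_trans _ _ (tent q j z.2 - Lam K (fun z => tent q j z.2) z.1)); last first.
    exact: (@le_bigmax _ _ _ _
      (fun j : 'I_J => tent q j z.2 - Lam K (fun z => tent q j z.2) z.1) j).
  rewrite lerBrDr gerDl; have [_ _] := LamP hLDP hgood z.1 (tentC q j); apply => y.
  rewrite subr0; apply: le_trans (Pc j.+1 y); rewrite lee_fin.
  exact: (@tent_le_max _ _ q P j.+1 ord_max).
- exact: Pcvg.
- exact: cvg_cst.
Qed.

(** The hypotheses on [c] concern each slice [c x] separately; joint measurability is inherited from
    the approximations [cost_approx]. *)
Lemma cost_measurable :
  measurable_fun setT (fun z : Borel (E * E)%type => c z.1 z.2).
Proof.
have [q hq] := rV_separable R d.
apply: (@emeasurable_fun_cvg _ (Borel (E * E)%type) R setT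
  (fun J (z : Borel (E * E)%type) => (cost_approx q J z)%:E)).
  by move=> J; apply/measurable_EFinP; exact: cost_approx_measurable.
by move=> z _; exact: cost_approx_cvg.
Qed.

Lemma coupling_cost_le (rho : PEE) (a : R) : marg1 rho mu ->
  (forall f, Cb f -> integ rho f <= a + phi_lim mu K f) ->
  (\int[rho]_p c p.1 p.2 <= a%:E)%E.
Proof.
move=> m1 ineq.
have [q hq] := rV_separable R d.
pose h j : E -> R := tent q j.
have hC j : Cb (h j) by exact: tent_Cb.
have HC j : Cb (fun z : E * E => h j z.2) by exact: Cb_snd.
pose u m j (x : E) := lam K m (fun z => h j z.2) x.
pose ul j (x : E) := Lam K (fun z => h j z.2) x.
have uC m j : Cb (u m j) by exact: (lam_snd_Cb hFeller).
have ucvg j x : u m j x @[m --> \oo] --> ul j x by have [] := LamP hLDP hgood x (HC j).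
have ulB j : Bm (ul j : Borel E -> R).
  by have [] := lam_cvg_phi hFeller hLDP hgood hpi (HC j).
pose cJ := cost_approx q.
(* [f m J] is [cost_approx q J] with the merely measurable [Lam] replaced by the continuous
   [lam K m]. The error bound [del] depends on the first variable alone, so its [rho]-integral is a
   [mu]-integral. *)
pose f m J (z : E * E) := \big[Num.max/0]_(j < J) (h j z.2 - u m j z.1).
pose del m J (x : E) := \sum_(j < J) `|u m j x - ul j x|.
have cJ_ge0 := cost_approx_ge0 q.
have cJ_le := cost_approx_le q.
have mcJ := cost_approx_measurable q.
have fC m J : Cb (f m J).
  apply: Cb_bigmax => j; apply: CbB; first exact: HC.
  exact: (Cb_fst (uC m j)).
have cJ_f m J z : cJ J z <= f m J z + del m J z.1.
  have := bigmax_le_sum_dist J (fun j => h j z.2 - ul j z.1) (fun j => h j z.2 - u m j z.1).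
  move=> /le_trans; apply; rewrite lerD2l; apply: ler_sum => j _.
  by rewrite opprB addrC addrA subrK.
have f_cJ m J z : f m J z <= cJ J z + del m J z.1.
  have := bigmax_le_sum_dist J (fun j => h j z.2 - u m j z.1) (fun j => h j z.2 - ul j z.1).
  move=> /le_trans; apply; rewrite lerD2l; apply: ler_sum => j _.
  by rewrite opprB addrC addrA subrK distrC.
have delB m J : Bm (del m J : Borel E -> R).
  apply: Bm_sum => j.
  have [mb [M bM]] := BmB (Cb_Bm (uC m j)) (ulB j); split; first exact: measurableT_comp.
  by exists M => x; rewrite normr_id.
have del_cvg J : \int[mu]_x del m J x @[m --> \oo] --> (0 : R).
  have /choice[M hM] : forall j, exists M : R, forall m x, `|u m j x - ul j x| <= M.
    move=> j; have [_ [M hM]] := hC j; exists (M + M) => m x.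
    have [_ _ HM] := lam_cvg_phi hFeller hLDP hgood hpi (HC j).
    rewrite (le_trans (ler_normB _ _))// lerD//; last by apply: HM => z; exact: hM.
    apply: lam_norm_le; last by move=> z; exact: hM.
    by case: (Cb_Bm (HC j)).
  have [||x|_ _] := @Rint_dct _ (Borel E) R mu (fun m => del m J) (fun=> 0) (\sum_(j < J) M j).
  - by move=> m; case: (delB m J).
  - move=> m x; rewrite ger0_norm ?sumr_ge0//; exact: ler_sum.
  - rewrite /del; elim: (index_enum _) => [|j r ih].
      by under eq_fun do rewrite big_nil; exact: cvg_cst.
    have A : `|u m j x - ul j x| @[m --> \oo] --> (0 : R).
      rewrite -[X in _ --> X](@normr0 _ R) -(subrr (ul j x)).
      apply: cvg_norm.
      exact: (cvgB (ucvg j x) (cvg_cst (ul j x))).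
    under eq_fun do rewrite big_cons.
    have H := cvgD A ih; rewrite /= addr0 in H.
    exact: H.
  - by rewrite Rint_cst.
have cJB J : Bm (cJ J : Borel (E * E)%type -> R).
  split => //; have [_ [M fM]] := fC 0%N J; have [_ [N dN]] := delB 0%N J.
  exists (M + N) => z; rewrite ger0_norm// (le_trans (cJ_f 0%N J z))// lerD//.
    by rewrite (le_trans (ler_norm _)).
  by rewrite (le_trans (ler_norm _)).
have int_cJ J : \int[rho]_z cJ J z <= a.
  apply/ler_addgt0Pr => e e0.
  have e20 : 0 < e / 2 by rewrite divr_gt0.
  have := del_cvg J => /cvgrPdist_le/(_ _ e20)[m _ /(_ m (leqnn m))].
  rewrite /= sub0r normrN => hm.
  have {}hm : \int[mu]_x del m J x <= e / 2 by rewrite (le_trans (ler_norm _)).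
  have bd1 : Bm (fun z : Borel (E * E)%type => del m J z.1) by exact: Bm_fst (delB m J).
  have bf : Bm (f m J : Borel (E * E)%type -> R) by exact: Cb_Bm.
  have s1 : \int[rho]_z cJ J z <= integ rho (f m J) + \int[mu]_x del m J x.
    rewrite -(marg1_Rint m1 (delB m J)).
    rewrite -[integ rho (f m J)]/(\int[rho]_z f m J z) -RintD//.
    by apply: Rint_le => //; exact: BmD.
  (* Since [f m J - del <= cost_approx <= c], the minimality clause of [LamP] bounds [Lam (f m J)]
     by [del]. *)
  have s2 : phi_lim mu K (f m J) <= \int[mu]_x del m J x.
    apply: Rint_le => //.
      by have [] := lam_cvg_phi hFeller hLDP hgood hpi (fC m J).
    move=> x; have [_ _] := LamP hLDP hgood x (fC m J); apply => y.
    by apply: le_trans (cJ_le J (x, y)); rewrite lee_fin lerBlDr; exact: f_cJ.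
  have := ineq _ (fC m J); lra.
have cJ_nd := cost_approx_nd q.
have cJ_cvg z := @cost_approx_cvg q z hq.
have -> : (\int[rho]_p c p.1 p.2 = limn (fun J => \int[rho]_z (cJ J z)%:E))%E.
  rewrite -monotone_convergence//.
  - by apply: eq_integral => z _; apply/esym/cvg_lim => //; exact: cJ_cvg.
  - by move=> J; apply/measurable_EFinP.
  - by move=> J z _; rewrite lee_fin.
apply: lime_le.
  apply: ereal_nondecreasing_is_cvgn => I J IJ; apply: ge0_le_integral => //.
  - by move=> z _; rewrite lee_fin.
  - by apply/measurable_EFinP.
  - by apply/measurable_EFinP.
  - by move=> z _; exact: cJ_nd.
by apply: nearW => J; rewrite Bm_EFin// lee_fin.
Qed.

End liminf.

Lemma ultra_bounded_cvg {R : realType} {T : Type} (U : set_system T) (f : T -> R) (M : R) :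
  UltraFilter U -> (forall t, `|f t| <= M) -> exists l : R, f t @[t --> U] --> l.
Proof.
move=> UU fM.
have FM : U (f @^-1` `[- M, M]%classic).
  by apply: filterE => t /=; have := fM t; rewrite ler_norml in_itv.
have [y [_ cy]] := @segment_compact R (- M) M (f @ U) _ FM.
exists y => V nV; have [//|UnV] := in_ultra_setVsetC (f @^-1` V) UU.
have [z [/= nz Vz]] := cy (~` V) V UnV nV.
by [].
Qed.

Section limit_coupling.
Context {R : realType} {d : nat}.
Local Notation E := 'rV[R]_d.
Local Notation PEE := (probability (Borel (E * E)%type) R).
Variables (mu : probability (Borel E) R) (K : nat -> E -> probability (Borel E) R)
  (c : E -> E -> \bar R) (pik : nat -> PEE).
Hypotheses (hFeller : forall n, feller (K n))
  (hLDP : forall x, kLDP (fun n => K n x) (c x))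
  (hgood : forall x, good_rate (c x))
  (hpi : forall n (A B : set (Borel E)), measurable A -> measurable B ->
     pik n (A `*` B) = (\int[mu]_(x in A) K n x B)%E).

(** A filter on pairs of an index and a measure plays the part of a subsequence: it sends the index
    to infinity while the measures converge against all of [C_b]. *)
Lemma limit_coupling (U : set_system (nat * PEE)) (L : (E * E -> R) -> R) (a : R) :
  ProperFilter U -> (forall N, U [set s | (N <= s.1)%N]) ->
  U [set s | (Sk mu pik s.1 s.2 <= a%:E)%E] ->
  (forall f, Cb f -> integ s.2 f @[s --> U] --> L f) ->
  exists rho : PEE, [/\ marg1 rho mu, (\int[rho]_p c p.1 p.2 <= a%:E)%E &
    forall f, Cb f -> L f = integ rho f].
Proof.
move=> UU Uoo US UL.
have near_L f (e : R) : Cb f -> 0 < e -> U [set s | `|L f - integ s.2 f| <= e].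
  by move=> cf e0; have /cvgrPdist_le := UL f cf; apply.
have ineq f : Cb f -> L f <= a + phi_lim mu K f.
  move=> cf; apply/ler_addgt0Pr => e e0.
  have e20 : 0 < e / 2 by rewrite divr_gt0.
  have [_ /cvgrPdist_le/(_ _ e20)[N _ hN] _] := lam_cvg_phi hFeller hLDP hgood hpi cf.
  have [[n P] /= [hn [hS hL]]] := filter_ex (filterI (Uoo N) (filterI US (near_L f _ cf e20))).
  have := hN n hn => /= h1.
  have h2 := Sk_phi_ineq hFeller hpi (Cb_Bm cf) hS.
  have h3 := le_trans (ler_norm _) hL.
  rewrite distrC in h1; have h4 := le_trans (ler_norm _) h1.
  rewrite -[\int[P]_z f z]/(integ P f) in h2; lra.
have Llin f g (s t : R) : Cb f -> Cb g ->
    L (fun z => s * f z + t * g z) = s * L f + t * L g.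
  move=> cf cg; have csf := CbZ s cf; have ctg := CbZ t cg.
  apply: (@cvg_unique _ (@Rhausdorff R) _ _ _ _ (UL _ (CbD csf ctg))).
  have H := cvgD (cvgM (cvg_cst s) (UL f cf)) (cvgM (cvg_cst t) (UL g cg)).
  rewrite (_ : (fun q => _) = (fun q : nat * PEE => s * integ q.2 f + t * integ q.2 g)).
    exact: H.
  apply/funext => q; rewrite /integ.
  have := @RintD _ _ _ q.2 _ _ (Cb_Bm csf) (Cb_Bm ctg).
  by rewrite !RintZ//; exact: Cb_Bm.
have Lpos f : Cb f -> (forall z, 0 <= f z) -> 0 <= L f.
  move=> cf f0; apply/ler_addgt0Pr => e e0.
  have [[n P] /= h] := filter_ex (near_L f _ cf e0).
  have : 0 <= integ P f by apply: Rintegral_ge0 => z _; exact: f0.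
  move: h; rewrite ler_norml => /andP[]; lra.
have L1 : L (fun=> 1) = 1.
  apply: (@cvg_unique _ (@Rhausdorff R) _ _ _ _ (UL _ (Cb_cst 1))).
  rewrite (_ : (fun q => _) = (fun=> 1)); first exact: cvg_cst.
  by apply/funext => q; exact: Rint_cst.
have Lsm (f_ : nat -> E * E -> R) : (forall n, Cb (f_ n)) ->
    (forall n z, 0 <= f_ n z) -> (forall z, nonincreasing_seq (f_ ^~ z)) ->
    (forall z, f_ n z @[n --> \oo] --> (0 : R)) ->
    forall e : R, 0 < e -> exists n, L (f_ n) <= e.
  move=> fC f0 fni fcvg e e0.
  (* The constant [a] in [ineq] does not shrink with [f_ n]. Testing with [t * f_ n] instead gives
     [t * L (f_ n) <= |a| + 1] for a suitable [n], and division by [t] leaves [e]. *)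
  pose t := (`|a| + 1) / e; have t0 : 0 < t by rewrite divr_gt0// ltr_wpDl.
  have hlim : phi_lim mu K (fun z => t * f_ n z) @[n --> \oo] --> (0 : R).
    apply: (phi_lim_cvg0 hFeller hLDP hgood hpi).
    - by move=> n; exact: CbZ.
    - by move=> n z; rewrite mulr_ge0// ltW.
    - by move=> z m n mn; rewrite ler_pM2l//; exact: fni.
    - by move=> z; rewrite -(mulr0 t); apply: cvgM; [exact: cvg_cst|exact: fcvg].
  have /cvgrPdist_le/(_ 1 ltr01)[n _ /(_ n (leqnn n))] := hlim.
  rewrite /= sub0r normrN => /(le_trans (ler_norm _)) h1.
  exists n; have := ineq _ (CbZ t (fC n)).
  have -> : L (fun z => t * f_ n z) = t * L (f_ n).
    have := Llin _ _ t 0 (fC n) (fC n); rewrite mul0r addr0 => <-.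
    by congr L; apply/funext => z; rewrite mul0r addr0.
  move=> h2; have h3 : t * L (f_ n) <= `|a| + 1 by have := ler_norm a; lra.
  by move: h3; rewrite -ler_pdivlMl// /t invf_div mulrAC -mulrA mulfV ?mulr1// gt_eqF// ltr_wpDl.
have [q hq] := rV_separable R d; have [q2 hq2] := pair_separable hq.
have [rho hrho] := Daniell_representation hq2 Llin Lpos L1 Lsm.
have m1 : marg1 rho mu.
  apply: marg1_Cb => u cu; rewrite -hrho; last exact: Cb_fst.
  apply: (@cvg_unique _ (@Rhausdorff R) _ _ _ _ (UL _ (Cb_fst cu))).
  apply: cvg_near_cst; apply: filterS US => -[n P] /= /Sk_marg1 m1.
  exact: (marg1_Rint m1 (Cb_Bm cu)).
exists rho; split => //.
by apply: (coupling_cost_le hFeller hLDP hgood hpi m1) => f cf; rewrite -hrho//; exact: ineq.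
Qed.

(** The hypothesis controls only integrals of functions of [p], for instance the second marginal. An
    ultrafilter finer than [F0] makes all the other bounded integrals converge as well, which gives
    [limit_coupling] its functional [L]. *)
Lemma liminf_coupling {T : topologicalType} (p : E * E -> T) (Phi : (T -> R) -> R) (a : R) :
  continuous p ->
  (forall (A : set (T -> R)) (e : R) N, finite_set A -> A `<=` @Cb R T -> 0 < e ->
    exists k P, [/\ (N <= k)%N, (Sk mu pik k P <= a%:E)%E &
      forall f, A f -> `|integ P (f \o p) - Phi f| < e]) ->
  exists rho : PEE, [/\ marg1 rho mu, (\int[rho]_p c p.1 p.2 <= a%:E)%E &
    forall f, Cb f -> integ rho (f \o p) = Phi f].
Proof.
move=> cp H.
pose good (A : set (T -> R)) (e : R) N (s : nat * PEE) :=
  [/\ (N <= s.1)%N, (Sk mu pik s.1 s.2 <= a%:E)%E &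
      forall f, A f -> `|integ s.2 (f \o p) - Phi f| < e].
pose F0 : set_system (nat * PEE) := [set S | exists A e N,
  [/\ finite_set A, A `<=` @Cb R T, 0 < e & good A e N `<=` S]].
have PF0 : ProperFilter F0.
  split.
    move=> [A [e [N [fA AC e0 sub]]]]; have [k [P hP]] := H A e N fA AC e0.
    exact: (sub (k, P) hP).
  split.
  - by exists set0, 1, 0%N; split => //; exact: finite_set0.
  - move=> S S' [A [e [N [fA AC e0 sub]]]] [A' [e' [N' [fA' AC' e0' sub']]]].
    exists (A `|` A'), (Num.min e e'), (maxn N N'); split.
    + by rewrite finite_setU.
    + by rewrite subUset.
    + by rewrite lt_min e0.
    + move=> s [hN hS hf]; split.
        apply: sub; split => //; first exact: leq_trans (leq_maxl _ _) hN.
        move=> f Af; apply: lt_le_trans (hf f (or_introl Af)) _.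
        by rewrite ge_min lexx.
      apply: sub'; split => //; first exact: leq_trans (leq_maxr _ _) hN.
      move=> f Af; apply: lt_le_trans (hf f (or_intror Af)) _.
      by rewrite ge_min lexx orbT.
  - move=> S S' SS' [A [e [N [fA AC e0 sub]]]]; exists A, e, N; split => //.
    exact: subset_trans sub SS'.
have [U [UU F0U]] := ultraFilterLemma PF0.
have Lex f : exists l : R, Cb f -> integ s.2 f @[s --> U] --> l.
  have [cf|ncf] := pselect (Cb f); last by exists 0.
  have [_ [M fM]] := cf.
  have [|l hl] := @ultra_bounded_cvg _ _ U (fun s => integ s.2 f) M UU.
    by move=> s; apply: Rint_norm_le => //; case: (Cb_Bm cf).
  by exists l.
have [L hL] := choice Lex.
have [|||rho [m1 cost hrho]] := @limit_coupling U L a _.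
- move=> N; apply: F0U; exists set0, 1, N; split => //; by move=> s [].
- by apply: F0U; exists set0, 1, 0%N; split => // s [].
- exact: hL.
exists rho; split => // f cf.
have cfp : Cb (f \o p) by exact: Cb_comp.
rewrite -hrho//; apply/eqP; rewrite -subr_eq0 -normr_eq0 eq_le normr_ge0 andbT.
apply/ler_addgt0Pr => e e0; rewrite add0r.
have e20 : 0 < e / 2 by rewrite divr_gt0.
have U1 : U [set s | `|L (f \o p) - integ s.2 (f \o p)| <= e / 2].
  by have /cvgrPdist_le := hL _ cfp; apply.
have U2 : U (good [set f] (e / 2) 0%N).
  by apply: F0U; exists [set f], (e / 2), 0%N; split => // _ ->.
have [s [/= s1 [_ _ /(_ f erefl) /ltW s2]]] := filter_ex (filterI U1 U2).
rewrite -(subrKA (integ s.2 (f \o p))) (le_trans (ler_normD _ _))//.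
by rewrite [leRHS]splitr lerD.
Qed.

End limit_coupling.

(** * Upper bound *)

Section continuity_toolbox.
Context {R : realType} {T : topologicalType}.
Implicit Types f g : T -> R.

Lemma cont_cst (a : R) : continuous (fun _ : T => a).
Proof. by move=> x; exact: cvg_cst. Qed.

Lemma contD f g : continuous f -> continuous g -> continuous (fun x => f x + g x).
Proof. by move=> cf cg x; apply: cvgD; [exact: cf|exact: cg]. Qed.

Lemma contM f g : continuous f -> continuous g -> continuous (fun x => f x * g x).
Proof. by move=> cf cg x; apply: cvgM; [exact: cf|exact: cg]. Qed.

Lemma cont_norm f : continuous f -> continuous (fun x => `|f x|).
Proof. by move=> cf x; apply: cvg_norm; exact: cf. Qed.

Lemma cont_sum (I : Type) (r : seq I) (F : I -> T -> R) :
  (forall i, continuous (F i)) -> continuous (fun x => \sum_(i <- r) F i x).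
Proof.
move=> cF; elim: r => [|i r ih].
  by under eq_fun do rewrite big_nil; exact: cont_cst.
by under eq_fun do rewrite big_cons; exact: contD.
Qed.

Lemma cont_modulus f (D : T -> T -> R) :
  (forall x y, `|f x - f y| <= D x y) -> (forall x, continuous (D x)) ->
  (forall x, D x x = 0) -> continuous f.
Proof.
move=> fD cD D0 x; apply/cvgrPdist_le => e e0.
have Dx : D x y @[y --> x] --> D x x := cD x x.
move: Dx; rewrite D0 => /cvgrPdist_le/(_ _ e0); apply: filterS => y.
rewrite sub0r normrN => h; rewrite (le_trans (fD x y))//.
exact: le_trans (ler_norm _) h.
Qed.

End continuity_toolbox.

(** From [exp u <= 1 / (1 - u)] and [(1 - u) (1 + u + 2 u^2) = 1 + u^2 (1 - 2 u)], which is where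
    the threshold 1/2 comes from. *)
Lemma expR_le_quadratic {R : realType} (u : R) : u <= 2^-1 -> expR u <= 1 + u + 2 * u ^+ 2.
Proof.
move=> u2; have h := expR_ge1Dx (- u).
have u1 : 0 < 1 - u by lra.
have : expR u <= (1 - u)^-1.
  rewrite -[expR u]invrK -expRN lef_pV2 ?posrE ?expR_gt0//.
move=> /le_trans; apply; rewrite -[leLHS]mul1r ler_pdivrMr// expr2.
have : 0 <= u * u * (1 - 2 * u) by rewrite mulr_ge0//; [rewrite -expr2 sqr_ge0|lra].
nra.
Qed.

Lemma linear_part_eq0 {R : realType} (A C t0 : R) : 0 < C -> 0 < t0 ->
  (forall t, `|t| <= t0 -> 0 <= t * A + t ^+ 2 * C) -> A = 0.
Proof.
move=> C0 t00 H; apply/eqP; apply: contraT => A0.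
have nA : 0 < `|A| by rewrite normr_gt0.
(* Test value [t = - s A]: the first entry gives [|t| <= t0], the second makes the quadratic term at
   most half of the linear one. *)
pose s := Num.min (t0 / `|A|) (2 * C)^-1.
have s0 : 0 < s by rewrite lt_min divr_gt0//= invr_gt0 mulr_gt0.
have s1 : s * `|A| <= t0.
  by rewrite -ler_pdivlMr// ge_min lexx.
have s2 : s * (2 * C) <= 1.
  by rewrite -ler_pdivlMr ?mulr_gt0// mul1r ge_min lexx orbT.
have := H (- (s * A)); rewrite normrN normrM (gtr0_norm s0) => /(_ s1).
have -> : - (s * A) * A + (- (s * A)) ^+ 2 * C = - (s * A ^+ 2) * (1 - s * C) by ring.
have A2 : 0 < s * A ^+ 2 by rewrite mulr_gt0// exprn_even_gt0.
by nra.
Qed.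

Section recovery.
Context {R : realType} {d : nat}.
Local Notation E := 'rV[R]_d.
Local Notation PEE := (probability (Borel (E * E)%type) R).
Variables (mu : probability (Borel E) R) (K : nat -> E -> probability (Borel E) R)
  (c : E -> E -> \bar R) (pik : nat -> PEE).
Hypotheses (hFeller : forall n, feller (K n))
  (hLDP : forall x, kLDP (fun n => K n x) (c x))
  (hgood : forall x, good_rate (c x))
  (hpi : forall n (A B : set (Borel E)), measurable A -> measurable B ->
     pik n (A `*` B) = (\int[mu]_(x in A) K n x B)%E).

(** Weak duality, the converse of [coupling_cost_le]: integrate [F - Lam F <= c]. The positive part
    [gp] allows comparison with the integral of the possibly infinite [c]. *)
Lemma integ_le_phi_lim (rho : PEE) (s : R) (F : E * E -> R) : marg1 rho mu ->
  (\int[rho]_p c p.1 p.2 <= s%:E)%E -> Cb F -> integ rho F <= s + phi_lim mu K F.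
Proof.
move=> m1 hs cF.
have [bL _ _] := lam_cvg_phi hFeller hLDP hgood hpi cF.
have bL1 := Bm_fst bL; have bF : Bm (F : Borel (E * E)%type -> R) by exact: Cb_Bm.
have c0 x y : (0 <= c x y)%E by have [+ _ _] := hgood x; exact.
pose g (z : Borel (E * E)%type) : R := F z - Lam K F z.1.
have bg : Bm g by exact: BmB.
have gc z : ((g z)%:E <= c z.1 z.2)%E.
  by case: z => x y; have [_ + _] := LamP hLDP hgood x cF; exact.
pose gp z := Num.max (g z) 0.
have bgp : Bm gp.
  have [mg [M gM]] := bg; split; first by apply: measurable_maxr => //; exact: measurable_cst.
  exists M => z; rewrite ger0_norm; last by rewrite le_max lexx orbT.
  by rewrite ge_max (le_trans _ (gM z)) ?ler_norm//= (le_trans _ (gM z)).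
have h1 : \int[rho]_z g z <= \int[rho]_z gp z.
  by apply: Rint_le => // z; rewrite le_max lexx.
have h2 : \int[rho]_z gp z <= s.
  rewrite -lee_fin -Bm_EFin// (le_trans _ hs)//; apply: ge0_le_integral => //.
  - by move=> z _; rewrite lee_fin le_max lexx orbT.
  - by apply/measurable_EFinP; case: bgp.
  - exact: (cost_measurable hFeller hLDP hgood hpi).
  - by move=> z _; rewrite EFin_max ge_max gc c0.
move: (le_trans h1 h2); rewrite RintB// (marg1_Rint m1 bL).
by rewrite lerBlDr.
Qed.

Lemma phi_le n F G (b : R) : Bm F -> Bm G -> (forall z, F z <= G z + b) ->
  phi mu K n F <= phi mu K n G + b.
Proof.
move=> bF bG FG; rewrite -[X in _ + X](Rint_cst mu) -RintD; [|exact: (lam_Bm hFeller hpi)|exact: Bm_cst].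
apply: Rint_le; first exact: (lam_Bm hFeller hpi).
  by apply: BmD; [exact: (lam_Bm hFeller hpi)|exact: Bm_cst].
move=> x; rewrite -lamD//; apply: lam_le => //.
by apply: BmD => //; exact: Bm_cst.
Qed.

End recovery.

Lemma sum_perturb {R : realType} (N : nat) (l x : 'I_N -> R) (t : R) (j : 'I_N) :
  \sum_(i < N) (l i + t * (i == j)%:R) * x i = \sum_(i < N) l i * x i + t * x j.
Proof.
under eq_bigr do rewrite mulrDl; rewrite big_split/=; congr (_ + _).
rewrite (bigD1 j)//= eqxx mulr1 big1 ?addr0// => i /negbTE ->.
by rewrite mulr0 mul0r.
Qed.

Lemma sum_sqr_perturb {R : realType} (N : nat) (l : 'I_N -> R) (t : R) (j : 'I_N) :
  \sum_(i < N) (l i + t * (i == j)%:R) ^+ 2 = \sum_(i < N) l i ^+ 2 + (2 * t * l j + t ^+ 2).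
Proof.
rewrite (bigD1 j)//= [in RHS](bigD1 j)//= eqxx mulr1.
rewrite (eq_bigr (fun i => l i ^+ 2)); first by ring.
by move=> i /negbTE ->; rewrite mulr0 addr0.
Qed.

Lemma ler_dist_bounds {R : realDomainType} (a b D : R) :
  a <= b + D -> b <= a + D -> `|a - b| <= D.
Proof. by move=> h1 h2; rewrite ler_norml; apply/andP; split; lra. Qed.

Lemma expR_perturb {R : realType} (k t M x : R) : 0 < k -> 0 < M -> `|x| <= M ->
  `|t| <= (2 * k * M)^-1 ->
  expR (k * (t * x)) <= 1 + 2 * (k * t * M) ^+ 2 + k * t * x.
Proof.
move=> k0 M0 xM tM.
have u1 : `|k * t * x| <= k * `|t| * M.
  by rewrite !normrM (gtr0_norm k0) ler_wpM2l// mulr_ge0// ltW.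
have u2 : k * t * x <= 2^-1.
  rewrite (le_trans (ler_norm _))// (le_trans u1)//.
  have : `|t| * (2 * k * M) <= 1 by rewrite -ler_pdivlMr ?mul1r// !mulr_gt0.
  lra.
have u3 : (k * t * x) ^+ 2 <= (k * t * M) ^+ 2.
  rewrite -[leLHS]real_normK ?num_real// -[leRHS]real_normK ?num_real//.
  rewrite ler_sqr ?nnegrE// (le_trans u1)// !normrM (gtr0_norm k0).
  by rewrite (gtr0_norm M0).
rewrite mulrA; have := expR_le_quadratic u2; lra.
Qed.

Lemma perturb_step {R : realType} (a a' k t y M X : R) : 0 < k ->
  a' <= a + k^-1 * (X - 1) -> X <= 1 + k * t * y + 2 * (k * t * M) ^+ 2 ->
  a' <= a + (t * y + 2 * k * t ^+ 2 * M ^+ 2).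
Proof.
move=> k0 h1 h2; apply: le_trans h1 _; rewrite lerD2l ler_pdivrMl//.
have -> : k * (t * y + 2 * k * t ^+ 2 * M ^+ 2) = k * t * y + 2 * (k * t * M) ^+ 2 by ring.
lra.
Qed.

Lemma perturb_obj {R : realType} (b b' S Q th t r l y k M : R) :
  b' <= b + (t * y + 2 * k * t ^+ 2 * M ^+ 2) ->
  b - S + th / 2 * Q <= b' - (S + t * r) + th / 2 * (Q + (2 * t * l + t ^+ 2)) ->
  0 <= t * (y - r + th * l) + t ^+ 2 * (2 * k * M ^+ 2 + th / 2).
Proof.
move=> h1 h2.
have -> : t * (y - r + th * l) + t ^+ 2 * (2 * k * M ^+ 2 + th / 2) =
  t * y + 2 * k * t ^+ 2 * M ^+ 2 - t * r + th / 2 * (2 * t * l + t ^+ 2) by field.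
rewrite mulrDr in h2; lra.
Qed.

Section tilted_minimiser.
Context {R : realType} {d : nat}.
Local Notation E := 'rV[R]_d.
Local Notation PEE := (probability (Borel (E * E)%type) R).
Variables (mu : probability (Borel E) R) (K : nat -> E -> probability (Borel E) R)
  (pik : nat -> PEE).
Hypotheses (hFeller : forall n, feller (K n))
  (hpi : forall n (A B : set (Borel E)), measurable A -> measurable B ->
     pik n (A `*` B) = (\int[mu]_(x in A) K n x B)%E).
Variables (N : nat) (f : 'I_N -> E * E -> R) (M : R) (r : 'I_N -> R).
Hypotheses (fC : forall i, Cb (f i)) (M0 : 0 < M) (fM : forall i z, `|f i z| <= M)
  (rM : forall i, `|r i| <= M).
Implicit Types l : 'rV[R]_N.

Definition comb l (z : E * E) : R := \sum_(i < N) l ord0 i * f i z.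
Definition dist1 l l' : R := \sum_(i < N) `|l ord0 i - l' ord0 i|.

Lemma comb_Cb l : Cb (comb l).
Proof. by apply: Cb_sum => i; exact: CbZ. Qed.

Let comb_Bm l : Bm (comb l : Borel (E * E)%type -> R).
Proof. exact: Cb_Bm (comb_Cb l). Qed.

Lemma sum_lip l l' (x : 'I_N -> R) : (forall i, `|x i| <= M) ->
  \sum_(i < N) l ord0 i * x i <= \sum_(i < N) l' ord0 i * x i + M * dist1 l l'.
Proof.
move=> xM; rewrite -lerBlDl -sumrB mulr_sumr; apply: ler_sum => i _.
rewrite -mulrBl (le_trans (ler_norm _))// normrM mulrC ler_wpM2r//.
Qed.

Lemma phi_comb_lip n l l' :
  phi mu K n (comb l) <= phi mu K n (comb l') + M * dist1 l l'.
Proof. by apply: (phi_le hFeller hpi) => // z; exact: sum_lip. Qed.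

Lemma dist1C l l' : dist1 l l' = dist1 l' l.
Proof. by apply: eq_bigr => i _; rewrite distrC. Qed.

Lemma dist1_continuous l : continuous (dist1 l).
Proof.
apply: cont_sum => i; apply: cont_norm; apply: contD; first exact: cont_cst.
rewrite (_ : (fun x => _) = (fun x : 'rV[R]_N => (-1) * x ord0 i)).
  by apply: contM; [exact: cont_cst|exact: coord_continuous].
by apply/funext => x; rewrite mulN1r.
Qed.

Lemma dist1xx l : dist1 l l = 0.
Proof. by rewrite /dist1 big1// => i _; rewrite subrr normr0. Qed.

Let k0 n : 0 < n.+1%:R :> R. Proof. by rewrite ltr0n. Qed.

Lemma phi0 n : phi mu K n (fun=> 0) = 0.
Proof.
rewrite /phi -[RHS](Rint_cst mu); apply: eq_Rintegral => x _.
by rewrite /lam lmgf_cst.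
Qed.

Lemma dist1_0 l : dist1 l 0 = \sum_(i < N) `|l ord0 i|.
Proof. by apply: eq_bigr => i _; rewrite mxE subr0. Qed.

Definition dual_obj n (th : R) l : R :=
  phi mu K n (comb l) - \sum_(i < N) l ord0 i * r i + th / 2 * \sum_(i < N) l ord0 i ^+ 2.

Lemma dual_obj_continuous n th : continuous (dual_obj n th).
Proof.
apply: contD; first apply: contD.
- apply: (@cont_modulus _ _ _ (fun l l' => M * dist1 l l')).
  + move=> l l'; apply: ler_dist_bounds; first exact: phi_comb_lip.
    rewrite dist1C; exact: phi_comb_lip.
  + by move=> l; apply: contM; [exact: cont_cst|exact: dist1_continuous].
  + by move=> l; rewrite dist1xx mulr0.
- rewrite (_ : (fun x => _) = (fun l => \sum_(i < N) - r i * l ord0 i)).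
    by apply: cont_sum => i; apply: contM; [exact: cont_cst|exact: coord_continuous].
  by apply/funext => l; rewrite -sumrN; apply: eq_bigr => i _; rewrite mulNr mulrC.
- apply: contM; first exact: cont_cst.
  by apply: cont_sum => i; apply: contM; exact: coord_continuous.
Qed.

Definition box (B : R) : set 'rV[R]_N := [set l | forall i, `|l ord0 i| <= B].

Lemma box_compact B : compact (box B).
Proof.
have -> : box B = [set l : 'rV[R]_N | forall i, `[- B, B]%classic (l ord0 i)].
  by apply/seteqP; split => l /= h i; have := h i; rewrite in_itv/= ler_norml.
apply: (@rV_compact _ _ (fun=> `[- B, B]%classic)) => i; exact: segment_compact.
Qed.

Lemma comb0 : comb 0 = fun=> 0.
Proof. by apply/funext => z; rewrite /comb big1// => i _; rewrite mxE mul0r. Qed.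

Lemma sum_0row (x : 'I_N -> R) : \sum_(i < N) (0 : 'rV[R]_N) ord0 i * x i = 0.
Proof. by rewrite big1// => i _; rewrite mxE mul0r. Qed.

Lemma dual_obj0 n th : dual_obj n th 0 = 0.
Proof.
rewrite /dual_obj comb0 phi0 sum_0row subrr add0r big1 ?mulr0// => i _.
by rewrite mxE expr0n.
Qed.

(** The cumulant and the linear term both vanish at 0 and are [M]-Lipschitz for [dist1], whence the
    factor 2. *)
Lemma dual_obj_lower n th l :
  \sum_(i < N) (th / 2 * l ord0 i ^+ 2 - 2 * M * `|l ord0 i|) <= dual_obj n th l.
Proof.
have h1 := phi_comb_lip n 0 l; have h2 := sum_lip l 0 rM.
rewrite comb0 phi0 dist1C in h1; rewrite sum_0row in h2.
rewrite dist1_0 in h1 h2.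
rewrite sumrB -!mulr_sumr /dual_obj.
have -> : 2 * M * (\sum_(i < N) `|l ord0 i|) = M * (\sum_(i < N) `|l ord0 i|) +
  M * (\sum_(i < N) `|l ord0 i|) by ring.
lra.
Qed.

(** With [X] the quotient, a minimiser in the box has [l_j^2 <= X <= (X + 1)^2], so
    [|l_j| <= X + 1]; the remaining 1 is room for perturbing a coordinate. The radius does not
    depend on [n]. *)
Definition box_radius (th : R) : R := 16 * N%:R * M ^+ 2 / th ^+ 2 + 2.

Lemma dual_obj_minimiser n th : 0 < th -> exists l,
  (forall i, `|l ord0 i| + 1 <= box_radius th) /\
  forall l', box (box_radius th) l' -> dual_obj n th l <= dual_obj n th l'.
Proof.
move=> th0; set B := box_radius th.
have X0 : 0 <= 16 * N%:R * M ^+ 2 / th ^+ 2.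
  by rewrite divr_ge0 ?sqr_ge0// mulr_ge0 ?sqr_ge0// mulr_ge0.
have B0 : 2 <= B by rewrite /B /box_radius; lra.
have b0 : box B 0 by move=> i; rewrite mxE normr0; lra.
have [|l lB lmin] := @EVT_min_rV R N (dual_obj n th) (box B) (ex_intro _ 0 b0) (@box_compact B).
  by apply: continuous_subspaceT; exact: dual_obj_continuous.
exists l; split; last by move=> l' hl'; apply: lmin; rewrite inE.
have l0 : dual_obj n th l <= 0 by rewrite -(dual_obj0 n th); apply: lmin; rewrite inE.
(* The difference of the two sides is [(th |l_i| - 4 M)^2 / (4 th)]: half of the quadratic term
   absorbs the linear one. *)
have term i : th / 4 * l ord0 i ^+ 2 - 4 * M ^+ 2 / th <=
    th / 2 * l ord0 i ^+ 2 - 2 * M * `|l ord0 i|.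
  have := sqr_ge0 (th * `|l ord0 i| - 4 * M).
  rewrite sqrrB exprMn real_normK ?num_real// exprMn => h.
  rewrite -subr_ge0.
  have -> : th / 2 * l ord0 i ^+ 2 - 2 * M * `|l ord0 i| -
     (th / 4 * l ord0 i ^+ 2 - 4 * M ^+ 2 / th) =
     (th ^+ 2 * l ord0 i ^+ 2 - th * `|l ord0 i| * (4 * M) *+ 2 + 4 ^+ 2 * M ^+ 2) / (4 * th).
    by field; rewrite gt_eqF.
  by rewrite divr_ge0// mulr_ge0// ltW.
have := le_trans (ler_sum _ (fun i _ => term i)) (le_trans (dual_obj_lower n th l) l0).
rewrite sumrB sumr_const card_ord -mulr_sumr -mulr_natr => hs.
move=> j.
have lj : l ord0 j ^+ 2 <= \sum_(i < N) l ord0 i ^+ 2.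
  by rewrite (bigD1 j)//= lerDl sumr_ge0// => i _; exact: sqr_ge0.
have lj2 : l ord0 j ^+ 2 <= 16 * N%:R * M ^+ 2 / th ^+ 2.
  have h1 : th / 4 * l ord0 j ^+ 2 <= 4 * M ^+ 2 / th * N%:R.
    apply: (@le_trans _ _ (th / 4 * \sum_(i < N) l ord0 i ^+ 2)).
      by rewrite ler_wpM2l// divr_ge0// ltW.
    lra.
  have -> : 16 * N%:R * M ^+ 2 / th ^+ 2 = (th / 4)^-1 * (4 * M ^+ 2 / th * N%:R).
    by field; rewrite gt_eqF.
  by rewrite ler_pdivlMl// divr_gt0.
rewrite /B /box_radius; set X := _ / _ in X0 lj2 *.
have hX : l ord0 j ^+ 2 <= (X + 1) ^+ 2.
  apply: le_trans lj2 _; rewrite sqrrD1; have := sqr_ge0 X; lra.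
have : `|l ord0 j| <= X + 1.
  rewrite -[X + 1]ger0_norm; last by lra.
  by rewrite -ler_sqr ?nnegrE// !real_normK ?num_real.
lra.
Qed.

(* Perturbing one coordinate of the minimiser and using [ln u <= u - 1] shows
   that the tilted measure [P] satisfies the stationarity condition
   [P f_i - r_i + th l_i = 0]. *)
Lemma tilted_minimiser n th : 0 < th -> exists l (P : PEE),
  [/\ box (box_radius th) l,
      (Sk mu pik n P <= (- dual_obj n th l - th / 2 * \sum_(i < N) l ord0 i ^+ 2)%:E)%E,
      th / 2 * \sum_(i < N) l ord0 i ^+ 2 <= - dual_obj n th l &
      forall i, integ P (f i) - r i + th * l ord0 i = 0].
Proof.
move=> th0; have [l [lB lmin]] := dual_obj_minimiser n th0.
have [P [m1 hS hS0 hder]] := tilt_measure hFeller hpi n (comb_Bm l).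
have bf i : Bm (f i : Borel (E * E)%type -> R) by exact: Cb_Bm.
set k : R := n.+1%:R in hder.
have kp : 0 < k by exact: k0.
clearbody k.
have stat j : integ P (f j) - r j + th * l ord0 j = 0.
  pose C := 2 * k * M ^+ 2 + th / 2.
  have C0 : 0 < C by rewrite addr_gt0 ?divr_gt0// !mulr_gt0// exprn_gt0.
  (* The bound 1 keeps the perturbed point in the box; the other bound keeps the exponent at most
     1/2, as [expR_le_quadratic] requires. *)
  pose t0 := Num.min 1 (2 * k * M)^-1.
  have t00 : 0 < t0 by rewrite lt_min ltr01 invr_gt0 !mulr_gt0.
  apply: (linear_part_eq0 C0 t00) => t; rewrite le_min => /andP[t1 t2].
  pose l' : 'rV[R]_N := \row_i (l ord0 i + t * (i == j)%:R).
  have l'E i : l' ord0 i = l ord0 i + t * (i == j)%:R by rewrite mxE.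
  have l'B : box (box_radius th) l'.
    move=> i; rewrite l'E (le_trans _ (lB i))// (le_trans (ler_normD _ _))// lerD2l.
    by rewrite normrM; case: (i == j); rewrite ?normr1 ?mulr1// normr0 mulr0.
  have sl' (x : 'I_N -> R) : \sum_(i < N) l' ord0 i * x i =
      \sum_(i < N) l ord0 i * x i + t * x j.
    by rewrite -sum_perturb; apply: eq_bigr => i _; rewrite l'E.
  have ql' : \sum_(i < N) l' ord0 i ^+ 2 = \sum_(i < N) l ord0 i ^+ 2 + (2 * t * l ord0 j + t ^+ 2).
    by rewrite -sum_sqr_perturb; apply: eq_bigr => i _; rewrite l'E.
  have btf : Bm (fun z : Borel (E * E)%type => t * f j z) := BmM (Bm_cst t) (bf j).
  have bktf : Bm (fun z : Borel (E * E)%type => k * t * f j z) := BmM (Bm_cst (k * t)) (bf j).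
  have bc : Bm (fun _ : Borel (E * E)%type => 1 + 2 * (k * t * M) ^+ 2) := Bm_cst _.
  have ephi : phi mu K n (comb l') = phi mu K n (fun z => comb l z + t * f j z).
    by congr phi; apply/funext => z; exact: sl'.
  have hexp : \int[P]_z expR (k * (t * f j z)) <=
      1 + k * t * integ P (f j) + 2 * (k * t * M) ^+ 2.
    apply: (@le_trans _ _ (\int[P]_z ((1 + 2 * (k * t * M) ^+ 2) + k * t * f j z))).
      apply: Rint_le.
      - exact: (Bm_expR k btf).
      - exact: (BmD bc bktf).
      move=> z; exact: (expR_perturb kp M0 (fM j z) t2).
    rewrite (RintD P bc bktf) Rint_cst (RintZ P (k * t) (bf j)).
    by rewrite -[\int[P]_x f j x]/(integ P (f j)) addrAC.
  have step : phi mu K n (comb l') <=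
      phi mu K n (comb l) + (t * integ P (f j) + 2 * k * t ^+ 2 * M ^+ 2).
    rewrite ephi; exact: (perturb_step kp (hder _ btf) hexp).
  have := lmin _ l'B; rewrite /dual_obj sl' ql'.
  exact: (perturb_obj step).
have Pcomb : \int[P]_z comb l z = \sum_(i < N) l ord0 i * integ P (f i).
  rewrite /comb Rint_sum; first by apply: eq_bigr => i _; exact: (RintZ P (l ord0 i) (bf i)).
  by move=> i; exact: (BmM (Bm_cst _) (bf i)).
(* Stationarity replaces [P f_i] by [r_i - th l_i]; the entropy bound thereby becomes minus the
   objective, with a further half of [th |l|^2] subtracted. *)
have E1 : \int[P]_z comb l z - phi mu K n (comb l) =
    - dual_obj n th l - th / 2 * \sum_(i < N) l ord0 i ^+ 2.
  have -> : \int[P]_z comb l z = \sum_(i < N) l ord0 i * r i - th * \sum_(i < N) l ord0 i ^+ 2.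
    rewrite Pcomb mulr_sumr -sumrB; apply: eq_bigr => i _.
    have -> : integ P (f i) = r i - th * l ord0 i by have := stat i; lra.
    by ring.
  by rewrite /dual_obj; field.
exists l, P; split => //.
- by move=> i; have := lB i; lra.
- by rewrite -E1.
- by move: hS0; rewrite E1 subr_ge0.
Qed.

End tilted_minimiser.

(** * Gamma-convergence *)

Lemma near_box_arith {R : realType} (Sl S0 L0 p0 pl D s eta : R) :
  S0 <= s + L0 -> L0 - p0 <= eta / 2 -> p0 <= pl + D -> Sl <= S0 + D ->
  D <= eta / 4 -> 0 < eta -> Sl <= pl + (s + eta).
Proof. lra. Qed.

Lemma dual_arith {R : realType} (S ph t se : R) : S <= ph + se ->
  - (ph - S + t) <= se - t.
Proof. lra. Qed.

Section Gamma_convergence.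
Context {R : realType} {d : nat}.
Local Notation E := 'rV[R]_d.
Local Notation PEE := (probability (Borel (E * E)%type) R).
Variables (mu : probability (Borel E) R) (K : nat -> E -> probability (Borel E) R)
  (c : E -> E -> \bar R) (pik : nat -> PEE).
Hypotheses (hFeller : forall n, feller (K n))
  (hLDP : forall x, kLDP (fun n => K n x) (c x))
  (hgood : forall x, good_rate (c x))
  (hpi : forall n (A B : set (Borel E)), measurable A -> measurable B ->
     pik n (A `*` B) = (\int[mu]_(x in A) K n x B)%E).

Lemma cost_integral_ge0 (rho : PEE) : (0 <= \int[rho]_p c p.1 p.2)%E.
Proof. by apply: integral_ge0 => z _; have [+ _ _] := hgood z.1; exact. Qed.

Lemma recovery (rho : PEE) (s : R) (A : set (E * E -> R)) (e eta : R) :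
  marg1 rho mu -> (\int[rho]_p c p.1 p.2 <= s%:E)%E ->
  finite_set A -> A `<=` @Cb R (E * E)%type -> 0 < e -> 0 < eta ->
  \forall n \near \oo, exists P : PEE, (Sk mu pik n P <= (s + eta)%:E)%E /\
    forall f, A f -> `|integ P f - integ rho f| < e.
Proof.
move=> m1 hs /finite_seqP[fs fsE] AC e0 eta0.
pose N := size fs; pose f (i : 'I_N) : E * E -> R := nth (fun=> 0) fs i.
have fA i : A (f i) by rewrite fsE /=; apply: mem_nth.
have fC i : Cb (f i) by apply: AC.
have s0 : 0 <= s by rewrite -lee_fin (le_trans (cost_integral_ge0 rho)).
have [M [M0 fM]] : exists M : R, 0 < M /\ forall i z, `|f i z| <= M.
  have /choice[b hb] : forall i, exists b : R, forall z, `|f i z| <= b.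
    by move=> i; have [_] := fC i.
  exists (1 + \sum_(i < N) `|b i|); split; first by rewrite ltr_wpDr// sumr_ge0.
  move=> i z; rewrite (le_trans (hb i z))// (le_trans (ler_norm _))// (bigD1 i)//=.
  have : 0 <= \sum_(j < N | j != i) `|b j| by rewrite sumr_ge0.
  have := normr_ge0 (b i); lra.
pose r i := integ rho (f i).
have rM i : `|r i| <= M by apply: Rint_norm_le => //; case: (Cb_Bm (fC i)).
(* Chosen so that [(th l_i)^2 <= 2 th (s + eta) = e^2 / 2 < e^2]. *)
pose th := e ^+ 2 / (4 * (s + eta)).
have se0 : 0 < s + eta by rewrite ltr_wpDl.
have th0 : 0 < th by rewrite divr_gt0 ?exprn_gt0 ?mulr_gt0.
have rcomb l : integ rho (comb f l) = \sum_(i < N) l ord0 i * r i.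
  rewrite /comb /integ -/(Rintegral _ _ _) Rint_sum; last first.
    by move=> i; apply: BmM; [exact: Bm_cst|exact: Cb_Bm].
  by apply: eq_bigr => i _; rewrite RintZ//; exact: Cb_Bm.
have cpt := (compact_near_coveringP _).1 (@box_compact R N (box_radius N M th)).
(* Uniformity over the box by compactness: at a centre [l0], convergence of the cumulants costs
   [eta / 2], and moving to a nearby [l] costs [eta / 4] in the linear term and [eta / 4] in [phi],
   both Lipschitz uniformly in [n]. *)
have near_all : \forall n \near \oo, forall l, box (box_radius N M th) l ->
    \sum_(i < N) l ord0 i * r i <= phi mu K n (comb f l) + (s + eta).
  apply: (cpt nat \oo (fun n l => \sum_(i < N) l ord0 i * r i <=
    phi mu K n (comb f l) + (s + eta)) ltac:(typeclasses eauto)) => l0 _.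
  have cl0 := comb_Cb fC l0.
  have h0 := integ_le_phi_lim hFeller hLDP hgood hpi m1 hs cl0.
  rewrite rcomb in h0.
  have eta2 : 0 < eta / 2 by rewrite divr_gt0.
  have [_ /cvgrPdist_le/(_ _ eta2) near1 _] := lam_cvg_phi hFeller hLDP hgood hpi cl0.
  have M2 : 0 < eta / (4 * M) by rewrite divr_gt0// mulr_gt0.
  have near2 : \forall l \near l0, dist1 l0 l <= eta / (4 * M).
    have Dl : dist1 l0 l @[l --> l0] --> dist1 l0 l0 := @dist1_continuous R N l0 l0.
    move: Dl; rewrite dist1xx => /cvgrPdist_le/(_ _ M2); apply: filterS => l.
    by rewrite sub0r normrN => /(le_trans (ler_norm _)).
  exists ([set l | dist1 l0 l <= eta / (4 * M)],
          [set n | `|phi_lim mu K (comb f l0) - phi mu K n (comb f l0)| <= eta / 2]) => //=.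
  move=> [l n] [/= hl hn].
  have h1 := le_trans (ler_norm _) hn.
  have h2 := phi_comb_lip hFeller hpi fC fM n l0 l.
  have h3 := sum_lip l l0 rM; rewrite dist1C in h3.
  have h4 : M * dist1 l0 l <= eta / 4.
    have -> : eta / 4 = M * (eta / (4 * M)) by field; rewrite gt_eqF.
    by rewrite ler_pM2l.
  exact: (near_box_arith h0 h1 h2 h3 h4 eta0).
apply: filterS near_all => n hn.
have [l [P [lB hS hq stat]]] := tilted_minimiser hFeller hpi fC M0 fM rM n th0.
have hdual := hn l lB.
set q2 := \sum_(i < N) l ord0 i ^+ 2 in hS hq.
have q0 : 0 <= q2 by apply: sumr_ge0 => i _; exact: sqr_ge0.
have tq0 : 0 <= th / 2 * q2 by rewrite mulr_ge0// divr_ge0// ltW.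
have hd : - dual_obj mu K f r n th l <= s + eta - th / 2 * q2.
  exact: (dual_arith _ hdual).
have hd2 : - dual_obj mu K f r n th l <= s + eta.
  by rewrite (le_trans hd)// gerBl.
exists P; split.
  apply: le_trans hS _; rewrite lee_fin; apply: le_trans hd2.
  by rewrite gerBl.
move=> g Ag.
have [i ->] : exists i, g = f i.
  move: Ag; rewrite fsE /= => gfs; have gi : (index g fs < N)%N by rewrite index_mem.
  by exists (Ordinal gi); rewrite /f nth_index.
have -> : integ P (f i) - integ rho (f i) = - (th * l ord0 i).
  by rewrite -[integ rho (f i)]/(r i); apply/eqP; rewrite -addr_eq0 stat.
rewrite normrN -(gtr0_norm e0) -ltr_sqr ?nnegrE// !real_normK ?num_real//.
have li : l ord0 i ^+ 2 <= q2.
  by rewrite /q2 (bigD1 i)//= lerDl sumr_ge0// => j _; exact: sqr_ge0.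
have h5 : th / 2 * l ord0 i ^+ 2 <= s + eta.
  apply: (@le_trans _ _ (th / 2 * q2)); first by rewrite ler_wpM2l// divr_ge0// ltW.
  exact: le_trans hq hd2.
have -> : (th * l ord0 i) ^+ 2 = 2 * th * (th / 2 * l ord0 i ^+ 2) by field.
apply: (@le_lt_trans _ _ (2 * th * (s + eta))).
  by rewrite ler_wpM2l// mulr_ge0// ltW.
have -> : 2 * th * (s + eta) = e ^+ 2 / 2 by rewrite /th; field; rewrite gt_eqF.
by rewrite ltr_pdivrMr// ltr_pMr ?exprn_gt0// ltr1n.
Qed.

Variables (X : Type) (T : topologicalType) (p : E * E -> T) (Phi : (T -> R) -> X -> R).
Hypothesis p_cont : continuous p.

Definition lifts (P : PEE) (x : X) := forall f, Cb f -> Phi f x = integ P (f \o p).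

Hypothesis lifts_ex : forall P, exists x, lifts P x.

(** The common form of the four Gamma-limits: [p] is the identity for [S] and the second projection
    for [T], and [Phi] evaluates points of [C_b'] or of the probabilities. A point without lifts
    gets [+oo] as the infimum of the empty set; [lifts_ex] returns recovery measures to [X]. *)
Lemma Gamma_lim_lift : Gamma_lim (weak_nbhs (@Cb R T) Phi)
  (fun n x => ereal_inf [set Sk mu pik n P | P in [set P | lifts P x]])
  (fun x => ereal_inf [set Sc mu c P | P in [set P | lifts P x]]).
Proof.
set fk := fun n x => _; set g := fun x => _; move=> x.
have sup_le : (Glimsup (weak_nbhs (@Cb R T) Phi) fk x <= g x)%E.
  apply: le_ereal_inf_tmp => _ [rho hrho <-].
  rewrite /Sc; case: asboolP => [m1|_]; last exact: leey.
  have := cost_integral_ge0 rho; case hs : (\int[rho]_z c z.1 z.2)%E => [s||] // _; last exact: leey.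
  apply: ge_ereal_sup => _ [V [A [e [fA AC e0 AV]]] <-].
  apply/lee_addgt0Pr => eta eta0; apply: limn_esup_le_near.
  have fA' : finite_set [set f \o p | f in A] by exact: finite_image.
  have AC' : [set f \o p | f in A] `<=` @Cb R (E * E)%type.
    by move=> _ [f Af <-]; apply: Cb_comp => //; exact: AC.
  have hs' : (\int[rho]_z c z.1 z.2 <= s%:E)%E by rewrite hs.
  have := recovery m1 hs' fA' AC' e0 eta0; apply: filterS => n [P [hS hP]].
  have [x' hx'] := lifts_ex P.
  apply: le_trans hS; apply: (@le_trans _ _ (fk n x')).
    apply: ereal_inf_lbound; exists x' => //; apply: AV => f Af /=.
    by rewrite hx' ?hrho; [apply: hP; exists f|exact: AC|exact: AC].
  by apply: ereal_inf_lbound; exists P.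
have inf_ge : (g x <= Gliminf (weak_nbhs (@Cb R T) Phi) fk x)%E.
  rewrite leNgt; apply/negP => lt.
  have [a [ha1 ha2]] : exists a : R, (Gliminf (weak_nbhs (@Cb R T) Phi) fk x < a%:E)%E /\ (a%:E < g x)%E.
    move: lt; case: (Gliminf _ _ _) => [u||]; case: (g x) => [v||] // uv.
    - by exists ((u + v) / 2); move: uv; rewrite !lte_fin => uv; lra.
    - by exists (u + 1); rewrite lte_fin ltey ltrDl.
    - by exists (v - 1); rewrite lte_fin ltNye gtrBl.
    - by exists 0; rewrite ltNye ltey.
  have [|rho [m1 cost hrho]] := @liminf_coupling _ _ mu K c pik hFeller hLDP hgood hpi
      T p (Phi ^~ x) a p_cont.
    move=> A e N fA AC e0.
    pose V := [set y | forall f, A f -> `|Phi f y - Phi f x| < e].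
    have hV : (limn_einf (fun k => ereal_inf (fk k @` V)) < a%:E)%E.
      apply: le_lt_trans ha1; apply: ereal_sup_ubound; exists V => //.
      by exists A, e; split.
    have [n [Nn hn]] : exists n, (N <= n)%N /\ (ereal_inf (fk n @` V) < a%:E)%E.
      apply: contrapT => /forallNP h; move: hV; rewrite ltNge => /negP; apply.
      apply: limn_einf_ge_near; exists N => // n /= Nn.
      by rewrite leNgt; apply/negP => hn; apply: (h n).
    move/ereal_inf_lt : hn => [_ [y Vy <-]] /ereal_inf_lt[_ [P hP <-] hlt].
    exists n, P; split => //; first exact: ltW.
    by move=> f Af; rewrite -hP; [exact: Vy|exact: AC].
  have : (g x <= a%:E)%E.
    apply: le_trans cost; apply: ereal_inf_lbound; exists rho.
      by move=> f cf; rewrite hrho.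
    by rewrite /Sc asboolT.
  by rewrite leNgt ha2.
have inf_sup : (Gliminf (weak_nbhs (@Cb R T) Phi) fk x <= Glimsup (weak_nbhs (@Cb R T) Phi) fk x)%E.
  apply: ge_ereal_sup => _ [V hV <-]; apply: le_trans (limn_einf_sup _) _.
  by apply: ereal_sup_ubound; exists V.
split; apply/eqP; rewrite eq_le.
  by rewrite inf_ge (le_trans inf_sup).
by rewrite sup_le (le_trans inf_ge).
Qed.

End Gamma_convergence.

(** * Identification of the lifted infima with the functionals S and T *)

Section narrow_topology.
Context {R : realType} {d : nat}.
Local Notation E := 'rV[R]_d.
Local Notation PE := (probability (Borel E) R).
Local Notation PEE := (probability (Borel (E * E)%type) R).

Lemma integ_isCbDual (T : ptopologicalType) (P : probability (Borel T) R) :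
  isCbDual (fun f => if `[< Cb f >] then integ P f else 0).
Proof.
split.
- move=> f g a b cf cg; have ca := CbZ a cf; have cb := CbZ b cg.
  rewrite !asboolT//; last exact: CbD.
  have := RintD P (Cb_Bm ca) (Cb_Bm cb).
  by rewrite (RintZ P a (Cb_Bm cf)) (RintZ P b (Cb_Bm cg)).
- exists 1 => f M cf fM; rewrite asboolT// mul1r.
  by apply: Rint_norm_le => //; case: (Cb_Bm cf).
- by move=> f ncf; rewrite asboolF.
Qed.

Definition integ_dual (T : ptopologicalType) (P : probability (Borel T) R) :
  CbDual (R := R) T := exist _ _ (integ_isCbDual P).

Lemma integ_dual_represents (T : ptopologicalType) (P : probability (Borel T) R) :
  represents (integ_dual P) P.
Proof. by move=> f cf /=; rewrite asboolT. Qed.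

(** A [probability] also has values on non-measurable sets, which integrals do not see. Hence lifts
    along the identity are unique only up to agreement on measurable sets, and the functionals are
    shown invariant under it. *)
Lemma integ_eq_measure (rho rho' : PEE) : (forall f, Cb f -> integ rho f = integ rho' f) ->
  forall A, measurable A -> rho A = rho' A.
Proof.
have [q hq] := rV_separable R d; have [q2 hq2] := pair_separable hq.
by move=> H A mA; apply: (Borel_unique hq2).
Qed.

Lemma marg1_eq (mu : PE) (rho rho' : PEE) :
  (forall A, measurable A -> rho A = rho' A) -> marg1 rho mu -> marg1 rho' mu.
Proof.
move=> H m1 A mA; rewrite -m1// H//.
rewrite (_ : _ `*` _ = fstB @^-1` A).
  by rewrite -[X in measurable X]setTI; exact: fstB_measurable.
by apply/seteqP; split => [z []|z].
Qed.

Lemma relent_eq (rho rho' Q : PEE) : (forall A, measurable A -> rho A = rho' A) ->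
  relent rho Q = relent rho' Q.
Proof.
move=> H; rewrite /relent; congr ereal_inf; apply/seteqP.
by split => _ [f [mf f0 fE] <-]; exists f => //; split => // A mA; rewrite -fE// H.
Qed.

Lemma Sk_eq (mu : PE) (pik : nat -> PEE) n (rho rho' : PEE) :
  (forall A, measurable A -> rho A = rho' A) -> Sk mu pik n rho = Sk mu pik n rho'.
Proof.
move=> H; rewrite /Sk (relent_eq _ H).
have -> // : `[< marg1 rho mu >] = `[< marg1 rho' mu >].
by apply/asboolP/asboolP; apply: marg1_eq => // A mA; rewrite H.
Qed.

Lemma Sc_eq (mu : PE) (c : E -> E -> \bar R) (rho rho' : PEE) :
  (forall A, measurable A -> rho A = rho' A) -> Sc mu c rho = Sc mu c rho'.
Proof.
move=> H; rewrite /Sc (eq_measure_integral rho'); last by move=> A mA _; exact: H.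
have -> // : `[< marg1 rho mu >] = `[< marg1 rho' mu >].
by apply/asboolP/asboolP; apply: marg1_eq => // A mA; rewrite H.
Qed.

Lemma marg2_Cb (rho : PEE) (nu : PE) : marg2 rho nu <->
  forall f, Cb f -> integ nu f = integ rho (f \o snd).
Proof.
split=> [m2 f cf|H]; first by symmetry; exact: (marg2_Rint m2 (Cb_Bm cf)).
have [nu' m2] := marg2_exists rho; move=> B mB; rewrite m2//.
have [q hq] := rV_separable R d.
apply: (Borel_unique hq) => // f cf; rewrite H//; symmetry.
exact: (marg2_Rint m2 (Cb_Bm cf)).
Qed.

Lemma inf_lifts_id (F : PEE -> \bar R) (P : PEE) :
  (forall rho rho' : PEE, (forall A, measurable A -> rho A = rho' A) -> F rho = F rho') ->
  ereal_inf [set F rho | rho in [set rho | forall f, Cb f -> integ P f = integ rho (f \o id)]] = F P.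
Proof.
move=> Feq; apply/eqP; rewrite eq_le; apply/andP; split.
  by apply: ereal_inf_lbound; exists P.
apply: le_ereal_inf_tmp => _ [rho hrho <-]; rewrite (Feq P rho)//.
exact: integ_eq_measure.
Qed.

Lemma inf_lifts_snd (mu : PE) (H : PEE -> \bar R) (nu : PE) :
  ereal_inf [set (if `[< marg1 rho mu >] then H rho else +oo%E) |
    rho in [set rho : PEE | forall f, Cb f -> integ nu f = integ rho (f \o snd)]] =
  ereal_inf [set H rho | rho in [set rho | marg1 rho mu /\ marg2 rho nu]].
Proof.
apply/eqP; rewrite eq_le; apply/andP; split.
  apply: le_ereal_inf_tmp => _ [rho [m1 /marg2_Cb m2] <-].
  by apply: ereal_inf_lbound; exists rho => //; rewrite asboolT.
apply: le_ereal_inf_tmp => _ [rho /marg2_Cb m2 <-].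
case: asboolP => [m1|_]; last exact: leey.
by apply: ereal_inf_lbound; exists rho.
Qed.

Lemma inf_lifts_dual (mu : PE) (H : PEE -> \bar R) (L : CbDual (R := R) E) :
  ereal_inf [set (if `[< marg1 rho mu >] then H rho else +oo%E) |
    rho in [set rho : PEE | forall f, Cb f -> proj1_sig L f = integ rho (f \o snd)]] =
  to_dual (fun nu => ereal_inf [set H rho | rho in [set rho | marg1 rho mu /\ marg2 rho nu]]) L.
Proof.
apply/eqP; rewrite eq_le; apply/andP; split; apply: le_ereal_inf_tmp.
  move=> _ [nu Lnu <-]; rewrite -inf_lifts_snd; apply: le_ereal_inf_tmp => _ [rho hrho <-].
  by apply: ereal_inf_lbound; exists rho => // f cf; rewrite Lnu// hrho.
move=> _ [rho hrho <-]; have [nu m2] := marg2_exists rho.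
apply: (@le_trans _ _ (ereal_inf [set H rho | rho in [set rho | marg1 rho mu /\ marg2 rho nu]])).
  apply: ereal_inf_lbound; exists nu => // f cf.
  by rewrite hrho//; symmetry; exact: (marg2_Cb rho nu).1.
rewrite -inf_lifts_snd; apply: ereal_inf_lbound; exists rho => //.
exact: (marg2_Cb rho nu).1.
Qed.

End narrow_topology.

(** * Narrow convergence of sequences and the diagonal choice *)

Section narrow_sequences.
Context {R : realType} {T : normedModType R} (q : nat -> T).
Hypothesis q_dense : forall x (e : R), 0 < e -> exists n, `|x - q n| < e.
Local Notation PT := (probability (Borel T) R).

(** Maxima of arbitrary finite lists of tents, hence a countable family containing every [tent_max].
    It stands in for a metric of the narrow topology in the diagonal argument. *)
Definition tent_family (j : nat) (x : T) : R :=
  \big[Num.max/0]_(i <- odflt [::] (unpickle j : option (seq nat))) tent q i x.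

Lemma tent_family_Cb j : Cb (tent_family j).
Proof. by apply: Cb_bigmax => i; exact: tent_Cb. Qed.

Lemma tent_max_family P n : exists j, tent_max q P n = tent_family j.
Proof.
exists (pickle [seq i <- index_iota 0 n | P i]); apply/funext => x.
by rewrite /tent_family pickleK/= /tent_max big_filter big_mkord.
Qed.

Let narrow_lower (nu_ : nat -> PT) (nu : PT) :
  (forall j, integ (nu_ n) (tent_family j) @[n --> \oo] --> integ nu (tent_family j)) ->
  forall f, Cb f -> (forall x, 0 <= f x) -> forall e : R, 0 < e ->
  \forall n \near \oo, integ nu f <= integ (nu_ n) f + e.
Proof.
move=> H f cf f0 e e0; have [cf' [M fM]] := cf.
have cl (a : R) : closed [set x | ((f x)%:E <= a%:E)%E].
  rewrite (_ : [set x | _] = f @^-1` [set y | y <= a]).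
    by apply: preimage_closed => //; exact: closed_le.
  by apply/seteqP; split => x /=; rewrite lee_fin.
have f0' x : (0 <= (f x)%:E)%E by rewrite lee_fin.
have [P [Pf Pcvg]] := lsc_tent_max q_dense f0' cl.
have tB n : Bm (tent_max q P n : Borel T -> R) by apply: Cb_Bm; exact: tent_max_Cb.
have e20 : 0 < e / 2 by rewrite divr_gt0.
have tM n x : `|tent_max q P n x| <= M.
  rewrite ger0_norm ?tent_max_ge0// (le_trans _ (fM x))// (le_trans _ (ler_norm _))//.
  by rewrite -lee_fin.
have tcvg x : tent_max q P n x @[n --> \oo] --> f x by exact: (fine_cvg (Pcvg x)).
have [|_ _] := @Rint_dct _ (Borel T) R nu (tent_max q P) f M _ tM tcvg.
  by move=> n; case: (tB n).
move=> /cvgrPdist_le/(_ _ e20)[m _ /(_ m (leqnn m))] /= hm.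
have [j tj] := tent_max_family P m.
have := H j; rewrite -tj => /cvgrPdist_le/(_ _ e20); apply: filterS => n hn.
have h1 : integ (nu_ n) (tent_max q P m) <= integ (nu_ n) f.
  by apply: Rint_le; [exact: tB|exact: Cb_Bm|move=> x; rewrite -lee_fin].
have h2 := le_trans (ler_norm _) hm; have h3 := le_trans (ler_norm _) hn.
rewrite -[\int[nu]_x f x]/(integ nu f) -[\int[nu]_x _]/(integ nu (tent_max q P m)) in h2.
move: h1 h2 h3.
move: (integ nu f) (integ nu _) (integ (nu_ n) f) (integ (nu_ n) _) => a b a' b'; lra.
Qed.

(** [narrow_lower] gives one-sided bounds for nonnegative functions, by approximation from below;
    applied to [f + M] and [M - f] it gives both sides. *)
Lemma tent_family_narrow (nu_ : nat -> PT) (nu : PT) :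
  (forall j, integ (nu_ n) (tent_family j) @[n --> \oo] --> integ nu (tent_family j)) ->
  forall f, Cb f -> integ (nu_ n) f @[n --> \oo] --> integ nu f.
Proof.
move=> H f cf; have [_ [M fM]] := cf; apply/cvgrPdist_le => e e0.
have shift (P : PT) : integ P (fun x => f x + M) = integ P f + M.
  by rewrite /integ; have := RintD P (Cb_Bm cf) (Bm_cst M); rewrite Rint_cst.
have shiftN (P : PT) : integ P (fun x => M - f x) = M - integ P f.
  by rewrite /integ; have := RintB P (Bm_cst M) (Cb_Bm cf); rewrite Rint_cst.
have c1 : Cb (fun x => f x + M) by apply: CbD => //; exact: Cb_cst.
have c2 : Cb (fun x => M - f x) by apply: CbB => //; exact: Cb_cst.
have p1 x : 0 <= f x + M by have := fM x; rewrite ler_norml => /andP[]; lra.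
have p2 x : 0 <= M - f x by have := fM x; rewrite ler_norml => /andP[]; lra.
have := narrow_lower H c2 p2 e0; have := narrow_lower H c1 p1 e0.
apply: filterS2 => n; rewrite !shift !shiftN.
move: (integ nu f) (integ (nu_ n) f) => a b h1 h2.
by rewrite ler_norml; apply/andP; split; lra.
Qed.

End narrow_sequences.

Lemma cvge_of_bounds {R : realType} (u : nat -> \bar R) (t : R) :
  (forall e : R, 0 < e -> \forall n \near \oo, ((t - e)%:E <= u n <= (t + e)%:E)%E) ->
  u n @[n --> \oo] --> t%:E.
Proof.
move=> H; apply/fine_cvgP; split.
  apply: filterS (H 1 ltr01) => n /andP[h1 h2]; rewrite fin_numE.
  by apply/andP; split; apply/eqP => un; rewrite un in h1 h2.
apply/cvgrPdist_le => e e0; apply: filterS (H e e0) => n /=.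
case: (u n) => [r|/andP[]|/andP[]]//; rewrite !lee_fin /= => /andP[h1 h2].
by rewrite ler_norml; apply/andP; split; lra.
Qed.

Section recovery_sequence.
Context {R : realType} {T : normedModType R} (q : nat -> T).
Hypothesis q_dense : forall x (e : R), 0 < e -> exists n, `|x - q n| < e.
Local Notation PT := (probability (Borel T) R).
Variables (F : nat -> PT -> \bar R) (G : PT -> \bar R).
Hypotheses (FG : Gamma_lim (@narrow_nbhs R T) F G) (G0 : forall nu, (0 <= G nu)%E).

Let narrow_self (nu : PT) V : narrow_nbhs nu V -> V nu.
Proof. by move=> [A [e [_ _ e0 AV]]]; apply: AV => f _; rewrite subrr normr0. Qed.

Let eventually_gt (nu : PT) (a : \bar R) : (a < G nu)%E ->
  exists2 V, narrow_nbhs nu V & \forall n \near \oo, forall nu', V nu' -> (a < F n nu')%E.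
Proof.
have [<- _] := FG nu; move=> /ereal_sup_gt[_ [V nV <-] /limn_einf_gt_near aV].
exists V => //; apply: filterS aV => n an nu' Vnu'; apply: lt_le_trans an _.
by apply: ereal_inf_lbound; exists nu'.
Qed.

Let eventually_lt (nu : PT) (b : \bar R) V : (G nu < b)%E -> narrow_nbhs nu V ->
  \forall n \near \oo, exists2 nu', V nu' & (F n nu' < b)%E.
Proof.
have [_ <-] := FG nu => Gb nV.
have : (limn_esup (fun n => ereal_inf (F n @` V)) < b)%E.
  by apply: le_lt_trans Gb; apply: ereal_sup_ubound; exists V.
move/limn_esup_lt_near; apply: filterS => n /ereal_inf_lt[_ [nu' Vnu' <-] h].
by exists nu'.
Qed.

Let narrow_eventually (nu_ : nat -> PT) (nu : PT) V :
  (forall f, Cb f -> integ (nu_ n) f @[n --> \oo] --> integ nu f) ->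
  narrow_nbhs nu V -> \forall n \near \oo, V (nu_ n).
Proof.
move=> H [A [e [/finite_seqP[s As] AC e0 AV]]].
suff : \forall n \near \oo, forall f, f \in s -> `|integ (nu_ n) f - integ nu f| < e.
  by apply: filterS => n hn; apply: AV => f; rewrite As; exact: hn.
have sC f : f \in s -> Cb f by move=> fs; apply: AC; rewrite As.
elim: s {As} sC => [|g s ih] sC; first by apply: nearW => n f; rewrite in_nil.
have near_g : \forall n \near \oo, `|integ (nu_ n) g - integ nu g| < e.
  have /cvgrPdist_lt/(_ _ e0) := H g (sC g (mem_head _ _)).
  by apply: filterS => n; rewrite distrC.
have near_s : \forall n \near \oo, forall f, f \in s -> `|integ (nu_ n) f - integ nu f| < e.
  by apply: ih => f fs; apply: sC; rewrite in_cons fs orbT.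
apply: filterS2 near_g near_s => n hg hs f; rewrite in_cons => /orP[/eqP ->//|].
exact: hs.
Qed.

Lemma Gamma_recovery_sequence (nu : PT) : exists nuk : nat -> PT,
  (forall f, Cb f -> integ (nuk n) f @[n --> \oo] --> integ nu f) /\
  F n (nuk n) @[n --> \oo] --> G nu.
Proof.
case Gt : (G nu) (G0 nu) => [t||] // t0; last first.
  (* At infinite value the constant sequence works: the lower Gamma-limit already forces [F n nu] to
     infinity. *)
  exists (fun=> nu); split; first by move=> f _; exact: cvg_cst.
  apply/cvgeyPge => a; have [|V nV hV] := @eventually_gt nu a%:E; first by rewrite Gt ltry.
  by apply: filterS hV => n /(_ nu (narrow_self nV))/ltW.
pose W m := [set nu' : PT | forall j, (j <= m)%N ->
  `|integ nu' (tent_family q j) - integ nu (tent_family q j)| < m.+1%:R^-1].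
pose good m n nu' := W m nu' /\ (F n nu' < (t + m.+1%:R^-1)%:E)%E.
have inv0 m : 0 < m.+1%:R^-1 :> R by rewrite invr_gt0 ltr0n.
have inv_le m m' : (m <= m')%N -> m'.+1%:R^-1 <= m.+1%:R^-1 :> R.
  by move=> mm; rewrite lef_pV2 ?posrE ?ltr0n// ler_nat.
have good_le m m' n nu' : (m <= m')%N -> good m' n nu' -> good m n nu'.
  move=> mm [hW hF]; split.
    move=> j jm; apply: lt_le_trans (hW j (leq_trans jm mm)) (inv_le _ _ mm).
  by apply: lt_le_trans hF _; rewrite lee_fin lerD2l inv_le.
have nW m : narrow_nbhs nu (W m).
  exists [set tent_family q j | j in `I_m.+1], m.+1%:R^-1; split => //.
  - exact: finite_image.
  - by move=> _ [j _ <-]; exact: tent_family_Cb.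
  - by move=> nu' h j jm; apply: h; exists j.
have good_near m : \forall n \near \oo, exists nu', good m n nu'.
  have := @eventually_lt nu (t + m.+1%:R^-1)%:E (W m) _ (nW m).
  rewrite Gt lte_fin ltrDl => /(_ (inv0 m)).
  by apply: filterS => n [nu' h1 h2]; exists nu'.
(* Goodness at precision [m] implies goodness at all coarser ones, so a witness at the finest
   attainable precision up to [N] serves all. Taking [N = n], every fixed precision is eventually
   reached. *)
have pick n N : exists nu', forall m, (m <= N)%N -> (exists nu'', good m n nu'') -> good m n nu'.
  elim: N => [|N [nu' ih]].
    have [[nu' h]|h] := pselect (exists nu'', good 0%N n nu''); last first.
      by exists nu => m; rewrite leqn0 => /eqP -> /h.
    by exists nu' => m; rewrite leqn0 => /eqP -> _.
  have [[nu'' h]|h] := pselect (exists nu'', good N.+1 n nu'').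
    by exists nu'' => m mN _; exact: good_le h.
  by exists nu' => m; rewrite leq_eqVlt => /orP[/eqP -> /h //|]; exact: ih.
have /choice[nuk hnuk] := fun n => pick n n.
have near_good m : \forall n \near \oo, good m n (nuk n).
  have large : \forall n \near \oo, (m <= n)%N by exists m.
  by apply: filterS2 large (good_near m) => n mn; exact: hnuk.
have small e : 0 < e -> exists m : nat, m.+1%:R^-1 < e :> R.
  move=> e0; exists (Num.truncn e^-1).
  by rewrite invf_plt ?posrE ?ltr0n//; exact: truncnS_gt.
have nukcvg f : Cb f -> integ (nuk n) f @[n --> \oo] --> integ nu f.
  apply: (tent_family_narrow q_dense) => j; apply/cvgrPdist_lt => e e0.
  have [m me] := small e e0.
  apply: filterS (near_good (maxn j m)) => n [hW _]; rewrite distrC.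
  apply: lt_trans (hW j (leq_maxl _ _)) (le_lt_trans _ me).
  exact: inv_le (leq_maxr _ _).
exists nuk; split => //; apply: cvge_of_bounds => e e0.
have [V nV hV] : exists2 V, narrow_nbhs nu V &
    \forall n \near \oo, forall nu', V nu' -> ((t - e)%:E < F n nu')%E.
  by apply: eventually_gt; rewrite Gt lte_fin gtrBl.
have [m me] := small e e0.
have nukV := narrow_eventually nukcvg nV.
apply: filterS3 hV nukV (near_good m) => n h1 h2 [_ h3].
rewrite (ltW (h1 _ h2))/= (le_trans (ltW h3))// lee_fin lerD2l.
exact: ltW.
Qed.

End recovery_sequence.

Unset Implicit Arguments. Set Strict Implicit. Set Printing Implicit Defensive.

Theorem mainTheorem4 (R : realType) (d : nat)
  (mu : probability (Borel 'rV[R]_d) R)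
  (K : nat -> 'rV[R]_d -> probability (Borel 'rV[R]_d) R)
  (c : 'rV[R]_d -> 'rV[R]_d -> \bar R)
  (z : nat -> nat -> 'rV[R]_d)
  (pik : nat -> probability (Borel ('rV[R]_d * 'rV[R]_d)%type) R)
  (hFeller : forall n, feller (K n))
  (hLDP : forall x, kLDP (fun n => K n x) (c x))
  (hgood : forall x, good_rate (c x))
  (hz : forall f, Cb f ->
     (fun n => n.+1%:R^-1 * \sum_(i < n.+1) f (z n i)) @ \oo --> integ mu f)
  (hpi : forall n (A B : set (Borel 'rV[R]_d)), measurable A -> measurable B ->
     pik n (A `*` B) = (\int[mu]_(x in A) K n x B)%E) :
  [/\ Gamma_lim (@weakstar_nbhs R _) (fun n => to_dual (Sk mu pik n))
                (to_dual (Sc mu c))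
    /\ Gamma_lim (@narrow_nbhs R _) (Sk mu pik) (Sc mu c),
      Gamma_lim (@weakstar_nbhs R _) (fun n => to_dual (Tk mu pik n))
                (to_dual (Tc mu c))
    /\ Gamma_lim (@narrow_nbhs R _) (Tk mu pik) (Tc mu c)
    & forall nu : probability (Borel 'rV[R]_d) R,
      exists nuk : nat -> probability (Borel 'rV[R]_d) R,
        (forall f, Cb f -> (fun n => integ (nuk n) f) @ \oo --> integ nu f) /\
        (fun n => Tk mu pik n (nuk n)) @ \oo --> Tc mu c nu].
Proof.
have lift := Gamma_lim_lift hFeller hLDP hgood hpi.
have idC : continuous (@id ('rV[R]_d * 'rV[R]_d)%type) by move=> x; exact: cvg_id.
have sndC : continuous (@snd 'rV[R]_d 'rV[R]_d) by move=> x; exact: cvg_snd.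
have Tnarrow : Gamma_lim (@narrow_nbhs R _) (Tk mu pik) (Tc mu c).
  have -> : Tk mu pik = fun n nu => ereal_inf [set Sk mu pik n P |
      P in [set P | lifts snd (fun f nu => integ nu f) P nu]].
    apply/funext => n; apply/funext => nu; symmetry.
    exact: (inf_lifts_snd mu (fun P => (n.+1%:R^-1)%:E * relent P (pik n))%E nu).
  have -> : Tc mu c = fun nu => ereal_inf [set Sc mu c P |
      P in [set P | lifts snd (fun f nu => integ nu f) P nu]].
    apply/funext => nu; symmetry.
    exact: (inf_lifts_snd mu (fun P => \int[P]_p c p.1 p.2)%E nu).
  apply: lift => // P; have [nu m2] := marg2_exists P.
  by exists nu; exact: (marg2_Cb P nu).1.
split; [split|split => //|].
(* For [p = id] the predicate [lifts] unfolds to [represents], so the lifted infimum is [to_dual] by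
   conversion. *)
- apply: (lift _ _ id (fun f L => proj1_sig L f) idC) => P.
  by exists (integ_dual P); exact: integ_dual_represents.
- have -> : Sk mu pik = fun n P' => ereal_inf [set Sk mu pik n P |
      P in [set P | lifts id (fun f P' => integ P' f) P P']].
    apply/funext => n; apply/funext => P; symmetry.
    by apply: inf_lifts_id => rho rho'; exact: Sk_eq.
  have -> : Sc mu c = fun P' => ereal_inf [set Sc mu c P |
      P in [set P | lifts id (fun f P' => integ P' f) P P']].
    apply/funext => P; symmetry.
    by apply: inf_lifts_id => rho rho'; exact: Sc_eq.
  by apply: lift => // P; exists P.
- have -> : (fun n => to_dual (Tk mu pik n)) = fun n L => ereal_inf [set Sk mu pik n P |
      P in [set P | lifts snd (fun f (L : CbDual 'rV[R]_d) => proj1_sig L f) P L]].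
    apply/funext => n; apply/funext => L; symmetry.
    exact: (inf_lifts_dual mu (fun P => (n.+1%:R^-1)%:E * relent P (pik n))%E L).
  have -> : to_dual (Tc mu c) = fun L => ereal_inf [set Sc mu c P |
      P in [set P | lifts snd (fun f (L : CbDual 'rV[R]_d) => proj1_sig L f) P L]].
    apply/funext => L; symmetry.
    exact: (inf_lifts_dual mu (fun P => \int[P]_p c p.1 p.2)%E L).
  apply: lift => // P; have [nu m2] := marg2_exists P.
  exists (integ_dual nu) => f cf; rewrite integ_dual_represents//.
  exact: (marg2_Cb P nu).1.
- have [q hq] := rV_separable R d => nu.
  apply: (Gamma_recovery_sequence hq Tnarrow) => nu'.
  by apply: le_ereal_inf_tmp => _ [rho _ <-]; exact: cost_integral_ge0.
Qed.
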